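(* Let $\Omega\subset\mathbb{R}^2$ be a bounded, convex domain which is centrally symmetric, and whose boundary $\partial\Omega$ is connected and of class $C^{2,\varepsilon}$ for some $\varepsilon\in(0,1)$. Then there is a constant $\alpha^*=\alpha^*(\Omega)>0$ with the following property: if for some $\alpha>\alpha^*$ there exists a nontrivial function $u$ solving the overdetermined problem $$\Delta u+\alpha u=0 \text{ in } \Omega,\qquad u=0 \text{ on } \partial\Omega,\qquad \partial_\nu u=c \text{ on }\partial\Omega$$ for some constant $c$, then $\Omega$ is a disk.
   Context: $\nu$ denotes the unit outer normal to $\partial\Omega$. A domain $\Omega$ is centrally symmetric if there is a point $O$ such that $\Omega$ is invariant under the rotation by $180^\circ$ about $O$ (i.e. $x\mapsto 2O-x$). *)

(* Defs.v *)
From Stdlib Require Import Reals.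
From Coquelicot Require Import Coquelicot.
Open Scope R_scope.

Definition pt := (R * R)%type.

Definition dist2 (p q : pt) : R :=
  sqrt ((fst p - fst q) ^ 2 + (snd p - snd q) ^ 2).

Definition open2 (S : pt -> Prop) : Prop :=
  forall p, S p -> exists e, 0 < e /\ forall q, dist2 q p < e -> S q.

Definition closure2 (S : pt -> Prop) (p : pt) : Prop :=
  forall e, 0 < e -> exists q, S q /\ dist2 q p < e.

Definition boundary2 (S : pt -> Prop) (p : pt) : Prop :=
  closure2 S p /\ closure2 (fun q => ~ S q) p.

Definition bounded2 (S : pt -> Prop) : Prop :=
  exists M, forall p, S p -> dist2 p (0, 0) <= M.

Definition convex2 (S : pt -> Prop) : Prop :=
  forall p q t, S p -> S q -> 0 <= t <= 1 ->
    S (fst p + t * (fst q - fst p), snd p + t * (snd q - snd p)).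

Definition centrally_symmetric (S : pt -> Prop) : Prop :=
  exists O : pt, forall x : pt,
    S x <-> S (2 * fst O - fst x, 2 * snd O - snd x).

Definition connected2 (S : pt -> Prop) : Prop :=
  ~ exists U V : pt -> Prop,
      open2 U /\ open2 V /\
      (forall p, S p -> U p \/ V p) /\
      (exists p, S p /\ U p) /\ (exists p, S p /\ V p) /\
      (forall p, S p -> U p -> V p -> False).

Definition is_disk (S : pt -> Prop) : Prop :=
  exists (C : pt) (rho : R), 0 < rho /\ forall x, S x <-> dist2 x C < rho.

Definition cont_within (S : pt -> Prop) (f : pt -> R) (p : pt) : Prop :=
  forall e, 0 < e -> exists d, 0 < d /\
    forall q, S q -> dist2 q p < d -> Rabs (f q - f p) < e.

Definition ex_px (f : pt -> R) (p : pt) : Prop := ex_derive (fun t => f (t, snd p)) (fst p).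
Definition ex_py (f : pt -> R) (p : pt) : Prop := ex_derive (fun t => f (fst p, t)) (snd p).
Definition px (f : pt -> R) (p : pt) : R := Derive (fun t => f (t, snd p)) (fst p).
Definition py (f : pt -> R) (p : pt) : R := Derive (fun t => f (fst p, t)) (snd p).

Definition laplacian (u : pt -> R) (p : pt) : R := px (px u) p + py (py u) p.

Definition C2_on (S : pt -> Prop) (u : pt -> R) : Prop :=
  forall p, S p ->
    ex_px u p /\ ex_py u p /\
    ex_px (px u) p /\ ex_py (px u) p /\ ex_px (py u) p /\ ex_py (py u) p /\
    cont_within (fun _ => True) u p /\
    cont_within (fun _ => True) (px u) p /\ cont_within (fun _ => True) (py u) p /\
    cont_within (fun _ => True) (px (px u)) p /\ cont_within (fun _ => True) (py (px u)) p /\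
    cont_within (fun _ => True) (px (py u)) p /\ cont_within (fun _ => True) (py (py u)) p.

(* Local coordinates at p in the frame rotated by angle th *)
Definition loc_xi (p : pt) (th : R) (q : pt) : R :=
  cos th * (fst q - fst p) + sin th * (snd q - snd p).
Definition loc_eta (p : pt) (th : R) (q : pt) : R :=
  - sin th * (fst q - fst p) + cos th * (snd q - snd p).

Definition C1_chart (Om : pt -> Prop) (p : pt) (th r : R) (g : R -> R) : Prop :=
  0 < r /\ g 0 = 0 /\
  (forall s, -r < s < r -> ex_derive g s) /\
  (forall s, -r < s < r -> continuous (Derive g) s) /\
  (forall q, Rabs (loc_xi p th q) < r -> Rabs (loc_eta p th q) < r ->
     (Om q <-> g (loc_xi p th q) < loc_eta p th q)).

Definition holder_on (a b eps : R) (h : R -> R) : Prop :=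
  exists K, 0 <= K /\ forall s t, a < s < b -> a < t < b -> s <> t ->
    Rabs (h s - h t) <= K * Rpower (Rabs (s - t)) eps.

Definition C2eps_chart (Om : pt -> Prop) (eps : R) (p : pt) (th r : R) (g : R -> R) : Prop :=
  C1_chart Om p th r g /\
  (forall s, -r < s < r -> ex_derive (Derive g) s) /\
  holder_on (- r) r eps (Derive (Derive g)).

Definition boundary_C2eps (Om : pt -> Prop) (eps : R) : Prop :=
  forall p, boundary2 Om p -> exists th r g, C2eps_chart Om eps p th r g.

(* unit outer normal at p computed from a chart (th, g): in local coordinates
   it is (g'(0), -1)/sqrt(1+g'(0)^2) *)
Definition chart_normal (th : R) (g : R -> R) : pt :=
  let d := Derive g 0 in
  let s := sqrt (1 + d ^ 2) in
  ((d * cos th + sin th) / s, (d * sin th - cos th) / s).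

(* u in C^2(Omega) /\ C^1(closure2 Omega) is a classical solution of
   Delta u + alpha u = 0 in Omega, u = 0 on bd Omega, d_nu u = c on bd Omega.
   G1, G2 are the continuous extensions of the gradient to the closure2. *)
Definition overdetermined_solution (Om : pt -> Prop) (alpha c : R) (u : pt -> R) : Prop :=
  exists G1 G2 : pt -> R,
    C2_on Om u /\
    (forall p, Om p -> laplacian u p + alpha * u p = 0) /\
    (forall p, Om p -> G1 p = px u p /\ G2 p = py u p) /\
    (forall p, closure2 Om p ->
       cont_within (closure2 Om) u p /\ cont_within (closure2 Om) G1 p /\
       cont_within (closure2 Om) G2 p) /\
    (forall p, boundary2 Om p -> u p = 0) /\
    (forall p th r g, boundary2 Om p -> C1_chart Om p th r g ->
       G1 p * fst (chart_normal th g) + G2 p * snd (chart_normal th g) = c).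

(* Main.v *)
Require Import Defs.
From Stdlib Require Import Reals Lra Lia Classical ClassicalEpsilon.
From Coquelicot Require Import Coquelicot.
Open Scope R_scope.

(** Put the centre of symmetry at the origin, let [k = sqrt alpha], and for a unit vector [w] let [h(w)]
    be the maximum of [w.y] over the closure of the domain. In coordinates [(x, t)] with [t] the height along [w],
    the domain is [l(t) < x < r(t)], [-h < t < h]. Green's identity with the solution [cos (k t)]
    of the Helmholtz equation, applied slice by slice, shows that
    [B(t) = int_l^r (cos(k t) u_t + k sin(k t) u) dx] satisfies
    [B' = - c cos(k t) (sqrt (1 + l'^2) + sqrt (1 + r'^2))].

    Suppose [sin (k h(w)) = 1]. Then [cos (k t)] vanishes at both tips, so [B] tends to [0] there.
    On the other hand [r'] is monotone, so [sqrt (1 + r'^2)] is a sum of a nondecreasing and a nonincreasing function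
    (minus 1), and integration by parts against [sin (k t) - 1 <= 0] (resp. [sin (k t) + 1 >= 0]) gives
    [int k cos (k t) sqrt (1 + r'^2) >= 2], and likewise for [l]; hence [c = 0]. If [c = 0], then the whole
    gradient of [u] vanishes on the boundary and a Rellich identity gives [u = 0].

    So [k h(w)] never equals [PI / 2] modulo [2 PI]. As [h] is continuous, [k (h(w) - h(w')) <= 2 PI] for all
    [w, w']; when [h] is not constant this bounds [alpha], and when [h] is constant the domain is a disk. *)

(** * Oscillatory integrals of monotone functions *)

(** Hence slices are inset horizontally, and the height is cut at [- s] and [s] with [s < h]. The
    cut is harmless: at distance tau from a tip the factor [1 - sin (k t)] is of order tau^2, while
    convexity bounds the slopes by a multiple of 1 / tau.

    The phase must be PI / 2 and not 3 PI / 2 modulo 2 PI: both kill [cos (k t)] at the tips, but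
    only the first leaves boundary terms of the right sign in the integration by parts.

    Central symmetry puts the tips at the opposite heights h and - h, so that [cos (k t)] vanishes
    at both at once. It also makes h half the width; a body of constant width need not be a disk,
    but one with a centre is.

    Once c = 0, the normal derivative vanishes on the boundary by hypothesis and the tangential one
    because u = 0 there; this is what the Rellich identity needs. *)

(** Over [N] equal pieces the defects telescope to [K * (b - a) * (f b - f a) / N], which tends to
    0. This stands in for Stieltjes integration against a monotone [f] that need not be
    differentiable. *)
Lemma nondecreasing_of_small_defect (F f : R -> R) (a b K : R) :
  a <= b -> 0 <= K ->
  (forall x y, a <= x <= b -> a <= y <= b -> x <= y -> - (K * (y - x) * (f y - f x)) <= F y - F x) ->
  F a <= F b.
Proof.
intros Hab HK H.
destruct (Rle_or_lt (F a) (F b)) as [|Hlt]; [assumption|exfalso].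
set (D := K * (b - a) * (f b - f a)).
destruct (archimed_cor1 ((F a - F b) / (Rabs D + 1))) as [N [HN1 HN2]].
{ pose proof (Rabs_pos D); apply Rdiv_lt_0_compat; lra. }
assert (HN : 0 < INR N) by (apply lt_0_INR; lia).
set (d := (b - a) / INR N).
assert (Hd : 0 <= d) by (unfold d; apply Rdiv_le_0_compat; lra).
assert (HNd : INR N * d = b - a) by (unfold d; field; lra).
assert (Hi : forall i, (i <= N)%nat ->
  - (K * d * (f (a + INR i * d) - f a)) <= F (a + INR i * d) - F a).
{ induction i as [|i IH]; intros Hi.
  - simpl. replace (a + 0 * d) with a by ring. lra.
  - specialize (IH ltac:(lia)).
    pose proof (le_INR _ _ Hi) as Hi'. rewrite S_INR in *.
    pose proof (pos_INR i).
    assert (H1 := H (a + INR i * d) (a + (INR i + 1) * d)).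
    replace (a + (INR i + 1) * d - (a + INR i * d)) with d in H1 by ring.
    assert (H2 : - (K * d * (f (a + (INR i + 1) * d) - f (a + INR i * d)))
      <= F (a + (INR i + 1) * d) - F (a + INR i * d)) by (apply H1; nra).
    lra. }
specialize (Hi N (le_n N)). rewrite HNd in Hi.
replace (a + (b - a)) with b in Hi by ring.
assert (HD : K * d * (f b - f a) = D * / INR N) by (unfold d, D; field; lra).
rewrite HD in Hi.
pose proof (Rle_abs D); pose proof (Rabs_pos D).
apply Rmult_lt_compat_r with (r := Rabs D + 1) in HN1; [|lra].
replace ((F a - F b) / (Rabs D + 1) * (Rabs D + 1)) with (F a - F b) in HN1 by (field; lra).
pose proof (Rinv_0_lt_compat _ HN).
nra.
Qed.

Lemma continuous_kcos (k t : R) : continuous (fun t => k * cos (k * t)) t.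
Proof. apply (ex_derive_continuous (fun t => k * cos (k * t))). auto_derive; auto. Qed.

(* Integrating by parts against [sin (k t) - 1 <= 0] leaves a Stieltjes integral of the right sign. *)
Lemma RInt_cos_nondecreasing (f : R -> R) (a b k : R) :
  a <= b -> 0 <= k ->
  (forall t, a <= t <= b -> continuous f t) ->
  (forall t t', a <= t <= t' -> t' <= b -> f t <= f t') ->
  (1 - sin (k * a)) * f a - (1 - sin (k * b)) * f b
    <= RInt (fun t => k * cos (k * t) * f t) a b.
Proof.
intros Hab Hk Hc Hm.
assert (Hcg : forall t, a <= t <= b -> continuous (fun t => k * cos (k * t) * f t) t).
{ intros t Ht. apply (continuous_mult (fun t => k * cos (k * t)) f); auto using continuous_kcos. }
assert (Hex : forall x y, a <= x -> x <= y -> y <= b -> ex_RInt (fun t => k * cos (k * t) * f t) x y).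
{ intros x y H1 H2 H3. apply (ex_RInt_continuous (V:=R_CompleteNormedModule)); intros z Hz.
  rewrite Rmin_left, Rmax_right in Hz by lra. apply Hcg; lra. }
(* Formally [F x - F a] is the Stieltjes integral of [1 - sin (k t)] against [df] from [a] to
   [x]. *)
set (F := fun x => RInt (fun t => k * cos (k * t) * f t) a x + (1 - sin (k * x)) * f x).
assert (HF : F a <= F b).
{ apply (nondecreasing_of_small_defect F f a b k); auto; try lra.
  intros x y Hx Hy Hxy.
  unfold F.
  rewrite <- (RInt_Chasles (fun t => k * cos (k * t) * f t) a x y) by (apply Hex; lra).
  unfold plus; simpl.
  assert (Hs : is_RInt (fun t => k * cos (k * t)) x y (sin (k * y) - sin (k * x))).
  { apply (is_RInt_derive (fun t => sin (k * t))).
    - intros z _; auto_derive; auto; ring.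
    - intros z _; apply continuous_kcos. }
  (* Freezing [f] at the right end [y] leaves [(1 - sin (k * x)) * (f y - f x)], which is
     nonnegative, and an error of at most [k * (y - x) * (f y - f x)]. *)
  assert (E : RInt (fun t => k * cos (k * t) * f t) x y
     = RInt (fun t => k * cos (k * t) * (f t - f y)) x y + (sin (k * y) - sin (k * x)) * f y).
  { rewrite <- (is_RInt_unique _ _ _ _ Hs).
    rewrite Rmult_comm, <- (RInt_scal (V:=R_CompleteNormedModule)) by (eexists; apply Hs).
    rewrite <- (RInt_plus (V:=R_CompleteNormedModule)).
    - apply RInt_ext; intros; unfold plus, scal; simpl; unfold mult; simpl; ring.
    - apply (ex_RInt_ext (fun t => minus (k * cos (k * t) * f t) (scal (f y) (k * cos (k * t))))).
      + intros; unfold minus, plus, opp, scal; simpl; unfold mult; simpl; ring.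
      + apply (ex_RInt_minus (V:=R_NormedModule)); [apply Hex; lra|].
        apply (ex_RInt_scal (V:=R_NormedModule)); eexists; apply Hs.
    - apply (ex_RInt_scal (V:=R_NormedModule)); eexists; apply Hs. }
  rewrite E.
  assert (Hb : Rabs (RInt (fun t => k * cos (k * t) * (f t - f y)) x y)
    <= (y - x) * (k * (f y - f x))).
  { apply abs_RInt_le_const; auto.
    - apply (ex_RInt_continuous (V:=R_CompleteNormedModule)); intros z Hz.
      rewrite Rmin_left, Rmax_right in Hz by lra.
      apply (continuous_mult (fun t => k * cos (k * t)) (fun t => f t - f y)).
      + apply continuous_kcos.
      + apply (continuous_minus f (fun _ => f y)); [apply Hc; lra|apply continuous_const].
    - intros t Ht. rewrite !Rabs_mult, (Rabs_pos_eq k) by lra.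
      assert (H1 : Rabs (cos (k * t)) <= 1) by (apply Rabs_le, COS_bound).
      assert (H2 : Rabs (f t - f y) <= f y - f x).
      { pose proof (Hm x t ltac:(lra) ltac:(lra)). pose proof (Hm t y ltac:(lra) ltac:(lra)).
        apply Rabs_le; lra. }
      rewrite Rmult_assoc. apply Rmult_le_compat_l; [lra|].
      replace (f y - f x) with (1 * (f y - f x)) by ring.
      apply Rmult_le_compat; auto using Rabs_pos. }
  apply Rabs_le_between in Hb.
  pose proof (Hm x y ltac:(lra) ltac:(lra)).
  pose proof (SIN_bound (k * x)).
  nra. }
unfold F in HF. rewrite RInt_point in HF. unfold zero in HF; simpl in HF. lra.
Qed.

(** Reflection in 0 preserves [cos (k t)], reverses monotonicity and changes the sign of
    [sin (k t)], which reduces this to the nondecreasing case. *)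
Lemma RInt_cos_nonincreasing (f : R -> R) (s k : R) :
  0 <= s -> 0 <= k ->
  (forall t, - s <= t <= s -> continuous f t) ->
  (forall t t', - s <= t <= t' -> t' <= s -> f t' <= f t) ->
  (1 + sin (k * s)) * f s - (1 - sin (k * s)) * f (- s)
    <= RInt (fun t => k * cos (k * t) * f t) (- s) s.
Proof.
intros Hs Hk Hc Hm.
assert (E : RInt (fun t => k * cos (k * t) * f (- t)) (- s) s
  = RInt (fun t => k * cos (k * t) * f t) (- s) s).
{ transitivity (RInt (fun y => scal (-1) (- (k * cos (k * (-1 * y + 0)) * f (-1 * y + 0)))) (- s) s).
  - apply RInt_ext; intros; unfold scal; simpl; unfold mult; simpl.
    replace (k * (-1 * x + 0)) with (- (k * x)) by ring. rewrite cos_neg.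
    replace (-1 * x + 0) with (- x) by ring. ring.
  - etransitivity; [apply (RInt_comp_lin (fun y => - (k * cos (k * y) * f y)) (-1) 0 (- s) s)|].
    2:{ replace (-1 * - s + 0) with s by ring. replace (-1 * s + 0) with (- s) by ring.
      rewrite <- opp_RInt_swap.
      * rewrite <- RInt_opp. { apply RInt_ext; intros; unfold opp; simpl; ring. }
        apply (ex_RInt_continuous (V:=R_CompleteNormedModule)); intros z Hz.
        rewrite Rmin_left, Rmax_right in Hz by lra.
        apply (continuous_opp (fun y => k * cos (k * y) * f y)).
        apply (continuous_mult (fun t => k * cos (k * t)) f); auto using continuous_kcos.
      * apply (ex_RInt_continuous (V:=R_CompleteNormedModule)); intros z Hz.
        rewrite Rmin_left, Rmax_right in Hz by lra.
        apply (continuous_opp (fun y => k * cos (k * y) * f y)).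
        apply (continuous_mult (fun t => k * cos (k * t)) f); auto using continuous_kcos. }
    apply (ex_RInt_continuous (V:=R_CompleteNormedModule)); intros z Hz.
      rewrite Rmin_right, Rmax_left in Hz by lra.
      apply (continuous_opp (fun y => k * cos (k * y) * f y)).
      apply (continuous_mult (fun t => k * cos (k * t)) f); [apply continuous_kcos|apply Hc; lra]. }
rewrite <- E.
replace (f s) with (f (- - s)) by (f_equal; ring).
replace (1 + sin (k * s)) with (1 - sin (k * - s)).
2:{ replace (k * - s) with (- (k * s)) by ring. rewrite sin_neg; ring. }
apply (RInt_cos_nondecreasing (fun t => f (- t)) (- s) s k); try lra.
- intros t Ht. apply (continuous_comp Ropp f); [|apply Hc; lra].
  apply (continuous_opp (fun x : R => x) t), continuous_id.
- intros t t' H1 H2. apply Hm; lra.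
Qed.

Lemma Rmax_0_sqr_plus (x : R) : sqrt (1 + Rmax x 0 ^ 2) + sqrt (1 + Rmin x 0 ^ 2) = 1 + sqrt (1 + x ^ 2).
Proof.
destruct (Rle_or_lt x 0).
- rewrite Rmax_right, Rmin_left by lra. replace (1 + 0 ^ 2) with 1 by ring. rewrite sqrt_1. ring.
- rewrite Rmax_left, Rmin_right by lra. replace (1 + 0 ^ 2) with 1 by ring. rewrite sqrt_1. ring.
Qed.

Lemma continuous_Rmax_0 (q : R -> R) (t : R) : continuous q t -> continuous (fun t => Rmax (q t) 0) t.
Proof.
intros H. apply (continuous_ext (fun t => (q t + Rabs (q t)) / 2)).
- intros x. unfold Rmax. destruct (Rle_dec (q x) 0).
  + rewrite Rabs_left1 by lra. simpl; field.
  + rewrite Rabs_pos_eq by lra. simpl; field.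
- apply (continuous_mult (fun t => q t + Rabs (q t)) (fun _ => / 2)); [|apply continuous_const].
  apply (continuous_plus q (fun t => Rabs (q t))); auto.
  apply (continuous_comp q Rabs); auto. apply continuous_Rabs.
Qed.

Lemma continuous_sqrt_1_sqr (q : R -> R) (t : R) : continuous q t -> continuous (fun t => sqrt (1 + q t ^ 2)) t.
Proof.
intros H. apply (continuous_comp q (fun x => sqrt (1 + x ^ 2))); auto.
apply (ex_derive_continuous (fun x => sqrt (1 + x ^ 2))). auto_derive. nra.
Qed.

Lemma sqrt_1_sqr_ge1 (x : R) : 1 <= sqrt (1 + x ^ 2).
Proof. rewrite <- sqrt_1 at 1. apply sqrt_le_1_alt; nra. Qed.

Lemma sqrt_1_sqr_le (x : R) : sqrt (1 + x ^ 2) <= 1 + Rabs x.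
Proof.
pose proof (Rabs_pos x). rewrite <- (sqrt_pow2 (1 + Rabs x)) by lra.
apply sqrt_le_1_alt. rewrite <- (pow2_abs x). nra.
Qed.

(* [sqrt (1 + q^2)] is V-shaped for monotone [q]; both monotone parts contribute with the same sign. *)
Lemma RInt_cos_arclength (q : R -> R) (s k : R) :
  0 <= s -> 0 <= k ->
  (forall t, - s <= t <= s -> continuous q t) ->
  (forall t t', - s <= t <= t' -> t' <= s -> q t' <= q t) ->
  2 - (1 - sin (k * s)) * (2 + Rabs (q s) + Rabs (q (- s)))
    <= RInt (fun t => k * cos (k * t) * sqrt (1 + q t ^ 2)) (- s) s.
Proof.
intros Hs Hk Hc Hm.
set (fp := fun t => sqrt (1 + Rmax (q t) 0 ^ 2)).
set (fm := fun t => sqrt (1 + Rmin (q t) 0 ^ 2)).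
assert (Hcp : forall t, - s <= t <= s -> continuous fp t).
{ intros t Ht. apply (continuous_sqrt_1_sqr (fun t => Rmax (q t) 0)), continuous_Rmax_0; auto. }
assert (Hcm : forall t, - s <= t <= s -> continuous fm t).
{ intros t Ht. apply (continuous_ext (fun t => sqrt (1 + Rmax (- q t) 0 ^ 2))).
  - intros x; unfold fm. f_equal. f_equal.
    replace (Rmin (q x) 0) with (- Rmax (- q x) 0); [ring|].
    unfold Rmax, Rmin; destruct (Rle_dec (- q x) 0), (Rle_dec (q x) 0); lra.
  - apply (continuous_sqrt_1_sqr (fun t => Rmax (- q t) 0)), (continuous_Rmax_0 (fun t => - q t)).
    apply (continuous_opp q); auto. }
assert (Hp := RInt_cos_nonincreasing fp s k Hs Hk Hcp).
assert (Hq := RInt_cos_nondecreasing fm (- s) s k ltac:(lra) Hk Hcm).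
replace (k * - s) with (- (k * s)) in Hq by ring. rewrite sin_neg in Hq.
assert (Hp' := Hp ltac:(intros t t' H1 H2; unfold fp; apply sqrt_le_1_alt;
  specialize (Hm t t' H1 H2); unfold Rmax; destruct (Rle_dec (q t') 0), (Rle_dec (q t) 0); nra)).
assert (Hq' := Hq ltac:(intros t t' H1 H2; unfold fm; apply sqrt_le_1_alt;
  specialize (Hm t t' ltac:(lra) H2); unfold Rmin; destruct (Rle_dec (q t') 0), (Rle_dec (q t) 0); nra)).
clear Hp Hq.
assert (Hex : forall f, (forall t, - s <= t <= s -> continuous f t) ->
  ex_RInt (fun t => k * cos (k * t) * f t) (- s) s).
{ intros f Hf. apply (ex_RInt_continuous (V:=R_CompleteNormedModule)); intros z Hz.
  rewrite Rmin_left, Rmax_right in Hz by lra.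
  apply (continuous_mult (fun t => k * cos (k * t)) f); auto using continuous_kcos. }
(* The sum [fp + fm] exceeds the arclength density by 1, whose integral against [k * cos (k * t)] is
   [2 * sin (k * s)]. *)
assert (E : RInt (fun t => k * cos (k * t) * sqrt (1 + q t ^ 2)) (- s) s
  = RInt (fun t => k * cos (k * t) * fp t) (- s) s + RInt (fun t => k * cos (k * t) * fm t) (- s) s
    - 2 * sin (k * s)).
{ assert (Hk1 : is_RInt (fun t => k * cos (k * t)) (- s) s (sin (k * s) - sin (k * - s))).
  { apply (is_RInt_derive (fun t => sin (k * t))).
    - intros z _; auto_derive; auto; ring.
    - intros z _; apply continuous_kcos. }
  replace (k * - s) with (- (k * s)) in Hk1 by ring. rewrite sin_neg in Hk1.
  pose proof (is_RInt_minus (V:=R_NormedModule) _ _ _ _ _ _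
    (is_RInt_plus (V:=R_NormedModule) _ _ _ _ _ _
      (RInt_correct (V:=R_CompleteNormedModule) _ _ _ (Hex fp Hcp))
      (RInt_correct (V:=R_CompleteNormedModule) _ _ _ (Hex fm Hcm))) Hk1) as HI.
  etransitivity.
  - apply (is_RInt_unique (V:=R_CompleteNormedModule)).
    refine (is_RInt_ext (V:=R_NormedModule) _ _ _ _ _ _ HI).
    intros t _. unfold minus, plus, opp; simpl.
    pose proof (Rmax_0_sqr_plus (q t)) as H. simpl in H. unfold fp, fm. simpl.
    replace (sqrt (1 + q t * (q t * 1))) with
     (sqrt (1 + Rmax (q t) 0 * (Rmax (q t) 0 * 1)) + sqrt (1 + Rmin (q t) 0 * (Rmin (q t) 0 * 1)) - 1) by lra.
    ring.
  - unfold minus, plus, opp; simpl. ring. }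
rewrite E.
(* [fm s] and [fp (- s)] are the boundary terms of the wrong sign. They carry the small factor
   [1 - sin (k * s)], so a crude upper bound by the slope is enough. *)
assert (B1 : fm s <= 1 + Rabs (q s)).
{ unfold fm. pose proof (Rmax_0_sqr_plus (q s)). pose proof (sqrt_1_sqr_ge1 (Rmax (q s) 0)).
  pose proof (sqrt_1_sqr_le (q s)). lra. }
assert (B2 : fp (- s) <= 1 + Rabs (q (- s))).
{ unfold fp. pose proof (Rmax_0_sqr_plus (q (- s))). pose proof (sqrt_1_sqr_ge1 (Rmin (q (- s)) 0)).
  pose proof (sqrt_1_sqr_le (q (- s))). lra. }
assert (B3 : 1 <= fp s) by apply sqrt_1_sqr_ge1.
assert (B4 : 1 <= fm (- s)) by apply sqrt_1_sqr_ge1.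
pose proof (SIN_bound (k * s)).
nra.
Qed.

(** * Green's formula on slices *)

(** Continuity is assumed relative to [[a, b]] only, so [f] is composed with the clamp onto
    [[a, b]]. The result is continuous on the line, and the limit is the continuity of its
    primitive. *)
Lemma RInt_inset_limit (f : R -> R) (a b : R) :
  a < b ->
  (forall x, a <= x <= b -> forall e, 0 < e -> exists d, 0 < d /\
     forall y, a <= y <= b -> Rabs (y - x) < d -> Rabs (f y - f x) < e) ->
  ex_RInt f a b /\
  forall e, 0 < e -> exists d, 0 < d /\ forall c, 0 < c < d ->
     Rabs (RInt f (a + c) (b - c) - RInt f a b) < e.
Proof.
intros Hab Hf.
set (cla := fun x => Rmax a (Rmin x b)).
assert (Hcl : forall x, a <= cla x <= b).
{ intros x; unfold cla. split; [apply Rmax_l|]. apply Rmax_lub; [lra|apply Rmin_r]. }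
assert (Hid : forall x, a <= x <= b -> cla x = x).
{ intros x Hx; unfold cla. rewrite Rmin_left, Rmax_right by lra; auto. }
assert (Hlip : forall x y, Rabs (cla y - cla x) <= Rabs (y - x)).
{ intros x y. apply Rle_trans with (Rabs (Rmin y b - Rmin x b)); unfold cla.
  - generalize (Rmin x b) (Rmin y b). intros u v. unfold Rmax, Rabs.
    destruct (Rle_dec a u), (Rle_dec a v), (Rcase_abs (v - u));
    try match goal with |- context [Rcase_abs ?z] => destruct (Rcase_abs z) end; lra.
  - unfold Rmin, Rabs. destruct (Rle_dec x b), (Rle_dec y b), (Rcase_abs (y - x));
    try match goal with |- context [Rcase_abs ?z] => destruct (Rcase_abs z) end; lra. }
set (g := fun x => f (cla x)).
assert (Hg : forall x, continuous g x).
{ intros x. apply (filterlim_locally g). intros eps.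
  destruct (Hf (cla x) (Hcl x) eps (cond_pos eps)) as [d [Hd H]].
  exists (mkposreal d Hd). intros y Hy. apply H; [apply Hcl|].
  eapply Rle_lt_trans; [apply Hlip|]. exact Hy. }
assert (Hge : forall u v, ex_RInt g u v).
{ intros u v. apply (ex_RInt_continuous (V:=R_CompleteNormedModule)); auto. }
assert (Hgf : forall c, 0 <= c -> a + c <= b - c -> RInt f (a + c) (b - c) = RInt g (a + c) (b - c)).
{ intros c H1 H2. apply RInt_ext. intros x Hx. rewrite Rmin_left, Rmax_right in Hx by lra.
  unfold g. rewrite Hid; auto; lra. }
split.
{ apply (ex_RInt_ext g); auto. intros x Hx. rewrite Rmin_left, Rmax_right in Hx by lra.
  unfold g. rewrite Hid; auto; lra. }
intros e He.
set (G := fun x => RInt g 0 x).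
assert (HG : forall x, continuous G x).
{ intros x. apply (ex_derive_continuous G). exists (g x). apply (is_derive_RInt g G 0 x); auto.
  apply filter_forall. intros y. apply (RInt_correct (V:=R_CompleteNormedModule)); auto. }
assert (HGD : forall u v, RInt g u v = G v - G u).
{ intros u v. unfold G.
  assert (E : RInt g 0 u + RInt g u v = RInt g 0 v) by (apply (RInt_Chasles g 0 u v); auto). lra. }
assert (He2 : 0 < e / 2) by lra.
destruct (proj1 (filterlim_locally G (G a)) (HG a) (mkposreal _ He2)) as [d1 H1].
destruct (proj1 (filterlim_locally G (G b)) (HG b) (mkposreal _ He2)) as [d2 H2].
exists (Rmin ((b - a) / 2) (Rmin d1 d2)). split.
{ repeat apply Rmin_glb_lt; try apply cond_pos; lra. }
intros c [Hc0 Hc].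
pose proof (Rmin_l ((b - a) / 2) (Rmin d1 d2)). pose proof (Rmin_r ((b - a) / 2) (Rmin d1 d2)).
pose proof (Rmin_l d1 d2). pose proof (Rmin_r d1 d2).
rewrite Hgf by lra. replace (RInt f a b) with (RInt g (a + 0) (b - 0)).
2:{ rewrite <- Hgf by lra. f_equal; ring. }
rewrite !HGD, Rplus_0_r, Rminus_0_r.
assert (A1 : Rabs (G (a + c) - G a) < e / 2).
{ apply H1. change (Rabs (a + c - a) < d1). rewrite Rabs_pos_eq; lra. }
assert (A2 : Rabs (G (b - c) - G b) < e / 2).
{ apply H2. change (Rabs (b - c - b) < d2). rewrite Rabs_left; lra. }
replace (G (b - c) - G (a + c) - (G b - G a)) with ((G (b - c) - G b) - (G (a + c) - G a)) by ring.
eapply Rle_lt_trans; [apply Rabs_triang|]. rewrite Rabs_Ropp. lra.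
Qed.

(** * Regions between two graphs and continuity up to their boundary *)

Definition cl (S : R -> R -> Prop) (x t : R) : Prop :=
  forall e, 0 < e -> exists x' t', S x' t' /\ Rabs (x' - x) < e /\ Rabs (t' - t) < e.

Definition cwithin (S : R -> R -> Prop) (f : R -> R -> R) (x t : R) : Prop :=
  forall e, 0 < e -> exists d, 0 < d /\
    forall x' t', cl S x' t' -> Rabs (x' - x) < d -> Rabs (t' - t) < d -> Rabs (f x' t' - f x t) < e.

Lemma cl_of_mem (S : R -> R -> Prop) (x t : R) : S x t -> cl S x t.
Proof. intros H e He. exists x, t. rewrite !Rminus_eq_0, Rabs_R0. auto. Qed.

Lemma cwithin_continuity_2d_pt (S : R -> R -> Prop) (f : R -> R -> R) (x t : R) :
  locally_2d S x t -> cwithin S f x t -> continuity_2d_pt f x t.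
Proof.
intros [d1 H1] H2 eps. destruct (H2 eps (cond_pos eps)) as [d2 [Hd2 H]].
assert (Hd : 0 < Rmin d1 d2) by (apply Rmin_glb_lt; auto; apply cond_pos).
exists (mkposreal _ Hd). simpl. intros u v Hu Hv.
pose proof (Rmin_l d1 d2). pose proof (Rmin_r d1 d2).
apply H; [apply cl_of_mem, H1|..]; lra.
Qed.

Lemma continuity_2d_pt_swap (f : R -> R -> R) (x t : R) :
  continuity_2d_pt f x t -> continuity_2d_pt (fun u v => f v u) t x.
Proof. intros H eps. destruct (H eps) as [d Hd]. exists d; auto. Qed.

Lemma continuity_2d_pt_fst (f : R -> R -> R) (x t : R) :
  continuity_2d_pt f x t -> continuous (fun x => f x t) x.
Proof.
intros H. apply (filterlim_locally (fun x => f x t)). intros eps. destruct (H eps) as [d Hd].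
exists d. intros y Hy. apply Hd; auto. rewrite Rminus_eq_0, Rabs_R0. apply cond_pos.
Qed.

(** The sides are C^1 over the open interval of heights only: nothing is asked at the tips, where
    the slopes [pl], [pr] of a smooth convex body are unbounded. *)
Record slab (S : R -> R -> Prop) (h M : R) (l r pl pr : R -> R) : Prop := {
  slab_height : forall x t, S x t -> - h < t < h;
  slab_slice : forall x t, - h < t < h -> (S x t <-> l t < x < r t);
  slab_lt : forall t, - h < t < h -> l t < r t;
  slab_bound : forall t, - h < t < h -> - M <= l t /\ r t <= M;
  slab_open : forall x t, S x t -> locally_2d S x t;
  slab_dl : forall t, - h < t < h -> is_derive l t (pl t) /\ continuous pl t;
  slab_dr : forall t, - h < t < h -> is_derive r t (pr t) /\ continuous pr t
}.

Section Slab.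
Variables (S : R -> R -> Prop) (h M : R) (l r pl pr : R -> R).
Hypothesis HS : slab S h M l r pl pr.

Lemma slab_cl (x t : R) : - h < t < h -> l t <= x <= r t -> cl S x t.
Proof.
intros Ht Hx e He. pose proof (slab_lt _ _ _ _ _ _ _ HS t Ht) as Hw.
set (c := Rmin (e / 2) ((r t - l t) / 4)).
assert (Hc : 0 < c) by (apply Rmin_glb_lt; lra).
pose proof (Rmin_l (e / 2) ((r t - l t) / 4)). pose proof (Rmin_r (e / 2) ((r t - l t) / 4)).
fold c in H, H0.
exists (Rmax (l t + c) (Rmin x (r t - c))), t.
split; [apply (slab_slice _ _ _ _ _ _ _ HS); auto; split|].
- eapply Rlt_le_trans; [|apply Rmax_l]. lra.
- apply Rmax_lub_lt; [lra|]. eapply Rle_lt_trans; [apply Rmin_r|]. lra.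
- rewrite Rminus_eq_0, Rabs_R0. split; auto. apply Rabs_def1.
  + unfold Rmax, Rmin; destruct (Rle_dec x (r t - c)), (Rle_dec (l t + c) _); lra.
  + unfold Rmax, Rmin; destruct (Rle_dec x (r t - c)), (Rle_dec (l t + c) _); lra.
Qed.

Lemma slab_near (t0 e : R) : - h < t0 < h -> 0 < e ->
  exists d, 0 < d /\ forall t, Rabs (t - t0) < d ->
    - h < t < h /\ Rabs (l t - l t0) < e /\ Rabs (r t - r t0) < e /\
    Rabs (pl t - pl t0) < e /\ Rabs (pr t - pr t0) < e.
Proof.
intros Ht He.
destruct (slab_dl _ _ _ _ _ _ _ HS t0 Ht) as [Dl Cl'].
destruct (slab_dr _ _ _ _ _ _ _ HS t0 Ht) as [Dr Cr'].
assert (Cl : continuous l t0) by (apply (ex_derive_continuous l); eexists; eauto).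
assert (Cr : continuous r t0) by (apply (ex_derive_continuous r); eexists; eauto).
destruct (proj1 (filterlim_locally l (l t0)) Cl (mkposreal e He)) as [d1 H1].
destruct (proj1 (filterlim_locally r (r t0)) Cr (mkposreal e He)) as [d2 H2].
destruct (proj1 (filterlim_locally pl (pl t0)) Cl' (mkposreal e He)) as [d3 H3].
destruct (proj1 (filterlim_locally pr (pr t0)) Cr' (mkposreal e He)) as [d4 H4].
exists (Rmin (Rmin (h - t0) (t0 + h)) (Rmin (Rmin d1 d2) (Rmin d3 d4))).
split.
{ repeat apply Rmin_glb_lt; try apply cond_pos; lra. }
intros t H.
apply Rmin_Rgt_l in H; destruct H as [Ha Hb].
apply Rmin_Rgt_l in Ha; destruct Ha as [Ha1 Ha2].
apply Rmin_Rgt_l in Hb; destruct Hb as [Hb Hc].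
apply Rmin_Rgt_l in Hb; destruct Hb as [Hb1 Hb2].
apply Rmin_Rgt_l in Hc; destruct Hc as [Hc1 Hc2].
split; [|repeat split; [apply H1|apply H2|apply H3|apply H4]; assumption].
pose proof (Rle_abs (t - t0)). pose proof (Rle_abs (- (t - t0))). rewrite Rabs_Ropp in *. lra.
Qed.

Lemma slab_width_near (t0 : R) : - h < t0 < h ->
  exists d w, 0 < d /\ 0 < w /\ forall t, Rabs (t - t0) < d -> - h < t < h /\ w < r t - l t.
Proof.
intros Ht. pose proof (slab_lt _ _ _ _ _ _ _ HS t0 Ht) as Hw.
destruct (slab_near t0 ((r t0 - l t0) / 4) Ht ltac:(lra)) as [d [Hd H]].
exists d, ((r t0 - l t0) / 2). repeat split; try lra; try apply H; auto.
destruct (H t H0) as [_ [A [B _]]]. apply Rabs_def2 in A, B. lra.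
Qed.

(** Leibniz's rule with moving ends. The inset [c] keeps nearby slices inside the open set, where
    [Qt] is continuous. *)
Lemma is_derive_slab_inset (Q Qt : R -> R -> R) (t c : R) :
  - h < t < h -> 0 < c -> 2 * c < r t - l t ->
  (forall x t, S x t -> continuity_2d_pt Q x t) ->
  (forall x t, S x t -> is_derive (fun t => Q x t) t (Qt x t)) ->
  (forall x t, S x t -> continuity_2d_pt Qt x t) ->
  is_derive (fun t => RInt (fun x => Q x t) (l t + c) (r t - c)) t
    (RInt (fun x => Qt x t) (l t + c) (r t - c) - Q (l t + c) t * pl t + Q (r t - c) t * pr t).
Proof.
intros Ht Hc Hw HQ HD HC.
assert (Hc2 : 0 < c / 2) by lra.
destruct (slab_near t (c / 2) Ht Hc2) as [d [Hd Hn]].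
assert (HSn : forall x t', Rabs (t' - t) < d -> l t + c / 2 <= x <= r t - c / 2 -> S x t').
{ intros x t' H1 H2. destruct (Hn t' H1) as [A [B [C _]]]. apply Rabs_def2 in B, C.
  apply (slab_slice _ _ _ _ _ _ _ HS); auto. lra. }
assert (Hself : Rabs (t - t) < d) by (rewrite Rminus_eq_0, Rabs_R0; auto).
assert (Hint : forall u v t', Rabs (t' - t) < d -> l t + c / 2 <= u -> u <= v -> v <= r t - c / 2 ->
  ex_RInt (fun x => Q x t') u v).
{ intros u v t' H1 H2 H3 H4. apply (ex_RInt_continuous (V:=R_CompleteNormedModule)).
  intros z Hz. rewrite Rmin_left, Rmax_right in Hz by lra.
  apply (continuity_2d_pt_fst Q), HQ, HSn; auto; lra. }
assert (HDer : forall x t', S x t' ->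
  continuity_2d_pt (fun u v => Derive (fun z => Q v z) u) t' x).
{ intros x t' HSx. apply (continuity_2d_pt_ext_loc (fun u v => Qt v u)).
  - destruct (slab_open _ _ _ _ _ _ _ HS x t' HSx) as [d' H'].
    exists d'. intros u v Hu Hv. symmetry. apply is_derive_unique, HD, H'; auto.
  - apply (continuity_2d_pt_swap Qt); auto. }
destruct (slab_dl _ _ _ _ _ _ _ HS t Ht) as [Dl _].
destruct (slab_dr _ _ _ _ _ _ _ HS t Ht) as [Dr _].
assert (E : RInt (fun x => Qt x t) (l t + c) (r t - c) =
  RInt (fun x => Derive (fun u => Q x u) t) (l t + c) (r t - c)).
{ apply RInt_ext. intros x Hx. rewrite Rmin_left, Rmax_right in Hx by lra.
  symmetry. apply is_derive_unique, HD, HSn; auto; lra. }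
rewrite E.
replace (RInt (fun x => Derive (fun u => Q x u) t) (l t + c) (r t - c)
   - Q (l t + c) t * pl t + Q (r t - c) t * pr t)
 with (RInt (fun x => Derive (fun u => Q x u) t) (l t + c) (r t - c)
   + - Q (l t + c) t * pl t + Q (r t - c) t * pr t) by ring.
apply (is_derive_RInt_param_bound_comp (fun t x => Q x t) (fun t => l t + c) (fun t => r t - c)).
- exists (mkposreal d Hd). intros y Hy. apply Hint; auto; lra.
- exists (mkposreal _ Hc2), (mkposreal d Hd). intros y Hy. simpl. apply Hint; auto; lra.
- exists (mkposreal _ Hc2), (mkposreal d Hd). intros y Hy. simpl. apply Hint; auto; lra.
- rewrite <- (Rplus_0_r (pl t)).
  apply (is_derive_plus l (fun _ => c) t (pl t) 0); [exact Dl|apply (is_derive_const c)].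
- rewrite <- (Rminus_0_r (pr t)).
  apply (is_derive_minus r (fun _ => c) t (pr t) 0); [exact Dr|apply (is_derive_const c)].
- exists (mkposreal _ Hc2), (mkposreal d Hd). intros y Hy x. simpl. intros Hx.
  rewrite Rmin_left, Rmax_right in Hx by lra.
  eexists. apply HD, HSn; auto; lra.
- intros x Hx. rewrite Rmin_left, Rmax_right in Hx by lra. apply HDer, HSn; auto; lra.
- exists (mkposreal _ (Rmin_stable_in_posreal (mkposreal d Hd) (mkposreal _ Hc2))).
  intros u v Hu Hv. simpl in *. pose proof (Rmin_l d (c / 2)). pose proof (Rmin_r d (c / 2)).
  apply Rabs_def2 in Hv. apply HDer, HSn; lra.
- exists (mkposreal _ (Rmin_stable_in_posreal (mkposreal d Hd) (mkposreal _ Hc2))).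
  intros u v Hu Hv. simpl in *. pose proof (Rmin_l d (c / 2)). pose proof (Rmin_r d (c / 2)).
  apply Rabs_def2 in Hv. apply HDer, HSn; lra.
- apply continuity_pt_filterlim. apply (continuity_2d_pt_fst Q), HQ, HSn; auto; lra.
- apply continuity_pt_filterlim. apply (continuity_2d_pt_fst Q), HQ, HSn; auto; lra.
Qed.

Definition slice_int (Q : R -> R -> R) (t : R) : R := RInt (fun x => Q x t) (l t) (r t).

(** The outward flux of the field [(P, Q)] through the two sides per unit of height: [(1, - pr)] and
    [(- 1, pl)] are the outer normals times the arclength density. *)
Definition flux (P Q : R -> R -> R) (t : R) : R :=
  (P (r t) t - Q (r t) t * pr t) - (P (l t) t - Q (l t) t * pl t).

Lemma slice_int_limit (Q : R -> R -> R) (t : R) :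
  - h < t < h -> (forall x t, cl S x t -> cwithin S Q x t) ->
  ex_RInt (fun x => Q x t) (l t) (r t) /\
  forall e, 0 < e -> exists d, 0 < d /\ forall c, 0 < c < d ->
     Rabs (RInt (fun x => Q x t) (l t + c) (r t - c) - slice_int Q t) < e.
Proof.
intros Ht HQ. apply (RInt_inset_limit (fun x => Q x t)).
- apply (slab_lt _ _ _ _ _ _ _ HS); auto.
- intros x Hx e He. destruct (HQ x t (slab_cl x t Ht Hx) e He) as [d [Hd H]].
  exists d; split; auto. intros y Hy Hyx. apply H; auto using slab_cl.
  rewrite Rminus_eq_0, Rabs_R0; auto.
Qed.

Lemma product_close (q0 p0 e : R) : 0 < e -> exists d, 0 < d /\
  forall q p, Rabs (q - q0) < d -> Rabs (p - p0) < d -> Rabs (q * p - q0 * p0) < e.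
Proof.
intros He.
destruct (continuity_2d_pt_mult _ _ q0 p0 (continuity_2d_pt_id1 q0 p0) (continuity_2d_pt_id2 q0 p0)
  (mkposreal e He)) as [d H].
exists d; split; [apply cond_pos|auto].
Qed.

(** [s * c] is an inward shift, with [s = - 1] on the right side and [s = 1] on the left. The
    estimate is joint in [t] and [c], so [c] may tend to 0 while [t] ranges over a fixed window. *)
Lemma side_term_near (rho p : R -> R) (P Q : R -> R -> R) (s t0 e : R) :
  - h < t0 < h -> cl S (rho t0) t0 -> (s = 1 \/ s = - 1) ->
  (forall e, 0 < e -> exists d, 0 < d /\ forall t, Rabs (t - t0) < d ->
    Rabs (rho t - rho t0) < e /\ Rabs (p t - p t0) < e) ->
  cwithin S P (rho t0) t0 -> cwithin S Q (rho t0) t0 -> 0 < e ->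
  exists d, 0 < d /\ forall t c, Rabs (t - t0) < d -> 0 < c < d -> cl S (rho t + s * c) t ->
    Rabs ((P (rho t + s * c) t - Q (rho t + s * c) t * p t) - (P (rho t0) t0 - Q (rho t0) t0 * p t0)) < e.
Proof.
intros Ht Hcl Hs Hn HP HQ He.
destruct (product_close (Q (rho t0) t0) (p t0) (e / 2) ltac:(lra)) as [d1 [Hd1 H1]].
destruct (HP (e / 2) ltac:(lra)) as [d2 [Hd2 H2]].
destruct (HQ d1 Hd1) as [d3 [Hd3 H3]].
assert (Hm : 0 < Rmin d1 (Rmin d2 d3) / 2) by (apply Rdiv_lt_0_compat; [repeat apply Rmin_glb_lt; auto|lra]).
destruct (Hn _ Hm) as [d4 [Hd4 H4]].
exists (Rmin d4 (Rmin d1 (Rmin d2 d3) / 2)). split; [apply Rmin_glb_lt; auto|].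
intros t c Htt Hc Hin.
pose proof (Rmin_l d4 (Rmin d1 (Rmin d2 d3) / 2)). pose proof (Rmin_r d4 (Rmin d1 (Rmin d2 d3) / 2)).
pose proof (Rmin_l d1 (Rmin d2 d3)). pose proof (Rmin_r d1 (Rmin d2 d3)).
pose proof (Rmin_l d2 d3). pose proof (Rmin_r d2 d3).
destruct (H4 t ltac:(lra)) as [A B].
assert (HX : Rabs (rho t + s * c - rho t0) < Rmin d1 (Rmin d2 d3)).
{ apply Rabs_def2 in A. destruct Hs; subst s; apply Rabs_def1; lra. }
assert (C1 := H2 _ _ Hin ltac:(lra) ltac:(lra)).
assert (C2 := H1 _ _ (H3 _ _ Hin ltac:(lra) ltac:(lra)) ltac:(apply (Rlt_trans _ _ _ B); lra)).
apply Rabs_def2 in C1, C2. apply Rabs_def1; lra.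
Qed.

(* Second derivatives may blow up at the boundary, so the slices are inset by [c] and [c] tends to [0];
   a local lower bound on increments only needs pointwise continuity of [P], [Q] up to the boundary. *)
Lemma slice_int_increment (P Q Px Qt : R -> R -> R) (t0 m e : R) :
  - h < t0 < h -> 0 < e ->
  (forall x t, cl S x t -> cwithin S P x t) ->
  (forall x t, cl S x t -> cwithin S Q x t) ->
  (forall x t, S x t -> is_derive (fun x => P x t) x (Px x t)) ->
  (forall x t, S x t -> is_derive (fun t => Q x t) t (Qt x t)) ->
  (forall x t, S x t -> continuity_2d_pt Px x t) ->
  (forall x t, S x t -> continuity_2d_pt Qt x t) ->
  (exists d, 0 < d /\ forall t c, Rabs (t - t0) < d -> 0 < c < d ->
     m <= RInt (fun x => Px x t + Qt x t) (l t + c) (r t - c)) ->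
  exists d, 0 < d /\ forall a b, t0 - d < a -> a <= b -> b < t0 + d ->
    (m - flux P Q t0 - e) * (b - a) <= slice_int Q b - slice_int Q a.
Proof.
intros Ht He HP HQ DP DQ CP CQ [dm [Hdm Hm]].
assert (Hlr := slab_lt _ _ _ _ _ _ _ HS t0 Ht).
assert (Clr : cl S (r t0) t0) by (apply slab_cl; auto; lra).
assert (Cll : cl S (l t0) t0) by (apply slab_cl; auto; lra).
destruct (side_term_near r pr P Q (-1) t0 (e / 2) Ht Clr ltac:(auto)) as [dr [Hdr Hr]]; auto; try lra.
{ intros e' He'. destruct (slab_near t0 e' Ht He') as [d [Hd H]].
  exists d; split; auto. intros t H'. destruct (H t H') as [? [? [? [? ?]]]]; auto. }
destruct (side_term_near l pl P Q 1 t0 (e / 2) Ht Cll ltac:(auto)) as [dl [Hdl Hl]]; auto; try lra.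
{ intros e' He'. destruct (slab_near t0 e' Ht He') as [d [Hd H]].
  exists d; split; auto. intros t H'. destruct (H t H') as [? [? [? [? ?]]]]; auto. }
destruct (slab_width_near t0 Ht) as [dw [w [Hdw [Hw Hwid]]]].
set (d := Rmin (Rmin dm dw) (Rmin dr dl)).
assert (Hd : 0 < d) by (unfold d; repeat apply Rmin_glb_lt; auto).
assert (Hdd : d <= dm /\ d <= dw /\ d <= dr /\ d <= dl).
{ unfold d. pose proof (Rmin_l (Rmin dm dw) (Rmin dr dl)). pose proof (Rmin_r (Rmin dm dw) (Rmin dr dl)).
  pose proof (Rmin_l dm dw). pose proof (Rmin_r dm dw). pose proof (Rmin_l dr dl). pose proof (Rmin_r dr dl). lra. }
clearbody d. destruct Hdd as [Hd1 [Hd2 [Hd3 Hd4]]].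
exists d; split; auto. intros a b Ha Hab Hb.
assert (Hin : forall t c, Rabs (t - t0) < d -> 0 < c -> 2 * c < w ->
  forall x, l t + c <= x <= r t - c -> S x t).
{ intros t c H1 H2 H3 x Hx. destruct (Hwid t ltac:(lra)).
  apply (slab_slice _ _ _ _ _ _ _ HS); auto; lra. }
assert (Hc : forall c, 0 < c < d -> 2 * c < w ->
  (m - flux P Q t0 - e) * (b - a) <=
   RInt (fun x => Q x b) (l b + c) (r b - c) - RInt (fun x => Q x a) (l a + c) (r a - c)).
{ intros c Hc Hcw.
  assert (Habs : forall t, a <= t <= b -> Rabs (t - t0) < d) by (intros; apply Rabs_def1; lra).
  assert (Hder : forall t, a <= t <= b ->
    is_derive (fun t => RInt (fun x => Q x t) (l t + c) (r t - c)) t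
    (RInt (fun x => Qt x t) (l t + c) (r t - c) - Q (l t + c) t * pl t + Q (r t - c) t * pr t)).
  { intros t H. destruct (Hwid t) as [W1 W2]; [specialize (Habs t H); lra|].
    apply is_derive_slab_inset; auto; try lra.
    intros x t' HSx. apply (cwithin_continuity_2d_pt S);
      [apply (slab_open _ _ _ _ _ _ _ HS)|apply HQ, cl_of_mem]; auto. }
  destruct (MVT_gen (fun t => RInt (fun x => Q x t) (l t + c) (r t - c)) a b
    (fun t => RInt (fun x => Qt x t) (l t + c) (r t - c) - Q (l t + c) t * pl t + Q (r t - c) t * pr t))
    as [t [Htab E]].
  - intros t. rewrite Rmin_left, Rmax_right by lra. intros H; apply Hder; lra.
  - intros t. rewrite Rmin_left, Rmax_right by lra. intros H.
    apply continuity_pt_filterlim.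
    apply (ex_derive_continuous (fun t => RInt (fun x => Q x t) (l t + c) (r t - c))).
    eexists; apply Hder; lra.
  - rewrite Rmin_left, Rmax_right in Htab by lra. rewrite E.
    apply Rmult_le_compat_r; [lra|].
    specialize (Habs t Htab). destruct (Hwid t ltac:(lra)) as [W1 W2].
    (* Integrating [Px] along the slice turns the derivative given by the mean value theorem into
       the integral of the divergence minus the flux through the inset sides, and that flux is
       within [e] of [flux] at [t0]. *)
    assert (HI : is_RInt (fun x => Px x t) (l t + c) (r t - c) (P (r t - c) t - P (l t + c) t)).
    { apply (is_RInt_derive (fun x => P x t)).
      - intros x Hx. rewrite Rmin_left, Rmax_right in Hx by lra. apply DP, (Hin t c); auto; lra.
      - intros x Hx. rewrite Rmin_left, Rmax_right in Hx by lra.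
        apply (continuity_2d_pt_fst Px), CP, (Hin t c); auto; lra. }
    assert (HI2 : ex_RInt (fun x => Qt x t) (l t + c) (r t - c)).
    { apply (ex_RInt_continuous (V:=R_CompleteNormedModule)); intros x Hx.
      rewrite Rmin_left, Rmax_right in Hx by lra.
      apply (continuity_2d_pt_fst Qt), CQ, (Hin t c); auto; lra. }
    assert (HIm := Hm t c ltac:(lra) ltac:(lra)).
    assert (HE : RInt (fun x => Px x t + Qt x t) (l t + c) (r t - c)
      = P (r t - c) t - P (l t + c) t + RInt (fun x => Qt x t) (l t + c) (r t - c)).
    { apply is_RInt_unique.
      apply (is_RInt_plus (V:=R_NormedModule) (fun x => Px x t) (fun x => Qt x t)); [exact HI|].
      apply (RInt_correct (V:=R_CompleteNormedModule)); auto. }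
    rewrite HE in HIm.
    assert (A1 := Hr t c ltac:(lra) ltac:(lra)).
    assert (A2 := Hl t c ltac:(lra) ltac:(lra)).
    replace (r t + -1 * c) with (r t - c) in A1 by ring.
    replace (l t + 1 * c) with (l t + c) in A2 by ring.
    specialize (A1 ltac:(apply slab_cl; auto; lra)).
    specialize (A2 ltac:(apply slab_cl; auto; lra)).
    apply Rabs_def2 in A1, A2. unfold flux. lra. }
(* The window [d] was fixed before [c]; now [c] tends to 0 at the two heights [a] and [b]. *)
apply le_epsilon. intros e2 He2.
assert (Hta : - h < a < h) by (apply Hwid; apply Rabs_def1; lra).
assert (Htb : - h < b < h) by (apply Hwid; apply Rabs_def1; lra).
destruct (proj2 (slice_int_limit Q a Hta HQ) (e2 / 2) ltac:(lra)) as [da [Hda La]].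
destruct (proj2 (slice_int_limit Q b Htb HQ) (e2 / 2) ltac:(lra)) as [db [Hdb Lb]].
set (c := Rmin (Rmin da db) (Rmin d (w / 2)) / 2).
assert (Hc0 : 0 < Rmin (Rmin da db) (Rmin d (w / 2))) by (repeat apply Rmin_glb_lt; lra).
pose proof (Rmin_l (Rmin da db) (Rmin d (w / 2))). pose proof (Rmin_r (Rmin da db) (Rmin d (w / 2))).
pose proof (Rmin_l da db). pose proof (Rmin_r da db). pose proof (Rmin_l d (w / 2)). pose proof (Rmin_r d (w / 2)).
specialize (La c ltac:(unfold c; lra)). specialize (Lb c ltac:(unfold c; lra)).
specialize (Hc c ltac:(unfold c; lra) ltac:(unfold c; lra)).
apply Rabs_def2 in La, Lb. lra.
Qed.

End Slab.

Lemma cwithin_mult (S : R -> R -> Prop) (f g : R -> R -> R) (x t : R) :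
  cwithin S f x t -> cwithin S g x t -> cwithin S (fun x t => f x t * g x t) x t.
Proof.
intros Hf Hg e He. destruct (product_close (f x t) (g x t) e He) as [d [Hd H]].
destruct (Hf d Hd) as [d1 [Hd1 H1]]. destruct (Hg d Hd) as [d2 [Hd2 H2]].
exists (Rmin d1 d2). split; [apply Rmin_glb_lt; auto|].
intros x' t' Hc Hx Ht. apply Rmin_Rgt_l in Hx, Ht. destruct Hx, Ht. apply H; auto.
Qed.

Lemma cwithin_plus (S : R -> R -> Prop) (f g : R -> R -> R) (x t : R) :
  cwithin S f x t -> cwithin S g x t -> cwithin S (fun x t => f x t + g x t) x t.
Proof.
intros Hf Hg e He.
destruct (Hf (e / 2) ltac:(lra)) as [d1 [Hd1 H1]]. destruct (Hg (e / 2) ltac:(lra)) as [d2 [Hd2 H2]].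
exists (Rmin d1 d2). split; [apply Rmin_glb_lt; auto|].
intros x' t' Hc Hx Ht. apply Rmin_Rgt_l in Hx, Ht. destruct Hx, Ht.
specialize (H1 x' t' Hc ltac:(auto) ltac:(auto)). specialize (H2 x' t' Hc ltac:(auto) ltac:(auto)).
apply Rabs_def2 in H1, H2. apply Rabs_def1; lra.
Qed.

Lemma cwithin_of_continuity_2d_pt (S : R -> R -> Prop) (f : R -> R -> R) (x t : R) :
  continuity_2d_pt f x t -> cwithin S f x t.
Proof.
intros H e He. destruct (H (mkposreal e He)) as [d Hd].
exists d; split; [apply cond_pos|]. auto.
Qed.

Lemma cwithin_snd (S : R -> R -> Prop) (g : R -> R) (x t : R) :
  continuous g t -> cwithin S (fun _ t => g t) x t.
Proof.
intros H. apply cwithin_of_continuity_2d_pt.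
apply (continuity_1d_2d_pt_comp g (fun _ t => t)).
- apply continuity_pt_filterlim, H.
- apply continuity_2d_pt_id2.
Qed.

(** For fixed [e] this is continuous induction: the supremum of the points reached from [a] at a
    loss of at most [e] per unit length can always be passed, so it is [b]. The window [d] may
    depend on the point. *)
Lemma nondecreasing_of_local_defect (f : R -> R) (a b : R) :
  a <= b ->
  (forall t e, a <= t <= b -> 0 < e -> exists d, 0 < d /\
     forall x y, t - d < x -> x <= y -> y < t + d -> - e * (y - x) <= f y - f x) ->
  f a <= f b.
Proof.
intros Hab H.
assert (Hmain : forall e, 0 < e -> - e * (b - a) <= f b - f a).
{ intros e He.
  set (E := fun x => a <= x <= b /\ - e * (x - a) <= f x - f a).
  destruct (completeness E) as [s [Hs1 Hs2]].
  - exists b. intros x [Hx _]. lra.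
  - exists a. split; lra.
  - assert (Has : a <= s) by (apply Hs1; split; lra).
    assert (Hsb : s <= b) by (apply Hs2; intros x [Hx _]; lra).
    destruct (H s e (conj Has Hsb) He) as [d [Hd Hloc]].
    assert (Hx : exists x, E x /\ s - d < x).
    { apply NNPP. intros Hn. assert (s <= s - d); [|lra].
      apply Hs2. intros x Hx. apply Rnot_lt_le. intros Hlt. apply Hn. exists x; auto. }
    destruct Hx as [x [[Hx1 Hx2] Hx3]].
    assert (Hxs : x <= s) by (apply Hs1; split; auto).
    set (y := Rmin b (s + d / 2)).
    assert (Hy1 : y <= b) by apply Rmin_l. assert (Hy2 : y <= s + d / 2) by apply Rmin_r.
    assert (Hys : s <= y) by (apply Rmin_glb; lra).
    assert (HyE : E y).
    { split; [lra|]. specialize (Hloc x y Hx3 ltac:(lra) ltac:(lra)). lra. }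
    assert (y <= s) by (apply Hs1; auto).
    assert (Hyb : y = b).
    { unfold y, Rmin in *. destruct (Rle_dec b (s + d / 2)); lra. }
    rewrite <- Hyb. apply HyE. }
apply le_epsilon. intros e He.
assert (Hpos : 0 < e / (b - a + 1)) by (apply Rdiv_lt_0_compat; lra).
specialize (Hmain _ Hpos).
assert (e / (b - a + 1) * (b - a) <= e).
{ apply Rle_trans with (e / (b - a + 1) * (b - a + 1)).
  - apply Rmult_le_compat_l; lra.
  - right; field; lra. }
lra.
Qed.

Lemma cos_ge_quadratic (y : R) : 0 <= y -> 1 - y * y / 2 <= cos y.
Proof.
intros Hy. replace (cos y) with (1 - 2 * sin (y / 2) * sin (y / 2)).
2:{ replace y with (2 * (y / 2)) at 3 by field. rewrite cos_2a_sin. ring. }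
assert (H : - (y / 2) <= sin (y / 2) <= y / 2); [|nra].
destruct (Req_dec y 0) as [->|].
{ replace (0 / 2) with 0 by field. rewrite sin_0. lra. }
split; [|left; apply sin_lt_x; lra].
destruct (Rle_or_lt (y / 2) 1).
- assert (0 <= sin (y / 2)); [|lra]. apply sin_ge_0; [lra|]. pose proof PI2_1. lra.
- pose proof (SIN_bound (y / 2)). lra.
Qed.

Section Slab.
Variables (S : R -> R -> Prop) (h M : R) (l r pl pr : R -> R).
Hypothesis HS : slab S h M l r pl pr.

(** The closure may meet the height [tau] in a whole segment, so slices need not shrink. Instead [Q]
    is small near that height, uniformly in [x] by compactness of [[- M, M]]: near each abscissa
    either [Q] is close to 0 or the closure is absent. *)
Lemma slice_int_tip (Q : R -> R -> R) (tau e : R) :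
  0 < h ->
  (forall x t, cl S x t -> cwithin S Q x t) ->
  (forall x, cl S x tau -> Q x tau = 0) -> 0 < e ->
  exists d, 0 < d /\ forall t, - h < t < h -> Rabs (t - tau) < d ->
    Rabs (slice_int l r Q t) <= e.
Proof.
intros Hh HQ H0 He.
assert (HM : 0 < M).
{ pose proof (slab_lt _ _ _ _ _ _ _ HS 0 ltac:(lra)).
  pose proof (slab_bound _ _ _ _ _ _ _ HS 0 ltac:(lra)). lra. }
assert (He' : 0 < e / (2 * M)) by (apply Rdiv_lt_0_compat; lra).
assert (Hloc : forall x, exists d : posreal, forall x' t', cl S x' t' ->
  Rabs (x' - x) < d -> Rabs (t' - tau) < d -> Rabs (Q x' t') < e / (2 * M)).
{ intros x. destruct (classic (cl S x tau)) as [Hc|Hc].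
  - destruct (HQ x tau Hc _ He') as [d [Hd H]]. exists (mkposreal d Hd).
    intros x' t' H1 H2 H3. specialize (H x' t' H1 H2 H3). rewrite (H0 x Hc), Rminus_0_r in H. auto.
  - apply not_all_ex_not in Hc. destruct Hc as [d Hc]. apply imply_to_and in Hc.
    destruct Hc as [Hd Hc].
    assert (Hd2 : 0 < d / 2) by lra. exists (mkposreal _ Hd2). simpl.
    intros x' t' H1 H2 H3. exfalso. apply Hc.
    destruct (H1 (d / 2) Hd2) as [x2 [t2 [A [B C]]]].
    exists x2, t2. split; auto. apply Rabs_def2 in H2, H3, B, C.
    split; apply Rabs_def1; lra. }
set (delta := fun x => proj1_sig (constructive_indefinite_description _ (Hloc x))).
destruct (compactness_value_1d (- M) M delta) as [d Hd].
exists d. split; [apply cond_pos|]. intros t Ht Htau.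
pose proof (slab_lt _ _ _ _ _ _ _ HS t Ht) as Hlt.
pose proof (slab_bound _ _ _ _ _ _ _ HS t Ht) as [Hb1 Hb2].
destruct (slice_int_limit _ _ _ _ _ _ _ HS Q t Ht HQ) as [Hex _].
apply Rle_trans with ((r t - l t) * (e / (2 * M))).
- apply (abs_RInt_le_const (fun x => Q x t)); auto; [lra|].
  (* [compactness_value_1d] gives the covering interval under a double negation. *)
  intros x Hx. left. apply NNPP. intros Hn.
  apply (Hd x ltac:(lra)). intros [y [Hy1 [Hy2 Hy3]]]. apply Hn.
  apply (proj2_sig (constructive_indefinite_description _ (Hloc y))).
  + apply (slab_cl _ _ _ _ _ _ _ HS); auto.
  + exact Hy2.
  + eapply Rlt_le_trans; [exact Htau|exact Hy3].
- apply Rle_trans with (2 * M * (e / (2 * M))).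
  + apply Rmult_le_compat_r; lra.
  + right; field; lra.
Qed.

(** [slice_int_increment] bounds increments from below. For a field without divergence it applies to
    [(P, Q)] and to [(- P, - Q)], and the two bounds squeeze the difference quotient. *)
Lemma is_derive_slice_int (P Q Px Qt : R -> R -> R) (t0 : R) :
  - h < t0 < h ->
  (forall x t, cl S x t -> cwithin S P x t) ->
  (forall x t, cl S x t -> cwithin S Q x t) ->
  (forall x t, S x t -> is_derive (fun x => P x t) x (Px x t)) ->
  (forall x t, S x t -> is_derive (fun t => Q x t) t (Qt x t)) ->
  (forall x t, S x t -> continuity_2d_pt Px x t) ->
  (forall x t, S x t -> continuity_2d_pt Qt x t) ->
  (forall x t, S x t -> Px x t + Qt x t = 0) ->
  is_derive (slice_int l r Q) t0 (- flux l r pl pr P Q t0).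
Proof.
intros Ht HP HQ DP DQ CP CQ Hz.
assert (Hopp : forall f x t, cwithin S f x t -> cwithin S (fun x t => - f x t) x t).
{ intros f x t Hf e He. destruct (Hf e He) as [d [Hd H]]. exists d; split; auto.
  intros x' t' A B C. specialize (H x' t' A B C).
  replace (- f x' t' - - f x t) with (- (f x' t' - f x t)) by ring. rewrite Rabs_Ropp; auto. }
assert (HO : forall t, - h < t < h -> slice_int l r (fun x t => - Q x t) t = - slice_int l r Q t).
{ intros t H. apply (RInt_opp (V:=R_CompleteNormedModule) (fun x => Q x t)).
  apply (slice_int_limit _ _ _ _ _ _ _ HS); auto. }
assert (Hwid := slab_width_near _ _ _ _ _ _ _ HS t0 Ht).
assert (Hm : forall (Px Qt : R -> R -> R), (forall x t, S x t -> Px x t + Qt x t = 0) ->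
  exists d, 0 < d /\ forall t c, Rabs (t - t0) < d -> 0 < c < d ->
     0 <= RInt (fun x => Px x t + Qt x t) (l t + c) (r t - c)).
{ intros Px' Qt' Hz'. destruct Hwid as [d [w [Hd [Hw H]]]].
  exists (Rmin d (w / 2)). split; [apply Rmin_glb_lt; lra|].
  intros t c H1 H2. pose proof (Rmin_l d (w / 2)). pose proof (Rmin_r d (w / 2)).
  destruct (H t ltac:(lra)) as [A B].
  right. symmetry. transitivity (RInt (fun _ => 0) (l t + c) (r t - c)).
  - apply RInt_ext. intros x Hx. rewrite Rmin_left, Rmax_right in Hx by lra.
    apply Hz'. apply (slab_slice _ _ _ _ _ _ _ HS); auto. lra.
  - rewrite RInt_const. apply Rmult_0_r. }
apply is_derive_Reals. intros e He.
assert (He2 : 0 < e / 2) by lra.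
destruct (slice_int_increment _ _ _ _ _ _ _ HS P Q Px Qt t0 0 (e / 2) Ht He2 HP HQ DP DQ CP CQ (Hm Px Qt Hz))
  as [d1 [Hd1 H1]].
destruct (slice_int_increment _ _ _ _ _ _ _ HS (fun x t => - P x t) (fun x t => - Q x t)
  (fun x t => - Px x t) (fun x t => - Qt x t) t0 0 (e / 2) Ht He2) as [d2 [Hd2 H2]]; auto.
{ intros x t H. apply (is_derive_opp (fun x => P x t)); auto. }
{ intros x t H. apply (is_derive_opp (fun t => Q x t)); auto. }
{ intros x t H. apply continuity_2d_pt_opp; auto. }
{ intros x t H. apply continuity_2d_pt_opp; auto. }
{ apply Hm. intros x t H. specialize (Hz x t H). lra. }
destruct Hwid as [dw [w [Hdw [Hw Hin]]]].
assert (Hd : 0 < Rmin (Rmin d1 d2) dw) by (repeat apply Rmin_glb_lt; auto).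
exists (mkposreal _ Hd). simpl. intros u Hu0 Hu.
apply Rmin_Rgt_l in Hu; destruct Hu as [Hu Hu3].
apply Rmin_Rgt_l in Hu; destruct Hu as [Hu1 Hu2].
assert (Hinu : - h < t0 + u < h) by (apply Hin; replace (t0 + u - t0) with u by ring; auto).
assert (HB : forall a b, - h < a < h -> - h < b < h -> t0 - d1 < a -> t0 - d2 < a -> a <= b -> b < t0 + d1 -> b < t0 + d2 ->
  Rabs (slice_int l r Q b - slice_int l r Q a + flux l r pl pr P Q t0 * (b - a)) <= e / 2 * (b - a)).
{ intros a b Ha Hb A1 A2 A3 A4 A5.
  specialize (H1 a b A1 A3 A4). specialize (H2 a b A2 A3 A5).
  rewrite !HO in H2 by auto.
  replace (flux l r pl pr (fun x t => - P x t) (fun x t => - Q x t) t0)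
    with (- flux l r pl pr P Q t0) in H2 by (unfold flux; ring).
  apply Rabs_le. lra. }
replace ((slice_int l r Q (t0 + u) - slice_int l r Q t0) / u - - flux l r pl pr P Q t0)
 with ((slice_int l r Q (t0 + u) - slice_int l r Q t0 + flux l r pl pr P Q t0 * u) / u) by (field; auto).
unfold Rdiv at 1. rewrite Rabs_mult, Rabs_inv.
apply Rmult_lt_reg_r with (Rabs u); [apply Rabs_pos_lt; auto|].
rewrite Rmult_assoc, Rinv_l, Rmult_1_r by (apply Rabs_no_R0; auto).
assert (0 < Rabs u) by (apply Rabs_pos_lt; auto).
apply Rle_lt_trans with (e / 2 * Rabs u); [|nra].
apply Rabs_def2 in Hu1, Hu2.
destruct (Rle_or_lt 0 u).
- specialize (HB t0 (t0 + u) Ht Hinu ltac:(lra) ltac:(lra) ltac:(lra) ltac:(lra) ltac:(lra)).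
  replace (t0 + u - t0) with u in HB by ring. rewrite (Rabs_pos_eq u) by lra. auto.
- specialize (HB (t0 + u) t0 Hinu Ht ltac:(lra) ltac:(lra) ltac:(lra) ltac:(lra) ltac:(lra)).
  replace (t0 - (t0 + u)) with (- u) in HB by ring. rewrite (Rabs_left u) by lra.
  rewrite <- Rabs_Ropp. eapply Rle_trans; [|exact HB]. right; f_equal; ring.
Qed.

End Slab.

(** * The Helmholtz equation on a slab *)

(* [X], [T] are the continuous extensions to the closure of the partial derivatives of [v]. *)
Record helmholtz (S : R -> R -> Prop) (alpha : R) (v X T XX XT TT : R -> R -> R) : Prop := {
  hz_v : forall x t, cl S x t -> cwithin S v x t;
  hz_X : forall x t, cl S x t -> cwithin S X x t;
  hz_T : forall x t, cl S x t -> cwithin S T x t;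
  hz_bd : forall x t, cl S x t -> ~ S x t -> v x t = 0;
  hz_vx : forall x t, S x t -> is_derive (fun x => v x t) x (X x t);
  hz_vt : forall x t, S x t -> is_derive (fun t => v x t) t (T x t);
  hz_Xx : forall x t, S x t -> is_derive (fun x => X x t) x (XX x t);
  hz_Xt : forall x t, S x t -> is_derive (fun t => X x t) t (XT x t);
  hz_Tx : forall x t, S x t -> is_derive (fun x => T x t) x (XT x t);
  hz_Tt : forall x t, S x t -> is_derive (fun t => T x t) t (TT x t);
  hz_XXc : forall x t, S x t -> continuity_2d_pt XX x t;
  hz_XTc : forall x t, S x t -> continuity_2d_pt XT x t;
  hz_TTc : forall x t, S x t -> continuity_2d_pt TT x t;
  hz_eq : forall x t, S x t -> XX x t + TT x t + alpha * v x t = 0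
}.

(** Since [sin] is maximal at [k * h], the deficit at distance tau from the tip is
    [1 - cos (k * tau)], at most [(k * tau)^2 / 2]. Against slopes of order [M / tau] the product is
    still of order tau. *)
Lemma sin_deficit_bound (k h M s : R) :
  0 < k -> 0 <= M -> sin (k * h) = 1 -> h - s < 1 -> 0 < h - s ->
  k * k * (h - s) * (1 + 2 * M) <= 1 ->
  (1 - sin (k * s)) * (2 + 2 * M / (h - s) + 2 * M / (h - s)) <= 1.
Proof.
intros Hk HM Hs H1 H2 H3.
assert (Hc : cos (k * h) = 0).
{ pose proof (sin2_cos2 (k * h)) as H. unfold Rsqr in H. rewrite Hs in H.
  apply Rsqr_0_uniq. unfold Rsqr. lra. }
replace (k * s) with (k * h - k * (h - s)) by ring.
rewrite sin_minus, Hs, Hc.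
set (tau := h - s) in *.
pose proof (cos_ge_quadratic (k * tau) ltac:(nra)).
pose proof (COS_bound (k * tau)).
apply Rle_trans with (k * tau * (k * tau) / 2 * (2 + 2 * M / tau + 2 * M / tau)).
- apply Rmult_le_compat_r; [|lra].
  assert (0 <= 2 * M / tau) by (apply Rdiv_le_0_compat; lra). lra.
- replace (k * tau * (k * tau) / 2 * (2 + 2 * M / tau + 2 * M / tau))
    with (k * k * tau * (tau + 2 * M)) by (field; lra).
  eapply Rle_trans; [|exact H3]. apply Rmult_le_compat_l; [|lra].
  apply Rmult_le_pos; nra.
Qed.

Section Slab.
Variables (S : R -> R -> Prop) (h M : R) (l r pl pr : R -> R).
Hypothesis HS : slab S h M l r pl pr.
Variables (alpha : R) (v X T XX XT TT : R -> R -> R).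
Hypothesis HZ : helmholtz S alpha v X T XX XT TT.

Let op := slab_open _ _ _ _ _ _ _ HS.

Lemma hz_cont (x t : R) : S x t ->
  continuity_2d_pt v x t /\ continuity_2d_pt X x t /\ continuity_2d_pt T x t.
Proof.
intros H. pose proof (op x t H). destruct HZ.
repeat split; apply (cwithin_continuity_2d_pt S); auto using cl_of_mem.
Qed.

Lemma slab_side_zero (t : R) : - h < t < h ->
  v (l t) t = 0 /\ v (r t) t = 0.
Proof.
intros Ht. pose proof (slab_lt _ _ _ _ _ _ _ HS t Ht).
split; apply (hz_bd _ _ _ _ _ _ _ _ HZ).
- apply (slab_cl _ _ _ _ _ _ _ HS); auto; lra.
- intros H'. apply (slab_slice _ _ _ _ _ _ _ HS) in H'; auto; lra.
- apply (slab_cl _ _ _ _ _ _ _ HS); auto; lra.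
- intros H'. apply (slab_slice _ _ _ _ _ _ _ HS) in H'; auto; lra.
Qed.

Lemma no_resonance (k c : R) :
  0 < h -> 0 < k -> alpha = k * k -> sin (k * h) = 1 ->
  (forall t t', - h < t -> t <= t' -> t' < h -> pr t' <= pr t /\ pl t <= pl t') ->
  (forall t, - h < t < h -> Rabs (pl t) <= 2 * M / (h - Rabs t) /\ Rabs (pr t) <= 2 * M / (h - Rabs t)) ->
  (forall t, - h < t < h -> X (r t) t - T (r t) t * pr t = c * sqrt (1 + pr t ^ 2)) ->
  (forall t, - h < t < h -> X (l t) t - T (l t) t * pl t = - (c * sqrt (1 + pl t ^ 2))) ->
  c = 0.
Proof.
intros Hh Hk Hal Hsin Hmon Hbd Hfr Hfl.
apply NNPP. intros Hc.
assert (Hc0 : cos (k * h) = 0).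
{ pose proof (sin2_cos2 (k * h)) as H. unfold Rsqr in H. rewrite Hsin in H.
  apply Rsqr_0_uniq. unfold Rsqr. lra. }
assert (HM : 0 < M).
{ pose proof (slab_lt _ _ _ _ _ _ _ HS 0 ltac:(lra)).
  pose proof (slab_bound _ _ _ _ _ _ _ HS 0 ltac:(lra)). lra. }
(* [(P, Q)] is the Green field w grad v - v grad w with w = cos (k t). Both functions solve the same
   equation, so it has no divergence; [slice_int l r Q] is the [B] of the overview. *)
set (P := fun x t => cos (k * t) * X x t).
set (Q := fun x t => cos (k * t) * T x t + k * sin (k * t) * v x t).
assert (Ccos : forall t, continuous (fun t => cos (k * t)) t).
{ intros t. apply (ex_derive_continuous (fun t => cos (k * t))). auto_derive; auto. }
assert (Csin : forall t, continuous (fun t => k * sin (k * t)) t).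
{ intros t. apply (ex_derive_continuous (fun t => k * sin (k * t))). auto_derive; auto. }
assert (HQ : forall x t, cl S x t -> cwithin S Q x t).
{ intros x t H. apply (cwithin_plus S (fun x t => cos (k * t) * T x t)).
  - apply (cwithin_mult S (fun _ t => cos (k * t))); [apply (cwithin_snd S (fun t => cos (k * t))); auto|].
    apply HZ; auto.
  - apply (cwithin_mult S (fun _ t => k * sin (k * t))); [apply (cwithin_snd S (fun t => k * sin (k * t))); auto|].
    apply HZ; auto. }
assert (HP : forall x t, cl S x t -> cwithin S P x t).
{ intros x t H.
  apply (cwithin_mult S (fun _ t => cos (k * t))); [apply (cwithin_snd S (fun t => cos (k * t))); auto|].
  apply HZ; auto. }
assert (C2 : forall g, (forall t, continuous g t) -> forall x t, continuity_2d_pt (fun _ t => g t) x t).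
{ intros g Hg x t. apply (continuity_1d_2d_pt_comp g (fun _ t => t)); [|apply continuity_2d_pt_id2].
  apply continuity_pt_filterlim, Hg. }
assert (DB : forall t, - h < t < h -> is_derive (slice_int l r Q) t (- flux l r pl pr P Q t)).
{ intros t Ht. apply (is_derive_slice_int _ _ _ _ _ _ _ HS P Q (fun x t => cos (k * t) * XX x t)
    (fun x t => cos (k * t) * (TT x t + k * k * v x t))); auto.
  - intros x t' H. unfold P. apply (is_derive_scal (fun x => X x t')). apply HZ; auto.
  - intros x t' H. unfold Q.
    assert (D1 := hz_Tt _ _ _ _ _ _ _ _ HZ x t' H). assert (D2 := hz_vt _ _ _ _ _ _ _ _ HZ x t' H).
    auto_derive.
    + repeat split; eexists; eauto.
    + replace (Derive (fun x0 => T x x0) t') with (TT x t') by (symmetry; apply is_derive_unique; auto).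
      replace (Derive (fun x0 => v x x0) t') with (T x t') by (symmetry; apply is_derive_unique; auto).
      ring.
  - intros x t' H. apply continuity_2d_pt_mult; [apply (C2 (fun t => cos (k * t))); auto|]. apply HZ; auto.
  - intros x t' H. apply continuity_2d_pt_mult; [apply (C2 (fun t => cos (k * t))); auto|].
    apply continuity_2d_pt_plus; [apply HZ; auto|].
    apply continuity_2d_pt_mult; [apply continuity_2d_pt_const|]. apply hz_cont; auto.
  - intros x t' H. pose proof (hz_eq _ _ _ _ _ _ _ _ HZ x t' H) as E. rewrite Hal in E.
    rewrite <- Rmult_plus_distr_l. replace (XX x t' + (TT x t' + k * k * v x t')) with 0 by lra. ring. }
set (g := fun t => k * cos (k * t) * sqrt (1 + pr t ^ 2) + k * cos (k * t) * sqrt (1 + pl t ^ 2)).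
assert (DB' : forall t, - h < t < h -> is_derive (slice_int l r Q) t (- c / k * g t)).
{ intros t Ht. replace (- c / k * g t) with (- flux l r pl pr P Q t); auto.
  destruct (slab_side_zero t Ht) as [Vl Vr].
  unfold flux, P, Q, g. rewrite Vl, Vr. specialize (Hfr t Ht). specialize (Hfl t Ht).
  replace (- c / k * (k * cos (k * t) * sqrt (1 + pr t ^ 2) + k * cos (k * t) * sqrt (1 + pl t ^ 2)))
   with (- cos (k * t) * (c * sqrt (1 + pr t ^ 2)) + cos (k * t) * (- (c * sqrt (1 + pl t ^ 2)))) by (field; lra).
  rewrite <- Hfr, <- Hfl. ring. }
assert (Cpr : forall t, - h < t < h -> continuous (fun t => k * cos (k * t) * sqrt (1 + pr t ^ 2)) t).
{ intros t Ht. apply (continuous_mult (fun t => k * cos (k * t)) (fun t => sqrt (1 + pr t ^ 2)));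
    [apply continuous_kcos|]. apply continuous_sqrt_1_sqr. apply (slab_dr _ _ _ _ _ _ _ HS); auto. }
assert (Cpl : forall t, - h < t < h -> continuous (fun t => k * cos (k * t) * sqrt (1 + pl t ^ 2)) t).
{ intros t Ht. apply (continuous_mult (fun t => k * cos (k * t)) (fun t => sqrt (1 + pl t ^ 2)));
    [apply continuous_kcos|]. apply continuous_sqrt_1_sqr. apply (slab_dl _ _ _ _ _ _ _ HS); auto. }
assert (Hck : 0 < Rabs c / k) by (apply Rdiv_lt_0_compat; auto; apply Rabs_pos_lt; auto).
assert (HQtop : forall x, cl S x h -> Q x h = 0).
{ intros x H. unfold Q. rewrite Hc0, (hz_bd _ _ _ _ _ _ _ _ HZ x h); auto; [ring|].
  intros H'. apply (slab_height _ _ _ _ _ _ _ HS) in H'. lra. }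
assert (HQbot : forall x, cl S x (- h) -> Q x (- h) = 0).
{ intros x H. unfold Q. replace (k * - h) with (- (k * h)) by ring.
  rewrite cos_neg, Hc0, (hz_bd _ _ _ _ _ _ _ _ HZ x (- h)); auto; [ring|].
  intros H'. apply (slab_height _ _ _ _ _ _ _ HS) in H'. lra. }
(* Half of [Rabs c / k] is allowed at each tip, so the two values differ by at most [Rabs c / k],
   whereas the integral of [g] will be at least 2 and force a difference of [2 * Rabs c / k]. *)
destruct (slice_int_tip _ _ _ _ _ _ _ HS Q h (Rabs c / k / 2) Hh HQ HQtop ltac:(lra)) as [d1 [Hd1 B1]].
destruct (slice_int_tip _ _ _ _ _ _ _ HS Q (- h) (Rabs c / k / 2) Hh HQ HQbot ltac:(lra)) as [d2 [Hd2 B2]].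
assert (Hp : 0 < / (k * k * (1 + 2 * M))) by (apply Rinv_0_lt_compat, Rmult_lt_0_compat; nra).
(* The last bound on [tau] is the smallness hypothesis of [sin_deficit_bound]; [d1] and [d2] put the
   cut within reach of the tip estimates. *)
set (tau := Rmin (Rmin (Rmin d1 d2) (Rmin 1 h)) (/ (k * k * (1 + 2 * M))) / 2).
assert (Ht : 0 < tau /\ tau < d1 /\ tau < d2 /\ tau < 1 /\ tau < h /\ tau < / (k * k * (1 + 2 * M))).
{ unfold tau.
  pose proof (Rmin_l d1 d2). pose proof (Rmin_r d1 d2). pose proof (Rmin_l 1 h). pose proof (Rmin_r 1 h).
  assert (0 < Rmin d1 d2) by (apply Rmin_glb_lt; lra). assert (0 < Rmin 1 h) by (apply Rmin_glb_lt; lra).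
  set (A := Rmin d1 d2) in *. set (A' := Rmin 1 h) in *.
  pose proof (Rmin_l A A'). pose proof (Rmin_r A A'). assert (0 < Rmin A A') by (apply Rmin_glb_lt; lra).
  set (A'' := Rmin A A') in *. set (Z := / (k * k * (1 + 2 * M))) in *.
  pose proof (Rmin_l A'' Z). pose proof (Rmin_r A'' Z). assert (0 < Rmin A'' Z) by (apply Rmin_glb_lt; lra).
  repeat split; lra. }
clearbody tau. destruct Ht as [T0 [T1 [T2 [T3 [T4 T5]]]]].
set (s := h - tau).
assert (Hs : 0 < s < h) by (unfold s; lra).
assert (Hprod : k * k * (h - s) * (1 + 2 * M) <= 1).
{ replace (h - s) with tau by (unfold s; ring).
  apply Rmult_lt_compat_r with (r := k * k * (1 + 2 * M)) in T5; [|apply Rmult_lt_0_compat; nra].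
  rewrite Rinv_l in T5 by (apply Rgt_not_eq, Rmult_lt_0_compat; nra). lra. }
assert (Hdef := sin_deficit_bound k h M s Hk ltac:(lra) Hsin ltac:(unfold s; lra) ltac:(lra) Hprod).
assert (B1s := B1 s ltac:(lra) ltac:(unfold s; apply Rabs_def1; lra)).
assert (B2s := B2 (- s) ltac:(lra) ltac:(unfold s; apply Rabs_def1; lra)).
assert (Ir := RInt_cos_arclength pr s k ltac:(lra) ltac:(lra)
  ltac:(intros; apply (slab_dr _ _ _ _ _ _ _ HS); lra)
  ltac:(intros t t' U1 U2; apply (Hmon t t'); lra)).
(* The left side is convex in [t], so its slope is negated to become nonincreasing; the arclength
   density is unchanged. *)
assert (Il := RInt_cos_arclength (fun t => - pl t) s k ltac:(lra) ltac:(lra)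
  ltac:(intros; apply (continuous_opp pl), (slab_dl _ _ _ _ _ _ _ HS); lra)
  ltac:(intros t t' U1 U2; apply Ropp_le_contravar, (Hmon t t'); lra)).
cbv beta in Il. rewrite !Rabs_Ropp in Il.
assert (Ell : RInt (fun t => k * cos (k * t) * sqrt (1 + (- pl t) ^ 2)) (- s) s
  = RInt (fun t => k * cos (k * t) * sqrt (1 + pl t ^ 2)) (- s) s).
{ apply RInt_ext. intros t _. replace ((- pl t) ^ 2) with (pl t ^ 2) by ring. reflexivity. }
rewrite Ell in Il.
assert (Eint : RInt g (- s) s = RInt (fun t => k * cos (k * t) * sqrt (1 + pr t ^ 2)) (- s) s
   + RInt (fun t => k * cos (k * t) * sqrt (1 + pl t ^ 2)) (- s) s).
{ apply (RInt_plus (V:=R_CompleteNormedModule)); apply (ex_RInt_continuous (V:=R_CompleteNormedModule));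
  intros t Ht; rewrite Rmin_left, Rmax_right in Ht by lra; [apply Cpr|apply Cpl]; lra. }
assert (Cg : forall t, - h < t < h -> continuous g t).
{ intros t Ht. apply (continuous_plus (fun t => k * cos (k * t) * sqrt (1 + pr t ^ 2))); auto. }
assert (EB : slice_int l r Q s - slice_int l r Q (- s) = - c / k * RInt g (- s) s).
{ transitivity (RInt (fun t => - c / k * g t) (- s) s).
  - symmetry. apply is_RInt_unique. apply (is_RInt_derive (slice_int l r Q)).
    + intros t Ht; rewrite Rmin_left, Rmax_right in Ht by lra. apply DB'; lra.
    + intros t Ht; rewrite Rmin_left, Rmax_right in Ht by lra.
      apply (continuous_mult (fun _ => - c / k) g); [apply continuous_const|apply Cg; lra].
  - apply (RInt_scal (V:=R_CompleteNormedModule) g).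
    apply (ex_RInt_continuous (V:=R_CompleteNormedModule)); intros t Ht.
    rewrite Rmin_left, Rmax_right in Ht by lra. apply Cg; lra. }
destruct (Hbd s ltac:(lra)) as [Bl1 Br1]. destruct (Hbd (- s) ltac:(lra)) as [Bl2 Br2].
rewrite Rabs_Ropp in Bl2, Br2. rewrite (Rabs_pos_eq s) in * by lra.
assert (Hns : 0 <= 1 - sin (k * s)) by (pose proof (SIN_bound (k * s)); lra).
assert (Ir' : 1 <= RInt (fun t => k * cos (k * t) * sqrt (1 + pr t ^ 2)) (- s) s).
{ eapply Rle_trans; [|exact Ir].
  assert ((1 - sin (k * s)) * (2 + Rabs (pr s) + Rabs (pr (- s))) <= 1); [|lra].
  eapply Rle_trans; [|exact Hdef]. apply Rmult_le_compat_l; lra. }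
assert (Il' : 1 <= RInt (fun t => k * cos (k * t) * sqrt (1 + pl t ^ 2)) (- s) s).
{ eapply Rle_trans; [|exact Il].
  assert ((1 - sin (k * s)) * (2 + Rabs (pl s) + Rabs (pl (- s))) <= 1); [|lra].
  eapply Rle_trans; [|exact Hdef]. apply Rmult_le_compat_l; lra. }
assert (Habs : Rabs (- c / k * RInt g (- s) s) = Rabs c / k * RInt g (- s) s).
{ rewrite Rabs_mult. f_equal.
  - unfold Rdiv. rewrite Rabs_mult, Rabs_Ropp, (Rabs_pos_eq (/ k)); auto.
    left; apply Rinv_0_lt_compat; auto.
  - apply Rabs_pos_eq. lra. }
rewrite <- EB in Habs.
assert (Rabs (slice_int l r Q s - slice_int l r Q (- s)) <= Rabs c / k).
{ eapply Rle_trans; [apply Rabs_triang|]. rewrite Rabs_Ropp. lra. }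
nra.
Qed.

(* The field [(P, Q)] comes from the multiplier [2 x v_x + v]; its divergence is [2 v_x^2]. *)
Lemma rellich_gradient_zero :
  0 < h ->
  (forall x t, cl S x t -> ~ S x t -> X x t = 0 /\ T x t = 0) ->
  forall x t, S x t -> X x t = 0.
Proof.
intros Hh Hb x0 t0 H0. apply NNPP. intros HX.
set (P := fun x t => x * (X x t * X x t - T x t * T x t + alpha * (v x t * v x t)) + v x t * X x t).
set (Q := fun x t => 2 * x * (X x t * T x t) + v x t * T x t).
set (Px := fun x t => (X x t * X x t - T x t * T x t + alpha * (v x t * v x t))
  + x * (2 * X x t * XX x t - 2 * T x t * XT x t + 2 * alpha * v x t * X x t)
  + (X x t * X x t + v x t * XX x t)).
set (Qt := fun x t => 2 * x * (XT x t * T x t + X x t * TT x t) + (T x t * T x t + v x t * TT x t)).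
assert (Hid : forall x t, cwithin S (fun x _ => x) x t).
{ intros x t. apply cwithin_of_continuity_2d_pt, continuity_2d_pt_id1. }
assert (Hcst : forall c x t, cwithin S (fun _ _ => c) x t).
{ intros c x t. apply cwithin_of_continuity_2d_pt, continuity_2d_pt_const. }
assert (HP : forall x t, cl S x t -> cwithin S P x t).
{ intros x t H. pose proof (hz_v _ _ _ _ _ _ _ _ HZ x t H). pose proof (hz_X _ _ _ _ _ _ _ _ HZ x t H).
  pose proof (hz_T _ _ _ _ _ _ _ _ HZ x t H).
  assert (HN : cwithin S (fun x t => X x t * X x t + (-1) * (T x t * T x t)) x t).
  { apply (cwithin_plus S (fun x t => X x t * X x t) (fun x t => (-1) * (T x t * T x t)));
      repeat (apply cwithin_mult; auto). }
  assert (HN' : cwithin S (fun x t => X x t * X x t - T x t * T x t) x t).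
  { intros e He. destruct (HN e He) as [d [Hd HH]]. exists d; split; auto. intros x' t' A1 A2 A3.
    replace (X x' t' * X x' t' - T x' t' * T x' t' - (X x t * X x t - T x t * T x t))
     with (X x' t' * X x' t' + -1 * (T x' t' * T x' t') - (X x t * X x t + -1 * (T x t * T x t))) by ring.
    auto. }
  apply cwithin_plus; repeat (apply cwithin_mult; auto).
  apply (cwithin_plus S (fun x t => X x t * X x t - T x t * T x t)); auto.
  repeat (apply cwithin_mult; auto). }
assert (HQ : forall x t, cl S x t -> cwithin S Q x t).
{ intros x t H. pose proof (hz_v _ _ _ _ _ _ _ _ HZ x t H). pose proof (hz_X _ _ _ _ _ _ _ _ HZ x t H).
  pose proof (hz_T _ _ _ _ _ _ _ _ HZ x t H).
  apply cwithin_plus; repeat (apply cwithin_mult; auto). }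
assert (DP : forall x t, S x t -> is_derive (fun x => P x t) x (Px x t)).
{ intros x t H. unfold P, Px.
  pose proof (hz_vx _ _ _ _ _ _ _ _ HZ x t H) as D1. pose proof (hz_Xx _ _ _ _ _ _ _ _ HZ x t H) as D2.
  pose proof (hz_Tx _ _ _ _ _ _ _ _ HZ x t H) as D3.
  auto_derive.
  - repeat split; eexists; eauto.
  - replace (Derive (fun x0 => v x0 t) x) with (X x t) by (symmetry; apply is_derive_unique; exact D1).
    replace (Derive (fun x0 => X x0 t) x) with (XX x t) by (symmetry; apply is_derive_unique; exact D2).
    replace (Derive (fun x0 => T x0 t) x) with (XT x t) by (symmetry; apply is_derive_unique; exact D3).
    ring. }
assert (DQ : forall x t, S x t -> is_derive (fun t => Q x t) t (Qt x t)).
{ intros x t H. unfold Q, Qt.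
  pose proof (hz_vt _ _ _ _ _ _ _ _ HZ x t H) as D1. pose proof (hz_Xt _ _ _ _ _ _ _ _ HZ x t H) as D2.
  pose proof (hz_Tt _ _ _ _ _ _ _ _ HZ x t H) as D3.
  auto_derive.
  - repeat split; eexists; eauto.
  - replace (Derive (fun x0 => v x x0) t) with (T x t) by (symmetry; apply is_derive_unique; exact D1).
    replace (Derive (fun x0 => X x x0) t) with (XT x t) by (symmetry; apply is_derive_unique; exact D2).
    replace (Derive (fun x0 => T x x0) t) with (TT x t) by (symmetry; apply is_derive_unique; exact D3).
    ring. }
assert (CP : forall x t, S x t -> continuity_2d_pt Px x t).
{ intros x t H. destruct (hz_cont x t H) as [? [? ?]].
  pose proof (hz_XXc _ _ _ _ _ _ _ _ HZ x t H). pose proof (hz_XTc _ _ _ _ _ _ _ _ HZ x t H).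
  unfold Px.
  repeat first [apply continuity_2d_pt_plus | apply continuity_2d_pt_opp | apply continuity_2d_pt_mult
   | apply continuity_2d_pt_const | apply continuity_2d_pt_id1 | assumption ]. }
assert (CQ : forall x t, S x t -> continuity_2d_pt Qt x t).
{ intros x t H. destruct (hz_cont x t H) as [? [? ?]].
  pose proof (hz_TTc _ _ _ _ _ _ _ _ HZ x t H). pose proof (hz_XTc _ _ _ _ _ _ _ _ HZ x t H).
  unfold Qt.
  repeat first [apply continuity_2d_pt_plus | apply continuity_2d_pt_opp | apply continuity_2d_pt_mult
   | apply continuity_2d_pt_const | apply continuity_2d_pt_id1 | assumption ]. }
assert (Hdiv : forall x t, S x t -> Px x t + Qt x t = 2 * (X x t * X x t)).
{ intros x t H. pose proof (hz_eq _ _ _ _ _ _ _ _ HZ x t H) as E.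
  assert (ET : TT x t = - XX x t - alpha * v x t) by lra.
  unfold Px, Qt. rewrite ET. ring. }
assert (Hfl : forall t, - h < t < h -> flux l r pl pr P Q t = 0).
{ intros t Ht. pose proof (slab_lt _ _ _ _ _ _ _ HS t Ht). destruct (slab_side_zero t Ht) as [Vl Vr].
  destruct (Hb (l t) t) as [A1 A2].
  { apply (slab_cl _ _ _ _ _ _ _ HS); auto; lra. }
  { intros H'. apply (slab_slice _ _ _ _ _ _ _ HS) in H'; auto; lra. }
  destruct (Hb (r t) t) as [A3 A4].
  { apply (slab_cl _ _ _ _ _ _ _ HS); auto; lra. }
  { intros H'. apply (slab_slice _ _ _ _ _ _ _ HS) in H'; auto; lra. }
  unfold flux, P, Q. rewrite Vl, Vr, A1, A2, A3, A4. ring. }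
assert (Hin : forall t c x, - h < t < h -> 0 < c -> l t + c <= x <= r t - c -> S x t).
{ intros t c x Ht Hc Hx. apply (slab_slice _ _ _ _ _ _ _ HS); auto; lra. }
assert (Hexi : forall t c u w, - h < t < h -> 0 < c -> l t + c <= u -> u <= w -> w <= r t - c ->
  ex_RInt (fun x => Px x t + Qt x t) u w).
{ intros t c u w Ht Hc H1 H2 H3. apply (ex_RInt_continuous (V:=R_CompleteNormedModule)); intros x Hx.
  rewrite Rmin_left, Rmax_right in Hx by lra.
  apply (continuity_2d_pt_fst (fun x t => Px x t + Qt x t)).
  apply continuity_2d_pt_plus; [apply CP|apply CQ]; apply (Hin t c); auto; lra. }
assert (Hpos : forall t c u w, - h < t < h -> 0 < c -> l t + c <= u -> u <= w -> w <= r t - c ->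
  0 <= RInt (fun x => Px x t + Qt x t) u w).
{ intros t c u w Ht Hc H1 H2 H3. apply RInt_ge_0; auto; [apply (Hexi t c); auto|].
  intros x Hx. rewrite Hdiv by (apply (Hin t c); auto; lra). nra. }
(* The divergence is nonnegative and the flux vanishes with [v], [X] and [T] on the sides, so the
   slice integral of [Q] can only grow. *)
assert (Hmono : forall a b, - h < a -> a <= b -> b < h -> slice_int l r Q a <= slice_int l r Q b).
{ intros a b Ha Hab Hbh. apply nondecreasing_of_local_defect; auto. intros t e Ht He.
  destruct (slab_width_near _ _ _ _ _ _ _ HS t ltac:(lra)) as [d [w [Hd [Hw Hwid]]]].
  destruct (slice_int_increment _ _ _ _ _ _ _ HS P Q Px Qt t 0 e ltac:(lra) He HP HQ DP DQ CP CQ) as [d' [Hd' H']].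
  { exists (Rmin d (w / 2)). split; [apply Rmin_glb_lt; lra|].
    intros t' c A1 A2. pose proof (Rmin_l d (w / 2)). pose proof (Rmin_r d (w / 2)).
    destruct (Hwid t' ltac:(lra)). apply (Hpos t' c); lra. }
  exists d'; split; auto. intros x y A1 A2 A3. specialize (H' x y A1 A2 A3).
  rewrite Hfl in H' by lra. lra. }
assert (Hz : forall tau x, tau = h \/ tau = - h -> cl S x tau -> Q x tau = 0).
{ intros tau x Ht Hc. assert (Hn : ~ S x tau).
  { intros H'. apply (slab_height _ _ _ _ _ _ _ HS) in H'. lra. }
  unfold Q. destruct (Hb x tau Hc Hn) as [E1 E2]. rewrite E2. ring. }
(* It also tends to 0 at both tips, so it is identically 0. *)
assert (HB0 : forall t, - h < t < h -> slice_int l r Q t = 0).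
{ intros t Ht. apply Rle_antisym.
  - apply le_epsilon. intros e He.
    destruct (slice_int_tip _ _ _ _ _ _ _ HS Q h e Hh HQ) as [d [Hd HT]]; auto.
    set (s := Rmax t (h - d / 2)).
    assert (Hs : t <= s /\ h - d < s /\ s < h).
    { unfold s. pose proof (Rmax_l t (h - d / 2)). pose proof (Rmax_r t (h - d / 2)).
      repeat split; try lra. apply Rmax_lub_lt; lra. }
    specialize (HT s ltac:(lra) ltac:(apply Rabs_def1; lra)).
    apply Rabs_le_between in HT. pose proof (Hmono t s ltac:(lra) ltac:(lra) ltac:(lra)). lra.
  - apply le_epsilon. intros e He.
    destruct (slice_int_tip _ _ _ _ _ _ _ HS Q (- h) e Hh HQ) as [d [Hd HT]]; auto.
    set (s := Rmin t (- h + d / 2)).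
    assert (Hs : s <= t /\ s < - h + d /\ - h < s).
    { unfold s. pose proof (Rmin_l t (- h + d / 2)). pose proof (Rmin_r t (- h + d / 2)).
      repeat split; try lra. apply Rmin_glb_lt; lra. }
    specialize (HT s ltac:(lra) ltac:(apply Rabs_def1; lra)).
    apply Rabs_le_between in HT. pose proof (Hmono s t ltac:(lra) ltac:(lra) ltac:(lra)). lra. }
assert (Ht0 := slab_height _ _ _ _ _ _ _ HS x0 t0 H0).
(* If [X] were nonzero at [(x0, t0)], the divergence would be at least [mu] on a box of half-width
   [4 * d] around it, and the slice integral would strictly increase across the box. *)
set (mu := X x0 t0 * X x0 t0).
assert (Hmu : 0 < mu) by (unfold mu; nra).
assert (HmuC : continuity_2d_pt (fun x t => X x t * X x t) x0 t0).
{ destruct (hz_cont x0 t0 H0) as [? [? ?]]. apply continuity_2d_pt_mult; auto. }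
destruct (HmuC (mkposreal (mu / 2) ltac:(lra))) as [d1 HN1].
destruct (op x0 t0 H0) as [d2 HN2].
set (d := Rmin d1 d2 / 4).
assert (Hd : 0 < d).
{ unfold d. apply Rdiv_lt_0_compat; [|lra]. apply Rmin_glb_lt; apply cond_pos. }
assert (Hd1 : 4 * d <= d1) by (unfold d; pose proof (Rmin_l d1 d2); lra).
assert (Hd2 : 4 * d <= d2) by (unfold d; pose proof (Rmin_r d1 d2); lra).
destruct (slice_int_increment _ _ _ _ _ _ _ HS P Q Px Qt t0 (d * mu) (d * mu / 2) Ht0
  ltac:(nra) HP HQ DP DQ CP CQ) as [d' [Hd' H']].
{ exists d. split; auto. intros t c Ht Hc.
  assert (Hbox : forall x, Rabs (x - x0) < 4 * d -> S x t /\ mu / 2 <= X x t * X x t).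
  { intros x Hx. split; [apply HN2; lra|].
    specialize (HN1 x t ltac:(lra) ltac:(lra)). simpl in HN1. apply Rabs_def2 in HN1. fold mu in HN1. lra. }
  assert (Htt : - h < t < h).
  { destruct (Hbox x0) as [HSx _]; [rewrite Rminus_eq_0, Rabs_R0; lra|].
    apply (slab_height _ _ _ _ _ _ _ HS) in HSx. auto. }
  assert (L1 : l t < x0 - 3 * d).
  { destruct (Hbox (x0 - 3 * d)) as [HSx _]; [apply Rabs_def1; lra|].
    apply (slab_slice _ _ _ _ _ _ _ HS) in HSx; auto; lra. }
  assert (L2 : x0 + 3 * d < r t).
  { destruct (Hbox (x0 + 3 * d)) as [HSx _]; [apply Rabs_def1; lra|].
    apply (slab_slice _ _ _ _ _ _ _ HS) in HSx; auto; lra. }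
  set (G := fun x => Px x t + Qt x t).
  assert (E1 : RInt G (l t + c) (x0 - d) + RInt G (x0 - d) (x0 + d) = RInt G (l t + c) (x0 + d)).
  { apply (RInt_Chasles G); apply (Hexi t c); auto; lra. }
  assert (E2 : RInt G (l t + c) (x0 + d) + RInt G (x0 + d) (r t - c) = RInt G (l t + c) (r t - c)).
  { apply (RInt_Chasles G); apply (Hexi t c); auto; lra. }
  assert (P1 : 0 <= RInt G (l t + c) (x0 - d)) by (apply (Hpos t c); auto; lra).
  assert (P2 : 0 <= RInt G (x0 + d) (r t - c)) by (apply (Hpos t c); auto; lra).
  assert (P3 : 2 * d * mu <= RInt G (x0 - d) (x0 + d)).
  { replace (2 * d * mu) with (RInt (fun _ => mu) (x0 - d) (x0 + d)).
    - apply RInt_le; [lra|apply ex_RInt_const|apply (Hexi t c); auto; lra|].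
      intros x Hx. unfold G. destruct (Hbox x) as [HSx HXx]; [apply Rabs_def1; lra|].
      rewrite Hdiv by auto. lra.
    - rewrite RInt_const. unfold scal; simpl; unfold mult; simpl. ring. }
  fold G. nra. }
set (b := Rmin (t0 + d' / 2) ((t0 + h) / 2)).
assert (Hb' : t0 < b /\ b < t0 + d' /\ b < h).
{ unfold b. pose proof (Rmin_l (t0 + d' / 2) ((t0 + h) / 2)). pose proof (Rmin_r (t0 + d' / 2) ((t0 + h) / 2)).
  repeat split; try lra. apply Rmin_glb_lt; lra. }
specialize (H' t0 b ltac:(lra) ltac:(lra) ltac:(lra)).
rewrite Hfl, !HB0 in H' by lra.
assert (0 < d * mu / 2 * (b - t0)); [|lra].
apply Rmult_lt_0_compat; nra.
Qed.

(** Each slice is a segment ending on the boundary, where [v] vanishes, and [v] is constant along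
    it. *)
Lemma zero_of_gradient_zero :
  (forall x t, S x t -> X x t = 0) -> forall x t, S x t -> v x t = 0.
Proof.
intros HX x t Hxt.
pose proof (slab_height _ _ _ _ _ _ _ HS x t Hxt) as Ht.
pose proof (proj1 (slab_slice _ _ _ _ _ _ _ HS x t Ht) Hxt) as Hx.
destruct (slab_side_zero t Ht) as [Vl _].
apply NNPP. intros Hn.
assert (Ha : 0 < Rabs (v x t)) by (apply Rabs_pos_lt; auto).
assert (Hcl : cl S (l t) t) by (apply (slab_cl _ _ _ _ _ _ _ HS); auto; lra).
destruct (hz_v _ _ _ _ _ _ _ _ HZ (l t) t Hcl (Rabs (v x t)) Ha) as [d [Hd H]].
set (y := l t + Rmin (d / 2) ((x - l t) / 2)).
assert (Hy : l t < y /\ y < l t + d /\ y < x).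
{ unfold y. pose proof (Rmin_l (d / 2) ((x - l t) / 2)). pose proof (Rmin_r (d / 2) ((x - l t) / 2)).
  assert (0 < Rmin (d / 2) ((x - l t) / 2)) by (apply Rmin_glb_lt; lra). repeat split; lra. }
assert (HSy : forall z, y <= z <= x -> S z t).
{ intros z Hz. apply (slab_slice _ _ _ _ _ _ _ HS); auto; lra. }
destruct (MVT_gen (fun x => v x t) y x (fun x => X x t)) as [z [Hz E]].
- intros z. rewrite Rmin_left, Rmax_right by lra. intros Hz. apply HZ, HSy; lra.
- intros z. rewrite Rmin_left, Rmax_right by lra. intros Hz.
  apply continuity_pt_filterlim, (continuity_2d_pt_fst v), hz_cont, HSy; auto.
- rewrite Rmin_left, Rmax_right in Hz by lra. rewrite HX in E by auto.
  assert (HH := H y t ltac:(apply cl_of_mem, HSy; lra) ltac:(apply Rabs_def1; lra)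
    ltac:(rewrite Rminus_eq_0, Rabs_R0; auto)).
  rewrite Vl, Rminus_0_r in HH. replace (v y t) with (v x t) in HH by lra. lra.
Qed.

End Slab.

(** * Slicing a symmetric convex body *)

Lemma open_convex_interval (E : R -> Prop) (M x0 : R) :
  E x0 -> (forall x, E x -> - M <= x <= M) ->
  (forall x, E x -> exists d, 0 < d /\ forall y, Rabs (y - x) < d -> E y) ->
  (forall x y z, E x -> E y -> x <= z <= y -> E z) ->
  exists l r, l < r /\ - M <= l /\ r <= M /\ forall x, E x <-> l < x < r.
Proof.
intros H0 HM Ho Hc.
destruct (completeness E) as [r [Hr1 Hr2]].
{ exists M. intros x Hx. apply HM; auto. }
{ exists x0; auto. }
destruct (completeness (fun x => E (- x))) as [l' [Hl1 Hl2]].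
{ exists M. intros x Hx. apply HM in Hx. lra. }
{ exists (- x0). rewrite Ropp_involutive; auto. }
assert (Hup : forall x, E x -> x < r).
{ intros x Hx. destruct (Ho x Hx) as [d [Hd H]].
  assert (x + d / 2 <= r); [|lra]. apply Hr1, H. apply Rabs_def1; lra. }
assert (Hdn : forall x, E x -> - l' < x).
{ intros x Hx. destruct (Ho x Hx) as [d [Hd H]].
  assert (- (x - d / 2) <= l'); [|lra]. apply Hl1. rewrite Ropp_involutive. apply H, Rabs_def1; lra. }
exists (- l'), r.
pose proof (Hup x0 H0). pose proof (Hdn x0 H0).
repeat split; try lra; auto.
- assert (l' <= M); [|lra]. apply Hl2. intros x Hx. apply HM in Hx. lra.
- apply Hr2. intros x Hx. apply HM; auto.
- intros [A B].
  assert (U1 : exists y, E y /\ x <= y).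
  { apply NNPP; intros Hn. assert (r <= x); [|lra]. apply Hr2. intros y Hy.
    apply Rnot_lt_le. intros Hlt. apply Hn. exists y; split; auto; lra. }
  assert (U2 : exists y, E y /\ y <= x).
  { apply NNPP; intros Hn. assert (l' <= - x); [|lra]. apply Hl2. intros y Hy.
    apply Rnot_lt_le. intros Hlt. apply Hn. exists (- y); split; auto; lra. }
  destruct U1 as [y1 [? ?]], U2 as [y2 [? ?]]. apply (Hc y2 y1); auto.
Qed.

Record sym_body (S : R -> R -> Prop) (M : R) : Prop := {
  sb_ne : exists x t, S x t;
  sb_open : forall x t, S x t -> locally_2d S x t;
  sb_convex : forall x t x' t' a, S x t -> S x' t' -> 0 <= a <= 1 -> S (x + a * (x' - x)) (t + a * (t' - t));
  sb_sym : forall x t, S x t -> S (- x) (- t);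
  sb_bound : forall x t, S x t -> - M <= x <= M
}.

(** In a rotated frame centred at the centre of symmetry, [h] is the value of the support function
    of the domain in the direction of the height. *)
Definition sup_height (S : R -> R -> Prop) (h : R) : Prop :=
  (forall x t, S x t -> t <= h) /\ forall s, s < h -> exists x t, S x t /\ s < t.

Lemma sym_body_origin (S : R -> R -> Prop) (M : R) : sym_body S M -> S 0 0.
Proof.
intros [[x [t H]] _ Hc Hs _].
assert (H' := Hc x t (- x) (- t) (1 / 2) H (Hs _ _ H) ltac:(lra)).
replace (x + 1 / 2 * (- x - x)) with 0 in H' by field.
replace (t + 1 / 2 * (- t - t)) with 0 in H' by field. auto.
Qed.

Lemma sup_height_lt (S : R -> R -> Prop) (M h x t : R) :
  sym_body S M -> sup_height S h -> S x t -> - h < t < h.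
Proof.
intros HB [H1 _] H.
assert (Hlt : forall x t, S x t -> t < h).
{ intros y s Hy. destruct (sb_open _ _ HB y s Hy) as [d Hd].
  assert (s + d / 2 <= h).
  { apply (H1 y). pose proof (cond_pos d). apply Hd; [rewrite Rminus_eq_0, Rabs_R0|apply Rabs_def1]; lra. }
  pose proof (cond_pos d). lra. }
pose proof (Hlt _ _ H). pose proof (Hlt _ _ (sb_sym _ _ HB _ _ H)). lra.
Qed.

Lemma sym_body_slices (S : R -> R -> Prop) (M h : R) :
  sym_body S M -> sup_height S h ->
  exists l r : R -> R, forall t, - h < t < h ->
    l t < r t /\ - M <= l t /\ r t <= M /\ forall x, S x t <-> l t < x < r t.
Proof.
intros HB Hh.
assert (H : forall t, exists p : R * R, - h < t < h ->
    fst p < snd p /\ - M <= fst p /\ snd p <= M /\ forall x, S x t <-> fst p < x < snd p).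
{ intros t. destruct (classic (- h < t < h)) as [Ht|Hn].
  2:{ exists (0, 0). tauto. }
  assert (Hx : exists x, S x t).
  { destruct (proj2 Hh (Rabs t)) as [x [s [Hx Hs]]]; [apply Rabs_def1; lra|].
    pose proof (Rle_abs t). pose proof (Rle_abs (- t)) as H'. rewrite Rabs_Ropp in H'.
    (* The segment from [(- x, - s)] to [(x, s)] crosses the height [t], because [Rabs t < s]. *)
    exists (- x + (t + s) / (2 * s) * (x - - x)).
    replace t with (- s + (t + s) / (2 * s) * (s - - s)) at 2 by (field; lra).
    apply (sb_convex _ _ HB); auto; [apply (sb_sym _ _ HB); auto|].
    split; [apply Rdiv_le_0_compat; lra|]. apply Rmult_le_reg_r with (2 * s); [lra|].
    unfold Rdiv. rewrite Rmult_assoc, Rinv_l; lra. }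
  destruct Hx as [x0 Hx0].
  destruct (open_convex_interval (fun x => S x t) M x0) as [l [r H]]; auto.
  - intros x Hx. apply (sb_bound _ _ HB x t); auto.
  - intros x Hx. destruct (sb_open _ _ HB x t Hx) as [d Hd]. exists d; split; [apply cond_pos|].
    intros y Hy. apply Hd; auto. rewrite Rminus_eq_0, Rabs_R0. apply cond_pos.
  - intros x y z Hx Hy Hz. destruct (Req_dec x y) as [->|Hxy].
    { replace z with y by lra. auto. }
    replace z with (x + (z - x) / (y - x) * (y - x)) by (field; lra).
    replace t with (t + (z - x) / (y - x) * (t - t)) by ring.
    apply (sb_convex _ _ HB); auto. split; [apply Rdiv_le_0_compat; lra|].
    apply Rmult_le_reg_r with (y - x); [lra|]. unfold Rdiv. rewrite Rmult_assoc, Rinv_l; lra.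
  - exists (l, r). intros _. exact H. }
exists (fun t => fst (proj1_sig (constructive_indefinite_description _ (H t)))),
  (fun t => snd (proj1_sig (constructive_indefinite_description _ (H t)))).
intros t. apply (proj2_sig (constructive_indefinite_description _ (H t))).
Qed.

(** * Normals of a convex body and the regularity of its sides *)

(** The second clause is strict support, the third is tangency: boundary points leave the line
    orthogonal to the normal by o(distance). Together they hold what is kept of a chart. *)
Definition has_normal (S : R -> R -> Prop) (x t n1 n2 : R) : Prop :=
  n1 ^ 2 + n2 ^ 2 = 1 /\
  (forall x' t', S x' t' -> n1 * (x' - x) + n2 * (t' - t) < 0) /\
  forall e, 0 < e -> exists d, 0 < d /\ forall x' t', cl S x' t' -> ~ S x' t' ->
    Rabs (x' - x) < d -> Rabs (t' - t) < d ->
    Rabs (n1 * (x' - x) + n2 * (t' - t)) <= e * (Rabs (x' - x) + Rabs (t' - t)).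

Lemma has_normal_cl (S : R -> R -> Prop) (x t n1 n2 x' t' : R) :
  has_normal S x t n1 n2 -> cl S x' t' -> n1 * (x' - x) + n2 * (t' - t) <= 0.
Proof.
intros [H1 [H2 _]] Hc. apply le_epsilon. intros e He.
destruct (Hc (e / 2) ltac:(lra)) as [x2 [t2 [A [B C]]]].
specialize (H2 _ _ A). apply Rabs_def2 in B, C.
assert (- 1 <= n1 <= 1) by (split; nra). assert (- 1 <= n2 <= 1) by (split; nra).
assert (n1 * (x' - x2) <= e / 2).
{ destruct (Rle_or_lt 0 n1); [destruct (Rle_or_lt 0 (x' - x2)); nra|destruct (Rle_or_lt 0 (x' - x2)); nra]. }
assert (n2 * (t' - t2) <= e / 2).
{ destruct (Rle_or_lt 0 n2); [destruct (Rle_or_lt 0 (t' - t2)); nra|destruct (Rle_or_lt 0 (t' - t2)); nra]. }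
lra.
Qed.

(** Compare with the points halfway to the nearer end, on both sides of [t]: the supergradient line
    would otherwise force a variation of [f] beyond [2 * M]. *)
Lemma supergradient_bound (f q : R -> R) (h M t : R) :
  (forall t, - h < t < h -> - M <= f t <= M) ->
  (forall a b, - h < a < h -> - h < b < h -> f b <= f a + q a * (b - a)) ->
  - h < t < h -> Rabs (q t) <= 4 * M / (h - Rabs t).
Proof.
intros Hf Hq Ht.
assert (Hd : 0 < h - Rabs t) by (assert (Rabs t < h) by (apply Rabs_def1; lra); lra).
pose proof (Rle_abs t). pose proof (Rle_abs (- t)) as Hn. rewrite Rabs_Ropp in Hn.
set (k := (h - Rabs t) / 2).
assert (Hk : 0 < k) by (unfold k; lra).
assert (- h < t + k < h) by (unfold k; lra). assert (- h < t - k < h) by (unfold k; lra).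
pose proof (Hq t (t + k) Ht ltac:(auto)) as A. pose proof (Hq t (t - k) Ht ltac:(auto)) as B.
replace (t + k - t) with k in A by ring. replace (t - k - t) with (- k) in B by ring.
pose proof (Hf t Ht). pose proof (Hf (t + k) ltac:(auto)). pose proof (Hf (t - k) ltac:(auto)).
replace (4 * M / (h - Rabs t)) with (2 * M / k) by (unfold k; field; lra).
assert (Hmk : 2 * M / k * k = 2 * M) by (field; lra).
apply Rabs_le. split; apply Rmult_le_reg_r with k; auto; nra.
Qed.

(** Supergradients are monotone, so any selection of them is continuous at a point where the
    function is differentiable. *)
Lemma supergradient_continuous (f q : R -> R) (h t : R) :
  (forall a b, - h < a < h -> - h < b < h -> f b <= f a + q a * (b - a)) ->
  - h < t < h -> is_derive f t (q t) -> continuous q t.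
Proof.
intros Hq Ht HD. apply (filterlim_locally q). intros eps.
apply is_derive_Reals in HD.
assert (He : 0 < eps / 3) by (pose proof (cond_pos eps); lra).
destruct (HD (eps / 3) He) as [d Hd].
assert (Hm : 0 < Rmin (d / 2) (Rmin ((h - t) / 2) ((t + h) / 2))).
{ pose proof (cond_pos d). repeat apply Rmin_glb_lt; lra. }
exists (mkposreal _ Hm). intros b Hb. change (Rabs (b - t) < Rmin (d / 2) (Rmin ((h - t) / 2) ((t + h) / 2))) in Hb.
apply Rmin_Rgt_l in Hb; destruct Hb as [Hb1 Hb]. apply Rmin_Rgt_l in Hb; destruct Hb as [Hb2 Hb3].
change (Rabs (q b - q t) < eps).
destruct (Req_dec b t) as [->|Hbt].
{ rewrite Rminus_eq_0, Rabs_R0. apply cond_pos. }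
set (s := b - t) in *. assert (Hs : s <> 0) by (unfold s; lra).
(* The supergradients at [t] and [b] bound [f (t + 2 * s) - f t] above by [(q t + q b) * s], and
   differentiability at [t] nearly attains [2 * q t * s]; so [q b] cannot be far from [q t]. *)
assert (A := Hd (2 * s) ltac:(lra) ltac:(rewrite Rabs_mult, (Rabs_pos_eq 2); lra)).
apply Rabs_def2 in Hb2, Hb3.
assert (B1 := Hq t b Ht ltac:(unfold s in *; lra)).
assert (B2 := Hq b (t + 2 * s) ltac:(unfold s in *; lra) ltac:(lra)).
assert (B3 := Hq b t ltac:(unfold s in *; lra) Ht).
fold s in B1. replace (t + 2 * s - b) with s in B2 by (unfold s; ring).
replace (t - b) with (- s) in B3 by (unfold s; ring).
apply Rabs_def2 in A. destruct A as [A1 A2].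
assert (E : (f (t + 2 * s) - f t) / (2 * s) * (2 * s) = f (t + 2 * s) - f t) by (field; auto).
set (D := (f (t + 2 * s) - f t) / (2 * s)) in *.
destruct (Rlt_or_le 0 s) as [Hp|Hp].
- assert (q b <= q t) by nra. assert (q t - 2 * (eps / 3) <= q b) by nra.
  pose proof (cond_pos eps). apply Rabs_def1; lra.
- assert (Hn : s < 0) by lra.
  assert (q t <= q b) by nra. assert (q b <= q t + 2 * (eps / 3)) by nra.
  pose proof (cond_pos eps). apply Rabs_def1; lra.
Qed.

(** [sg] is 1 on the right side and [- 1] on the left, so that [sg * rho] is concave in both cases.
    The slope is read off the normal as [- n2 / n1]: strict support makes it a supergradient,
    tangency makes it the derivative, and concavity then gives its continuity. *)
Lemma graph_side (S : R -> R -> Prop) (h M c sg : R) (rho : R -> R) (X T : R -> R -> R) :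
  0 <= M -> (sg = 1 \/ sg = - 1) ->
  (forall t, - h < t < h ->
     cl S (rho t) t /\ ~ S (rho t) t /\ - M <= rho t <= M /\
     (exists x, S x t /\ 0 < sg * (rho t - x)) /\
     exists n1 n2, has_normal S (rho t) t n1 n2 /\ X (rho t) t * n1 + T (rho t) t * n2 = c) ->
  exists p : R -> R, forall t, - h < t < h ->
    is_derive rho t (p t) /\ continuous p t /\
    Rabs (p t) <= 4 * M / (h - Rabs t) /\
    (forall t', t <= t' -> t' < h -> sg * p t' <= sg * p t) /\
    X (rho t) t - T (rho t) t * p t = sg * (c * sqrt (1 + p t ^ 2)).
Proof.
intros HM Hsg H.
assert (Hch : forall t, exists p, - h < t < h -> exists n1 n2, has_normal S (rho t) t n1 n2 /\
   X (rho t) t * n1 + T (rho t) t * n2 = c /\ 0 < sg * n1 /\ p = - n2 / n1).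
{ intros t. destruct (classic (- h < t < h)) as [Ht|Hn]; [|exists 0; tauto].
  destruct (H t Ht) as [_ [_ [_ [[x [Hx1 Hx2]] [n1 [n2 [Hn Hc]]]]]]].
  exists (- n2 / n1). intros _. exists n1, n2. repeat split; auto; try apply Hn.
  (* An interior point at the same height tests only the horizontal component of the normal, whose
     sign is therefore that of [sg]. *)
  destruct Hn as [_ [Hn _]]. specialize (Hn x t Hx1). destruct Hsg; subst sg; nra. }
set (p := fun t => proj1_sig (constructive_indefinite_description _ (Hch t))).
assert (Hp : forall t, - h < t < h -> exists n1 n2, has_normal S (rho t) t n1 n2 /\
   X (rho t) t * n1 + T (rho t) t * n2 = c /\ 0 < sg * n1 /\ p t = - n2 / n1).
{ intros t. apply (proj2_sig (constructive_indefinite_description _ (Hch t))). }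
clearbody p. clear Hch.
set (f := fun t => sg * rho t). set (q := fun t => sg * p t).
assert (Hsg2 : sg * sg = 1) by (destruct Hsg; subst sg; ring).
assert (Hsga : Rabs sg = 1) by (destruct Hsg; subst sg; unfold Rabs; destruct Rcase_abs; lra).
assert (Hf : forall t, - h < t < h -> - M <= f t <= M).
{ intros t Ht. destruct (H t Ht) as [_ [_ [HH _]]]. unfold f. destruct Hsg; subst sg; lra. }
assert (Hq : forall a b, - h < a < h -> - h < b < h -> f b <= f a + q a * (b - a)).
{ intros a b Ha Hb. destruct (Hp a Ha) as [n1 [n2 [Hn [_ [Hn1 Hpa]]]]].
  destruct (H b Hb) as [Hcb _].
  pose proof (has_normal_cl _ _ _ _ _ _ _ Hn Hcb) as HH.
  unfold f, q. rewrite Hpa.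
  assert (Hn0 : n1 <> 0) by (intros ->; lra).
  assert (E : sg * n1 * (sg * (rho b - rho a)) <= sg * n1 * (sg * (- n2 / n1) * (b - a))).
  { replace (sg * n1 * (sg * (rho b - rho a))) with (sg * sg * (n1 * (rho b - rho a))) by ring.
    replace (sg * n1 * (sg * (- n2 / n1) * (b - a))) with (sg * sg * (- n2 * (b - a))) by (field; auto).
    rewrite Hsg2. lra. }
  apply Rmult_le_reg_l in E; auto. lra. }
assert (Hqb : forall t, - h < t < h -> Rabs (q t) <= 4 * M / (h - Rabs t)).
{ intros t Ht. apply (supergradient_bound f q h M t); auto. }
assert (HD : forall t, - h < t < h -> is_derive rho t (p t)).
{ intros t Ht.
  assert (HDD : 0 < h - Rabs t) by (assert (Rabs t < h) by (apply Rabs_def1; lra); lra).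
  set (D := h - Rabs t) in *. set (K := 8 * M / D).
  assert (HK : 0 <= K) by (unfold K; apply Rdiv_le_0_compat; lra).
  (* Tangency bounds the error by [Rabs (rho (t + u) - rho t) + Rabs u]; a local Lipschitz bound
     from the supergradients turns this into a multiple of [Rabs u]. *)
  assert (HL : forall u, Rabs u < D / 2 -> - h < t + u < h /\ Rabs (rho (t + u) - rho t) <= K * Rabs u).
  { intros u Hu.
    assert (Hb : Rabs (t + u) <= h - D / 2) by (pose proof (Rabs_triang t u); unfold D in *; lra).
    assert (Htu : - h < t + u < h).
    { apply Rabs_le_between in Hb. lra. }
    split; auto.
    assert (Q1 := Hq t (t + u) Ht Htu). assert (Q2 := Hq (t + u) t Htu Ht).
    assert (B1 : Rabs (q t) <= K).
    { eapply Rle_trans; [apply Hqb; auto|]. fold D. unfold K, Rdiv.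
      apply Rmult_le_compat_r; [left; apply Rinv_0_lt_compat; auto|lra]. }
    assert (B2 : Rabs (q (t + u)) <= K).
    { eapply Rle_trans; [apply Hqb; auto|].
      replace K with (4 * M / (D / 2)) by (unfold K; field; lra).
      apply Rmult_le_compat_l; [lra|]. apply Rinv_le_contravar; lra. }
    replace (t + u - t) with u in Q1 by ring. replace (t - (t + u)) with (- u) in Q2 by ring.
    assert (C1 : q t * u <= K * Rabs u).
    { eapply Rle_trans; [apply Rle_abs|]. rewrite Rabs_mult. apply Rmult_le_compat_r; auto using Rabs_pos. }
    assert (C2 : q (t + u) * - u <= K * Rabs u).
    { eapply Rle_trans; [apply Rle_abs|]. rewrite Rabs_mult, Rabs_Ropp. apply Rmult_le_compat_r; auto using Rabs_pos. }
    assert (Hff : Rabs (f (t + u) - f t) <= K * Rabs u) by (apply Rabs_le; lra).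
    unfold f in Hff. rewrite <- Rmult_minus_distr_l, Rabs_mult in Hff.
    rewrite Hsga in Hff. lra. }
  destruct (Hp t Ht) as [n1 [n2 [[_ [_ Hn]] [_ [Hn1 Hpa]]]]].
  assert (Hn0 : n1 <> 0) by (intros ->; lra).
  assert (Hn0' : 0 < Rabs n1) by (apply Rabs_pos_lt; auto).
  apply is_derive_Reals. intros e He.
  set (e' := e * Rabs n1 / (2 * (K + 1))).
  assert (He' : 0 < e') by (unfold e'; apply Rdiv_lt_0_compat; [apply Rmult_lt_0_compat|]; lra).
  destruct (Hn e' He') as [d [Hd HH]].
  assert (Hdd : 0 < Rmin (D / 2) (d / (K + 1))).
  { apply Rmin_glb_lt; [lra|]. apply Rdiv_lt_0_compat; lra. }
  exists (mkposreal _ Hdd). simpl. intros u Hu0 Hu.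
  apply Rmin_Rgt_l in Hu. destruct Hu as [Hu1 Hu2].
  destruct (HL u Hu1) as [Htu HLu].
  assert (Hu3 : Rabs u * (K + 1) < d).
  { apply Rmult_lt_reg_r with (/ (K + 1)); [apply Rinv_0_lt_compat; lra|].
    rewrite Rmult_assoc, Rinv_r; lra. }
  pose proof (Rabs_pos u).
  destruct (H (t + u) Htu) as [Hc1 [Hc2 _]].
  assert (HH' := HH _ _ Hc1 Hc2 ltac:(nra) ltac:(replace (t + u - t) with u by ring; nra)).
  replace (t + u - t) with u in HH' by ring.
  assert (H3 : Rabs (n1 * (rho (t + u) - rho t) + n2 * u) <= e * Rabs n1 / 2 * Rabs u).
  { eapply Rle_trans; [exact HH'|].
    replace (e * Rabs n1 / 2 * Rabs u) with (e' * ((K + 1) * Rabs u)) by (unfold e'; field; lra).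
    apply Rmult_le_compat_l; lra. }
  rewrite Hpa.
  replace ((rho (t + u) - rho t) / u - - n2 / n1)
    with ((n1 * (rho (t + u) - rho t) + n2 * u) * / (n1 * u)) by (field; auto).
  assert (Hpu : 0 < Rabs u) by (apply Rabs_pos_lt; auto).
  rewrite Rabs_mult, Rabs_inv, Rabs_mult.
  apply Rmult_lt_reg_r with (Rabs n1 * Rabs u); [apply Rmult_lt_0_compat; auto|].
  rewrite Rmult_assoc, Rinv_l, Rmult_1_r by (apply Rgt_not_eq, Rmult_lt_0_compat; auto).
  assert (0 < e * Rabs n1 * Rabs u) by (repeat apply Rmult_lt_0_compat; auto).
  lra. }
exists p. intros t Ht.
assert (Hcq : continuous q t).
{ apply (supergradient_continuous f q h t); auto. apply (is_derive_scal rho); auto. }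
assert (Habs : forall t, Rabs (q t) = Rabs (p t)).
{ intros t'. unfold q. rewrite Rabs_mult, Hsga. ring. }
split; [auto|]. split; [|split; [|split]].
- apply (continuous_ext (fun t => sg * q t)).
  + intros t'. unfold q. rewrite <- Rmult_assoc, Hsg2. apply Rmult_1_l.
  + apply (continuous_mult (fun _ => sg) q); [apply continuous_const|auto].
- rewrite <- Habs. auto.
- intros t' H1 H2. fold (q t) (q t').
  destruct (Req_dec t t') as [->|Hne]; [lra|].
  pose proof (Hq t t' Ht ltac:(lra)). pose proof (Hq t' t ltac:(lra) Ht). nra.
- destruct (Hp t Ht) as [n1 [n2 [[Hu _] [Hc [Hn1 Hpa]]]]].
  assert (Hn0 : n1 <> 0) by (intros ->; lra).
  (* The normal has length 1, so [1 + p t ^ 2] is [1 / n1 ^ 2]. *)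
  replace (sqrt (1 + p t ^ 2)) with (sg / n1).
  + rewrite Hpa. apply Rmult_eq_reg_r with n1; auto.
    replace ((X (rho t) t - T (rho t) t * (- n2 / n1)) * n1) with (X (rho t) t * n1 + T (rho t) t * n2) by (field; auto).
    replace (sg * (c * (sg / n1)) * n1) with (sg * sg * c) by (field; auto). rewrite Hsg2, Hc. ring.
  + symmetry. apply sqrt_lem_1.
    * nra.
    * left. apply Rmult_lt_reg_r with (n1 * n1); [nra|]. replace (sg / n1 * (n1 * n1)) with (sg * n1) by (field; auto). lra.
    * rewrite Hpa. replace (sg / n1 * (sg / n1)) with (sg * sg / (n1 * n1)) by (field; auto). rewrite Hsg2.
      transitivity ((n1 ^ 2 + n2 ^ 2) / (n1 * n1)); [rewrite Hu; reflexivity|]. field; auto.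
Qed.

Lemma differentiable_of_partials (f fx fy : R -> R -> R) (x y : R) :
  locally_2d (fun u v => is_derive (fun z => f z v) u (fx u v)) x y ->
  is_derive (fun z => f x z) y (fy x y) ->
  continuity_2d_pt fx x y ->
  differentiable_pt_lim f x y (fx x y) (fy x y).
Proof.
intros H1 H2 H3. apply filterdiff_differentiable_pt_lim.
apply (is_derive_filterdiff f x y fx (fy x y)).
- destruct H1 as [d Hd]. exists d. intros [u v] [Hu Hv]. apply Hd; assumption.
- exact H2.
- apply continuity_2d_pt_filterlim, H3.
Qed.

Definition normals_with_flux (S : R -> R -> Prop) (X T : R -> R -> R) (c : R) : Prop :=
  forall x t, cl S x t -> ~ S x t ->
    exists n1 n2, has_normal S x t n1 n2 /\ X x t * n1 + T x t * n2 = c.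

(** The slab gets the bound [2 * M] so that the slope bound [4 * M / (h - Rabs t)] of [graph_side]
    takes the form that [no_resonance] expects. *)
Lemma slab_of_body (S : R -> R -> Prop) (M h c : R) (X T : R -> R -> R) :
  sym_body S M -> sup_height S h -> normals_with_flux S X T c ->
  exists l r pl pr : R -> R, slab S h (2 * M) l r pl pr /\
  (forall t t', - h < t -> t <= t' -> t' < h -> pr t' <= pr t /\ pl t <= pl t') /\
  (forall t, - h < t < h -> Rabs (pl t) <= 2 * (2 * M) / (h - Rabs t) /\
     Rabs (pr t) <= 2 * (2 * M) / (h - Rabs t)) /\
  (forall t, - h < t < h -> X (r t) t - T (r t) t * pr t = c * sqrt (1 + pr t ^ 2)) /\
  (forall t, - h < t < h -> X (l t) t - T (l t) t * pl t = - (c * sqrt (1 + pl t ^ 2))).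
Proof.
intros HB Hh HN.
assert (HM : 0 <= M).
{ pose proof (sb_bound _ _ HB 0 0 (sym_body_origin _ _ HB)). lra. }
destruct (sym_body_slices S M h HB Hh) as [l [r Hlr]].
assert (Hcl : forall t x, - h < t < h -> l t <= x <= r t -> cl S x t).
{ intros t x Ht Hx e He. destruct (Hlr t Ht) as [Hlt [_ [_ Hs]]].
  pose proof (Rmin_l (e / 2) ((r t - l t) / 4)). pose proof (Rmin_r (e / 2) ((r t - l t) / 4)).
  assert (Hc : 0 < Rmin (e / 2) ((r t - l t) / 4)) by (apply Rmin_glb_lt; lra).
  set (d := Rmin (e / 2) ((r t - l t) / 4)) in *.
  destruct (Rle_or_lt x ((l t + r t) / 2)).
  - exists (x + d), t. rewrite Rminus_eq_0, Rabs_R0. split; [apply Hs; lra|split; auto].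
    apply Rabs_def1; lra.
  - exists (x - d), t. rewrite Rminus_eq_0, Rabs_R0. split; [apply Hs; lra|split; auto].
    apply Rabs_def1; lra. }
destruct (graph_side S h M c 1 r X T HM ltac:(auto)) as [pr Hpr].
{ intros t Ht. destruct (Hlr t Ht) as [Hlt [H1 [H2 Hs]]].
  assert (Hc := Hcl t (r t) Ht ltac:(lra)). assert (Hn : ~ S (r t) t) by (rewrite Hs; lra).
  repeat split; auto; try lra.
  exists ((l t + r t) / 2). split; [apply Hs|]; lra. }
destruct (graph_side S h M c (- 1) l X T HM ltac:(auto)) as [pl Hpl].
{ intros t Ht. destruct (Hlr t Ht) as [Hlt [H1 [H2 Hs]]].
  assert (Hc := Hcl t (l t) Ht ltac:(lra)). assert (Hn : ~ S (l t) t) by (rewrite Hs; lra).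
  repeat split; auto; try lra.
  exists ((l t + r t) / 2). split; [apply Hs|]; lra. }
exists l, r, pl, pr. split; [|split; [|split; [|split]]].
- constructor.
  + intros x t H. apply (sup_height_lt S M h x t); auto.
  + intros x t Ht. apply Hlr; auto.
  + intros t Ht. destruct (Hlr t Ht) as [A _]. exact A.
  + intros t Ht. destruct (Hlr t Ht) as [_ [H1 [H2 _]]]. lra.
  + apply (sb_open _ _ HB).
  + intros t Ht. destruct (Hpl t Ht) as [? [? _]]; auto.
  + intros t Ht. destruct (Hpr t Ht) as [? [? _]]; auto.
- intros t t' H1 H2 H3.
  destruct (Hpl t ltac:(lra)) as [_ [_ [_ [A _]]]]. destruct (Hpr t ltac:(lra)) as [_ [_ [_ [B _]]]].
  specialize (A t' H2 H3). specialize (B t' H2 H3). lra.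
- intros t Ht. replace (2 * (2 * M)) with (4 * M) by ring.
  destruct (Hpl t Ht) as [_ [_ [A _]]]. destruct (Hpr t Ht) as [_ [_ [B _]]]. auto.
- intros t Ht. destruct (Hpr t Ht) as [_ [_ [_ [_ A]]]]. lra.
- intros t Ht. destruct (Hpl t Ht) as [_ [_ [_ [_ A]]]]. lra.
Qed.

(** * The gradient on the boundary and the conclusions for a body *)

(** This is the derivative of [v (r t) t = 0] along the side. As [X] and [T] are derivatives only
    inside, the chain rule and the mean value theorem are applied on the shifted curve [r - c]. *)
Lemma side_tangential_zero (S : R -> R -> Prop) (h M alpha : R) (l r pl pr : R -> R)
  (v X T XX XT TT : R -> R -> R) (t : R) :
  slab S h M l r pl pr -> helmholtz S alpha v X T XX XT TT -> - h < t < h ->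
  X (r t) t * pr t + T (r t) t = 0.
Proof.
intros HS HZ Ht.
pose proof (slab_lt _ _ _ _ _ _ _ HS t Ht) as Hlt.
assert (Hc : cl S (r t) t) by (apply (slab_cl _ _ _ _ _ _ _ HS); auto; lra).
assert (Hopp : cwithin S (fun x t => - X x t) (r t) t).
{ intros e He. destruct (hz_X _ _ _ _ _ _ _ _ HZ _ _ Hc e He) as [d [Hd H]]. exists d; split; auto.
  intros x' t' A B C. specialize (H x' t' A B C).
  replace (- X x' t' - - X (r t) t) with (- (X x' t' - X (r t) t)) by ring. rewrite Rabs_Ropp; auto. }
set (L := X (r t) t * pr t + T (r t) t).
assert (HL : forall e, 0 < e -> Rabs L <= e).
{ intros e He.
  (* With the field [(T, - X)] the side term is the tangential derivative [T + X * pr]. *)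
  destruct (side_term_near S h r pr T (fun x t => - X x t) (- 1) t e Ht Hc ltac:(auto)) as [d [Hd H]]; auto.
  { intros e' He'. destruct (slab_near _ _ _ _ _ _ _ HS t e' Ht He') as [d [Hd H]].
    exists d; split; auto. intros b Hb. destruct (H b Hb) as [_ [_ [? [_ ?]]]]; auto. }
  { apply (hz_T _ _ _ _ _ _ _ _ HZ); auto. }
  destruct (slab_width_near _ _ _ _ _ _ _ HS t Ht) as [dw [w [Hdw [Hw Hwid]]]].
  set (s := Rmin d dw / 2).
  assert (Hs : 0 < s /\ s < d /\ s < dw).
  { unfold s. pose proof (Rmin_l d dw). pose proof (Rmin_r d dw).
    assert (0 < Rmin d dw) by (apply Rmin_glb_lt; auto). lra. }
  clearbody s.
  assert (Hmv : forall c, 0 < c < d -> c < w ->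
    Rabs (v (r (t + s) - c) (t + s) - v (r t - c) t - L * s) <= e * s).
  { intros c Hcd Hcw.
    assert (HSb : forall b, t <= b <= t + s -> - h < b < h /\ S (r b - c) b).
    { intros b Hb. destruct (Hwid b) as [W1 W2]; [apply Rabs_def1; lra|].
      split; auto. apply (slab_slice _ _ _ _ _ _ _ HS); auto; lra. }
    assert (HDer : forall b, t <= b <= t + s -> is_derive (fun b => v (r b - c) b) b
       (X (r b - c) b * pr b + T (r b - c) b)).
    { intros b Hb. destruct (HSb b Hb) as [Hbh HSb'].
      apply is_derive_Reals.
      replace (X (r b - c) b * pr b + T (r b - c) b) with (X (r b - c) b * pr b + T (r b - c) b * 1) by ring.
      apply (derivable_pt_lim_comp_2d v (fun b => r b - c) (fun b => b)).
      - apply (differentiable_of_partials v X T).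
        + destruct (slab_open _ _ _ _ _ _ _ HS _ _ HSb') as [d' Hd']. exists d'.
          intros x' t' A1 A2. apply (hz_vx _ _ _ _ _ _ _ _ HZ). apply Hd'; auto.
        + apply (hz_vt _ _ _ _ _ _ _ _ HZ); auto.
        + apply (hz_cont _ _ _ _ _ _ _ HS _ _ _ _ _ _ _ HZ); auto.
      - apply is_derive_Reals. rewrite <- (Rminus_0_r (pr b)).
        apply (is_derive_minus r (fun _ => c) b (pr b) 0); [|apply (is_derive_const c)].
        apply (slab_dr _ _ _ _ _ _ _ HS); auto.
      - apply derivable_pt_lim_id. }
    destruct (MVT_gen (fun b => v (r b - c) b) t (t + s) (fun b => X (r b - c) b * pr b + T (r b - c) b))
      as [b [Hb E]].
    - intros b. rewrite Rmin_left, Rmax_right by lra. intros Hb; apply HDer; lra.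
    - intros b. rewrite Rmin_left, Rmax_right by lra. intros Hb. apply continuity_pt_filterlim.
      apply (ex_derive_continuous (fun b => v (r b - c) b)). eexists; apply HDer; lra.
    - rewrite Rmin_left, Rmax_right in Hb by lra. rewrite E.
      replace (t + s - t) with s by ring.
      rewrite <- Rmult_minus_distr_r, Rabs_mult, (Rabs_pos_eq s) by lra.
      apply Rmult_le_compat_r; [lra|]. left.
      specialize (H b c ltac:(apply Rabs_def1; lra) Hcd).
      replace (r b + -1 * c) with (r b - c) in H by ring.
      destruct (HSb b Hb) as [_ HSb']. specialize (H (cl_of_mem _ _ _ HSb')).
      unfold L.
      replace (X (r b - c) b * pr b + T (r b - c) b - (X (r t) t * pr t + T (r t) t))
        with (T (r b - c) b - - X (r b - c) b * pr b - (T (r t) t - - X (r t) t * pr t)) by ring. auto. }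
  assert (Hlim : forall b, - h < b < h -> forall e2, 0 < e2 -> exists d2, 0 < d2 /\
    forall c, 0 < c < d2 -> c < r b - l b -> Rabs (v (r b - c) b) < e2).
  { intros b Hb e2 He2. pose proof (slab_lt _ _ _ _ _ _ _ HS b Hb).
    assert (Hcb : cl S (r b) b) by (apply (slab_cl _ _ _ _ _ _ _ HS); auto; lra).
    destruct (hz_v _ _ _ _ _ _ _ _ HZ _ _ Hcb e2 He2) as [d2 [Hd2 HH]].
    exists d2; split; auto. intros c Hc1 Hc2.
    destruct (slab_side_zero _ _ _ _ _ _ _ HS _ _ _ _ _ _ _ HZ b Hb) as [_ Vr].
    specialize (HH (r b - c) b). rewrite Vr, Rminus_0_r in HH. apply HH.
    - apply (slab_cl _ _ _ _ _ _ _ HS); auto; lra.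
    - apply Rabs_def1; lra.
    - rewrite Rminus_eq_0, Rabs_R0; auto. }
  assert (Hts : - h < t + s < h) by (apply Hwid; apply Rabs_def1; lra).
  apply Rmult_le_reg_r with s; [lra|].
  (* With [s] fixed, [c] tends to 0 and the values of [v] at both ends of the shifted arc
     disappear. *)
  apply le_epsilon. intros e2 He2.
  destruct (Hlim t Ht (e2 / 2) ltac:(lra)) as [d2 [Hd2 L2]].
  destruct (Hlim (t + s) Hts (e2 / 2) ltac:(lra)) as [d3 [Hd3 L3]].
  pose proof (slab_lt _ _ _ _ _ _ _ HS (t + s) Hts) as Hlt2.
  set (c := Rmin (Rmin d w) (Rmin (Rmin d2 d3) (Rmin (r t - l t) (r (t + s) - l (t + s)))) / 2).
  assert (Hcs : 0 < c /\ c < d /\ c < w /\ c < d2 /\ c < d3 /\ c < r t - l t /\ c < r (t + s) - l (t + s)).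
  { assert (Hz : 0 < 2 * c /\ 2 * c <= d /\ 2 * c <= w /\ 2 * c <= d2 /\ 2 * c <= d3 /\ 2 * c <= r t - l t
       /\ 2 * c <= r (t + s) - l (t + s)); [|lra].
    unfold c. replace (2 * (Rmin (Rmin d w) (Rmin (Rmin d2 d3) (Rmin (r t - l t) (r (t + s) - l (t + s)))) / 2))
     with (Rmin (Rmin d w) (Rmin (Rmin d2 d3) (Rmin (r t - l t) (r (t + s) - l (t + s))))) by field.
    split; [repeat apply Rmin_glb_lt; lra|].
    set (A := Rmin d w). set (B := Rmin d2 d3). set (C := Rmin (r t - l t) (r (t + s) - l (t + s))).
    pose proof (Rmin_l A (Rmin B C)). pose proof (Rmin_r A (Rmin B C)).
    pose proof (Rmin_l B C). pose proof (Rmin_r B C).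
    pose proof (Rmin_l d w). pose proof (Rmin_r d w). pose proof (Rmin_l d2 d3). pose proof (Rmin_r d2 d3).
    pose proof (Rmin_l (r t - l t) (r (t + s) - l (t + s))). pose proof (Rmin_r (r t - l t) (r (t + s) - l (t + s))).
    fold A in H4, H5. fold B in H6, H7. fold C in H8, H9. repeat split; lra. }
  clearbody c. destruct Hcs as [C0 [C1 [C2 [C3 [C4 [C5 C6]]]]]].
  specialize (Hmv c ltac:(lra) C2). specialize (L2 c ltac:(lra) C5). specialize (L3 c ltac:(lra) C6).
  rewrite <- (Rabs_pos_eq s) at 1 by lra. rewrite <- Rabs_mult.
  replace (L * s) with (- (v (r (t + s) - c) (t + s) - v (r t - c) t - L * s) + v (r (t + s) - c) (t + s) - v (r t - c) t) by ring.
  unfold Rminus at 1. eapply Rle_trans; [apply Rabs_triang|]. rewrite Rabs_Ropp.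
  eapply Rle_trans; [apply Rplus_le_compat_r, Rabs_triang|]. rewrite Rabs_Ropp. lra. }
destruct (Req_dec L 0) as [|Hn]; auto. exfalso.
assert (0 < Rabs L) by (apply Rabs_pos_lt; auto).
specialize (HL (Rabs L / 2) ltac:(lra)). lra.
Qed.

Lemma body_no_resonance (S : R -> R -> Prop) (M h alpha c k : R) (v X T XX XT TT : R -> R -> R) :
  sym_body S M -> sup_height S h -> helmholtz S alpha v X T XX XT TT -> normals_with_flux S X T c ->
  0 < h -> 0 < k -> alpha = k * k -> sin (k * h) = 1 -> c = 0.
Proof.
intros HB Hh HZ HN H0 Hk Ha Hs.
destruct (slab_of_body S M h c X T HB Hh HN) as [l [r [pl [pr [HS [H1 [H2 [H3 H4]]]]]]]].
apply (no_resonance _ _ _ _ _ _ _ HS _ _ _ _ _ _ _ HZ k c); auto.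
Qed.

(** The vanishing normal and tangential derivatives form an invertible linear system for the
    gradient at the right end of the slice at height 0. A rotation brings any boundary point to that
    position. *)
Lemma body_axis_gradient_zero (S : R -> R -> Prop) (M h alpha x : R) (v X T XX XT TT : R -> R -> R) :
  sym_body S M -> sup_height S h -> helmholtz S alpha v X T XX XT TT -> normals_with_flux S X T 0 ->
  0 < x -> cl S x 0 -> ~ S x 0 -> X x 0 = 0 /\ T x 0 = 0.
Proof.
intros HB Hh HZ HN Hx Hc Hn.
assert (HO := sym_body_origin _ _ HB).
assert (H0 := sup_height_lt _ _ _ _ _ HB Hh HO).
destruct (slab_of_body S M h 0 X T HB Hh HN) as [l [r [pl [pr [HS [_ [_ [H3 _]]]]]]]].
(* The supporting line at [(r 0, 0)] has the origin strictly on its inner side, so no closure point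
   of the positive axis lies beyond [r 0]. *)
assert (E : x = r 0).
{ assert (Hlr := proj1 (slab_slice _ _ _ _ _ _ _ HS 0 0 H0) HO).
  apply Rle_antisym.
  - assert (Hcr : cl S (r 0) 0) by (apply (slab_cl _ _ _ _ _ _ _ HS); lra).
    assert (Hnr : ~ S (r 0) 0) by (rewrite (slab_slice _ _ _ _ _ _ _ HS) by lra; lra).
    destruct (HN _ _ Hcr Hnr) as [n1 [n2 [Hnn _]]].
    pose proof (has_normal_cl _ _ _ _ _ _ _ Hnn Hc) as A.
    destruct Hnn as [_ [B _]]. specialize (B 0 0 HO). nra.
  - apply Rnot_lt_le. intros Hlt. apply Hn. apply (slab_slice _ _ _ _ _ _ _ HS); lra. }
rewrite E.
pose proof (side_tangential_zero _ _ _ _ _ _ _ _ _ _ _ _ _ _ 0 HS HZ H0) as A.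
specialize (H3 0 H0).
assert (B : T (r 0) 0 * (1 + pr 0 ^ 2) = 0) by nra.
apply Rmult_integral in B. destruct B as [B|B]; [|nra].
rewrite B in *. split; lra.
Qed.

Lemma body_zero (S : R -> R -> Prop) (M h alpha : R) (v X T XX XT TT : R -> R -> R) :
  sym_body S M -> sup_height S h -> helmholtz S alpha v X T XX XT TT -> normals_with_flux S X T 0 ->
  (forall x t, cl S x t -> ~ S x t -> X x t = 0 /\ T x t = 0) ->
  forall x t, S x t -> v x t = 0.
Proof.
intros HB Hh HZ HN Hg.
assert (HO := sym_body_origin _ _ HB).
assert (H0 := sup_height_lt _ _ _ _ _ HB Hh HO).
destruct (slab_of_body S M h 0 X T HB Hh HN) as [l [r [pl [pr [HS _]]]]].
apply (zero_of_gradient_zero _ _ _ _ _ _ _ HS _ _ _ _ _ _ _ HZ).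
apply (rellich_gradient_zero _ _ _ _ _ _ _ HS _ _ _ _ _ _ _ HZ); auto. lra.
Qed.

(** * Charts and rotated frames *)

Definition planar (Om : pt -> Prop) (x y : R) : Prop := Om (x, y).

Lemma dist2_le (p q : pt) : dist2 p q <= Rabs (fst p - fst q) + Rabs (snd p - snd q).
Proof.
unfold dist2. pose proof (Rabs_pos (fst p - fst q)). pose proof (Rabs_pos (snd p - snd q)).
rewrite <- (sqrt_pow2 (Rabs (fst p - fst q) + Rabs (snd p - snd q))) by lra.
apply sqrt_le_1_alt. rewrite <- (pow2_abs (fst p - fst q)), <- (pow2_abs (snd p - snd q)). nra.
Qed.

Lemma dist2_ge (p q : pt) : Rabs (fst p - fst q) <= dist2 p q /\ Rabs (snd p - snd q) <= dist2 p q.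
Proof.
unfold dist2. split.
- rewrite <- (sqrt_pow2 (Rabs (fst p - fst q))) by apply Rabs_pos.
  apply sqrt_le_1_alt. rewrite pow2_abs. pose proof (pow2_ge_0 (snd p - snd q)). lra.
- rewrite <- (sqrt_pow2 (Rabs (snd p - snd q))) by apply Rabs_pos.
  apply sqrt_le_1_alt. rewrite pow2_abs. pose proof (pow2_ge_0 (fst p - fst q)). lra.
Qed.

Lemma planar_open (Om : pt -> Prop) (x y : R) : open2 Om -> planar Om x y -> locally_2d (planar Om) x y.
Proof.
intros Ho H. destruct (Ho _ H) as [e [He Hn]].
assert (He2 : 0 < e / 2) by lra. exists (mkposreal _ He2). simpl. intros u v Hu Hv.
apply Hn. eapply Rle_lt_trans; [apply dist2_le|]. simpl. lra.
Qed.

Lemma cl_planar (Om : pt -> Prop) (x y : R) : cl (planar Om) x y <-> closure2 Om (x, y).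
Proof.
split.
- intros H e He. destruct (H (e / 2) ltac:(lra)) as [x' [y' [A [B C]]]].
  exists (x', y'); split; auto. eapply Rle_lt_trans; [apply dist2_le|]. simpl. lra.
- intros H e He. destruct (H e He) as [[x' y'] [A B]].
  destruct (dist2_ge (x', y') (x, y)) as [C D]. simpl in C, D.
  exists x', y'. repeat split; auto; lra.
Qed.

Lemma cwithin_planar (Om : pt -> Prop) (f : pt -> R) (x y : R) :
  cont_within (closure2 Om) f (x, y) -> cwithin (planar Om) (fun x y => f (x, y)) x y.
Proof.
intros H e He. destruct (H e He) as [d [Hd HH]]. exists (d / 2). split; [lra|].
intros x' y' A B C. apply HH; [apply cl_planar; auto|].
eapply Rle_lt_trans; [apply dist2_le|]. simpl. lra.
Qed.

Lemma continuity_2d_planar (f : pt -> R) (x y : R) :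
  cont_within (fun _ => True) f (x, y) -> continuity_2d_pt (fun x y => f (x, y)) x y.
Proof.
intros H e. destruct (H e (cond_pos e)) as [d [Hd HH]].
assert (Hd2 : 0 < d / 2) by lra. exists (mkposreal _ Hd2). simpl. intros u v A B. apply HH; auto.
eapply Rle_lt_trans; [apply dist2_le|]. simpl. lra.
Qed.

Lemma boundary2_planar (Om : pt -> Prop) (x y : R) :
  cl (planar Om) x y -> ~ planar Om x y -> boundary2 Om (x, y).
Proof.
intros H1 H2. split; [apply cl_planar; auto|].
intros e He. exists (x, y). split; auto.
unfold dist2; simpl. rewrite !Rminus_eq_0. replace (0 * (0 * 1) + 0 * (0 * 1)) with 0 by ring. rewrite sqrt_0. auto.
Qed.

(** The closure point is replaced by a nearby member [(u, w)], and the interior end is moved by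
    [- (1 - a) / a] times the displacement, which leaves the point at parameter [a] in place. *)
Lemma open_segment (S : R -> R -> Prop) (x y x' y' a : R) :
  (forall x t x' t' a, S x t -> S x' t' -> 0 <= a <= 1 -> S (x + a * (x' - x)) (t + a * (t' - t))) ->
  cl S x y -> S x' y' -> locally_2d S x' y' -> 0 < a <= 1 ->
  S (x + a * (x' - x)) (y + a * (y' - y)).
Proof.
intros Hc Hcl HS [d Hd] Ha.
destruct (Hcl (a * d)) as [u [w [A [B C]]]].
{ apply Rmult_lt_0_compat; [lra|apply cond_pos]. }
assert (Hq : forall q, Rabs q < a * d -> Rabs ((1 - a) * - q / a) < d).
{ intros q Hq'. unfold Rdiv. rewrite !Rabs_mult, Rabs_Ropp, Rabs_inv, (Rabs_pos_eq (1 - a)), (Rabs_pos_eq a) by lra.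
  apply Rmult_lt_reg_r with a; [lra|]. rewrite Rmult_assoc, Rinv_l, Rmult_1_r by lra.
  pose proof (Rabs_pos q). pose proof (cond_pos d). nra. }
replace (x + a * (x' - x)) with (u + a * ((x' + (1 - a) * - (u - x) / a) - u)) by (field; lra).
replace (y + a * (y' - y)) with (w + a * ((y' + (1 - a) * - (w - y) / a) - w)) by (field; lra).
apply Hc; auto; [|lra].
apply Hd; match goal with |- Rabs (?p + ?q - ?p) < _ => replace (p + q - p) with q by ring end; auto.
Qed.

(** A point beyond the tangent line would, by convexity, drag into [Om] a segment starting at [p],
    and close to [p] this segment lies below the graph of [g]. *)
Lemma chart_has_normal (Om : pt -> Prop) (p : pt) (th r : R) (g : R -> R) :
  open2 Om -> convex2 Om -> boundary2 Om p -> C1_chart Om p th r g ->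
  has_normal (planar Om) (fst p) (snd p) (fst (chart_normal th g)) (snd (chart_normal th g)).
Proof.
intros Ho Hcv Hb [Hr [Hg0 [Hgd [Hgc Hch]]]].
set (d := Derive g 0). set (s := sqrt (1 + d ^ 2)).
assert (Hs : 0 < s) by (apply sqrt_lt_R0; nra).
assert (Hss : s * s = 1 + d ^ 2) by (apply sqrt_sqrt; nra).
assert (Hct : sin th * sin th + cos th * cos th = 1) by apply sin2_cos2.
set (n1 := fst (chart_normal th g)). set (n2 := snd (chart_normal th g)).
assert (En1 : n1 = (d * cos th + sin th) / s) by reflexivity.
assert (En2 : n2 = (d * sin th - cos th) / s) by reflexivity.
destruct p as [x y]. simpl fst. simpl snd.
set (xi := fun x' y' => cos th * (x' - x) + sin th * (y' - y)).
set (eta := fun x' y' => - sin th * (x' - x) + cos th * (y' - y)).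
assert (Hch' : forall x' y', Rabs (xi x' y') < r -> Rabs (eta x' y') < r ->
  (planar Om x' y' <-> g (xi x' y') < eta x' y')).
{ intros x' y' A B. apply (Hch (x', y')); auto. }
assert (Hdot : forall x' y', n1 * (x' - x) + n2 * (y' - y) = (d * xi x' y' - eta x' y') / s).
{ intros x' y'. rewrite En1, En2. unfold xi, eta. field. lra. }
assert (Hsize : forall x' y', Rabs (xi x' y') <= Rabs (x' - x) + Rabs (y' - y) /\
   Rabs (eta x' y') <= Rabs (x' - x) + Rabs (y' - y)).
{ assert (Hc1 : Rabs (cos th) <= 1) by (apply Rabs_le, COS_bound).
  assert (Hs1 : Rabs (sin th) <= 1) by (apply Rabs_le, SIN_bound).
  intros x' y'. pose proof (Rabs_pos (x' - x)). pose proof (Rabs_pos (y' - y)).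
  split; (eapply Rle_trans; [apply Rabs_triang|]); rewrite !Rabs_mult, ?Rabs_Ropp; nra. }
assert (Hcl : cl (planar Om) x y) by (apply cl_planar, Hb).
assert (Hcx : forall x t x' t' a, planar Om x t -> planar Om x' t' -> 0 <= a <= 1 ->
  planar Om (x + a * (x' - x)) (t + a * (t' - t))).
{ intros x1 y1 x2 y2 a A B C. apply (Hcv (x1, y1) (x2, y2) a); auto. }
assert (Hdg : derivable_pt_lim g 0 d).
{ apply is_derive_Reals, Derive_correct, Hgd. lra. }
assert (Hdg' : forall e, 0 < e -> exists dd, 0 < dd /\ forall u, Rabs u < dd -> Rabs (g u - d * u) <= e * Rabs u).
{ intros e He. destruct (Hdg e He) as [dd Hdd]. exists dd. split; [apply cond_pos|].
  intros u Hu. destruct (Req_dec u 0) as [->|Hu0].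
  { rewrite Hg0, Rmult_0_r, Rminus_0_r, Rabs_R0. lra. }
  specialize (Hdd u Hu0 Hu). rewrite Rplus_0_l, Hg0, Rminus_0_r in Hdd.
  replace (g u - d * u) with ((g u / u - d) * u) by (field; auto).
  rewrite Rabs_mult. apply Rmult_le_compat_r; [apply Rabs_pos|lra]. }
assert (Hweak : forall x' y', planar Om x' y' -> n1 * (x' - x) + n2 * (y' - y) <= 0).
{ intros x' y' HO. rewrite Hdot. apply Rnot_lt_le. intros Hlt.
  assert (Hlt' : 0 < d * xi x' y' - eta x' y').
  { apply Rmult_lt_reg_r with (/ s); [apply Rinv_0_lt_compat; auto|]. unfold Rdiv in Hlt. lra. }
  set (k := d * xi x' y' - eta x' y') in *.
  set (B := Rabs (x' - x) + Rabs (y' - y) + 1).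
  assert (HB : 0 < B) by (unfold B; pose proof (Rabs_pos (x' - x)); pose proof (Rabs_pos (y' - y)); lra).
  destruct (Hsize x' y') as [S1 S2].
  destruct (Hdg' (k / B)) as [dd [Hdd HH]]; [apply Rdiv_lt_0_compat; auto|].
  (* [a] shrinks the vector into the chart and into the range where [g] is within [k / B] times the
     abscissa of its linear part. *)
  set (a := Rmin 1 (Rmin dd r / B)).
  assert (Ha : 0 < a <= 1).
  { split; [apply Rmin_glb_lt; [lra|apply Rdiv_lt_0_compat; auto; apply Rmin_glb_lt; auto]|apply Rmin_l]. }
  assert (HaB : a * B <= Rmin dd r).
  { apply Rle_trans with (Rmin dd r / B * B); [apply Rmult_le_compat_r; [lra|apply Rmin_r]|].
    right; field; lra. }
  pose proof (Rmin_l dd r). pose proof (Rmin_r dd r).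
  assert (HIn := open_segment (planar Om) x y x' y' a Hcx Hcl HO (planar_open _ _ _ Ho HO) Ha).
  assert (Ex : xi (x + a * (x' - x)) (y + a * (y' - y)) = a * xi x' y') by (unfold xi; ring).
  assert (Ee : eta (x + a * (x' - x)) (y + a * (y' - y)) = a * eta x' y') by (unfold eta; ring).
  assert (Hsm : forall q, Rabs q <= Rabs (x' - x) + Rabs (y' - y) -> Rabs (a * q) < Rmin dd r).
  { intros q Hq. rewrite Rabs_mult, (Rabs_pos_eq a) by lra.
    apply Rlt_le_trans with (a * B); auto. apply Rmult_lt_compat_l; unfold B; lra. }
  assert (Hx1 := Hsm _ S1). assert (Hx2 := Hsm _ S2).
  apply Hch' in HIn; [|rewrite Ex; lra|rewrite Ee; lra].
  rewrite Ex, Ee in HIn.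
  specialize (HH (a * xi x' y') ltac:(lra)).
  rewrite (Rabs_mult a), (Rabs_pos_eq a) in HH by lra.
  apply Rabs_le_between in HH.
  assert (HkB : k / B * (a * Rabs (xi x' y')) <= a * k).
  { replace (a * k) with (k / B * (a * B)) by (field; lra).
    apply Rmult_le_compat_l; [left; apply Rdiv_lt_0_compat; auto|].
    apply Rmult_le_compat_l; [lra|]. unfold B; lra. }
  unfold k in *. lra. }
assert (Hunit : n1 ^ 2 + n2 ^ 2 = 1).
{ rewrite En1, En2.
  replace (((d * cos th + sin th) / s) ^ 2 + ((d * sin th - cos th) / s) ^ 2)
   with ((1 + d ^ 2) * (sin th * sin th + cos th * cos th) / (s * s)) by (field; lra).
  rewrite Hct, Hss. field. nra. }
split; [exact Hunit|split].
(* Support becomes strict by openness: a small step along the normal stays in [Om] and would break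
   the weak inequality. *)
- intros x' y' HO. apply Rnot_le_lt. intros Hge.
  destruct (planar_open _ _ _ Ho HO) as [e He].
  assert (Hn : - 1 <= n1 <= 1 /\ - 1 <= n2 <= 1) by (repeat split; nra).
  pose proof (cond_pos e).
  assert (HO' : planar Om (x' + e / 2 * n1) (y' + e / 2 * n2)).
  { apply He; apply Rabs_def1; nra. }
  specialize (Hweak _ _ HO').
  replace (n1 * (x' + e / 2 * n1 - x) + n2 * (y' + e / 2 * n2 - y))
   with (n1 * (x' - x) + n2 * (y' - y) + e / 2 * (n1 ^ 2 + n2 ^ 2)) in Hweak by ring.
  rewrite Hunit in Hweak. lra.
- intros e He.
  destruct (Hdg' (e * s) ltac:(nra)) as [dd [Hdd HH]].
  exists (Rmin dd r / 2). split.
  { assert (0 < Rmin dd r) by (apply Rmin_glb_lt; auto). lra. }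
  intros x' y' C1 C2 C3 C4.
  pose proof (Rmin_l dd r). pose proof (Rmin_r dd r).
  destruct (Hsize x' y') as [S1 S2].
  (* Boundary points in the chart lie on the graph: above it they would be in [Om], and below it a
     whole neighbourhood would miss [Om]. *)
  assert (Eg : eta x' y' = g (xi x' y')).
  { destruct (Rtotal_order (g (xi x' y')) (eta x' y')) as [Hlt|[E|Hgt]]; auto; exfalso.
    - apply C2. apply Hch'; auto; lra.
    - set (G := fun u v => g (xi u v) - eta u v).
      assert (HG : continuity_2d_pt G x' y').
      { unfold G. apply continuity_2d_pt_minus.
        - apply (continuity_1d_2d_pt_comp g xi).
          + apply continuity_pt_filterlim, (ex_derive_continuous g), Hgd.
            assert (HX : Rabs (xi x' y') < r) by lra. apply Rabs_def2 in HX. lra.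
          + unfold xi. repeat first [apply continuity_2d_pt_plus | apply continuity_2d_pt_mult
              | apply continuity_2d_pt_opp | apply continuity_2d_pt_const | apply continuity_2d_pt_id1 | apply continuity_2d_pt_id2].
        - unfold eta. repeat first [apply continuity_2d_pt_plus | apply continuity_2d_pt_mult
              | apply continuity_2d_pt_opp | apply continuity_2d_pt_const | apply continuity_2d_pt_id1 | apply continuity_2d_pt_id2]. }
      assert (Hpos : 0 < G x' y') by (unfold G; lra).
      destruct (HG (mkposreal _ Hpos)) as [d1 Hd1]. simpl in Hd1.
      set (d2 := Rmin d1 ((Rmin dd r - (Rabs (x' - x) + Rabs (y' - y))) / 2)).
      assert (Hd2 : 0 < d2) by (apply Rmin_glb_lt; [apply cond_pos|lra]).
      pose proof (Rmin_l d1 ((Rmin dd r - (Rabs (x' - x) + Rabs (y' - y))) / 2)).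
      pose proof (Rmin_r d1 ((Rmin dd r - (Rabs (x' - x) + Rabs (y' - y))) / 2)).
      fold d2 in H1, H2.
      destruct (C1 d2 Hd2) as [u [w [A1 [A2 A3]]]].
      specialize (Hd1 u w ltac:(lra) ltac:(lra)).
      destruct (Hsize u w) as [S3 S4].
      assert (Rabs (u - x) <= Rabs (u - x') + Rabs (x' - x)).
      { replace (u - x) with ((u - x') + (x' - x)) by ring. apply Rabs_triang. }
      assert (Rabs (w - y) <= Rabs (w - y') + Rabs (y' - y)).
      { replace (w - y) with ((w - y') + (y' - y)) by ring. apply Rabs_triang. }
      apply Hch' in A1; try lra.
      apply Rabs_def2 in Hd1. unfold G in Hd1. lra. }
  rewrite Hdot, Eg. unfold Rdiv. rewrite Rabs_mult, Rabs_inv, (Rabs_pos_eq s) by lra.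
  apply Rmult_le_reg_r with s; auto. rewrite Rmult_assoc, Rinv_l, Rmult_1_r by lra.
  rewrite Rabs_minus_sym. eapply Rle_trans; [apply HH; lra|].
  replace (e * (Rabs (x' - x) + Rabs (y' - y)) * s) with (e * s * (Rabs (x' - x) + Rabs (y' - y))) by ring.
  apply Rmult_le_compat_l; nra.
Qed.

Lemma planar_helmholtz (Om : pt -> Prop) (alpha : R) (u G1 G2 : pt -> R) :
  open2 Om ->
  C2_on Om u ->
  (forall p, Om p -> laplacian u p + alpha * u p = 0) ->
  (forall p, Om p -> G1 p = px u p /\ G2 p = py u p) ->
  (forall p, closure2 Om p ->
     cont_within (closure2 Om) u p /\ cont_within (closure2 Om) G1 p /\
     cont_within (closure2 Om) G2 p) ->
  (forall p, boundary2 Om p -> u p = 0) ->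
  helmholtz (planar Om) alpha (fun x y => u (x, y)) (fun x y => G1 (x, y)) (fun x y => G2 (x, y))
    (fun x y => px (px u) (x, y)) (fun x y => py (px u) (x, y)) (fun x y => py (py u) (x, y)).
Proof.
intros Ho HC HL HG Hc Hb.
assert (Hloc : forall x y, planar Om x y -> exists d, 0 < d /\ forall x' y', Rabs (x' - x) < d -> Rabs (y' - y) < d -> planar Om x' y').
{ intros x y H. destruct (planar_open _ _ _ Ho H) as [d Hd]. exists d; split; auto. apply cond_pos. }
assert (Hz : forall z : R, Rabs (z - z) = 0) by (intros; rewrite Rminus_eq_0; apply Rabs_R0).
(* [G1] and [G2] agree with the partial derivatives only on [Om]; being open, it lets their
   derivatives be computed by local equality. *)
assert (HextX : forall (F G : pt -> R) x y l, (forall p, Om p -> F p = G p) -> planar Om x y ->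
  is_derive (fun x => G (x, y)) x l -> is_derive (fun x => F (x, y)) x l).
{ intros F G x y l E H. apply is_derive_ext_loc. destruct (Hloc x y H) as [d [Hd HH]].
  exists (mkposreal d Hd). intros x' Hx'. symmetry. apply E, HH; auto. rewrite Hz; auto. }
assert (HextY : forall (F G : pt -> R) x y l, (forall p, Om p -> F p = G p) -> planar Om x y ->
  is_derive (fun y => G (x, y)) y l -> is_derive (fun y => F (x, y)) y l).
{ intros F G x y l E H. apply is_derive_ext_loc. destruct (Hloc x y H) as [d [Hd HH]].
  exists (mkposreal d Hd). intros y' Hy'. symmetry. apply E, HH; auto. rewrite Hz; auto. }
(* [helmholtz] has a single mixed derivative [XT], so symmetry of second derivatives is needed. *)
assert (Hmix : forall x y, planar Om x y -> px (py u) (x, y) = py (px u) (x, y)).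
{ intros x y H.
  apply (Schwarz (fun x y => u (x, y)) x y).
  - destruct (planar_open _ _ _ Ho H) as [d Hd]. exists d. intros a b A B.
    destruct (HC (a, b) (Hd a b A B)) as [E1 [E2 [E3 [E4 [E5 [E6 _]]]]]].
    repeat split; [exact E1|exact E2|exact E5|exact E4].
  - destruct (HC (x, y) H) as [_ [_ [_ [_ [_ [_ [_ [_ [_ [_ [_ [E _]]]]]]]]]]]].
    apply (continuity_2d_planar (px (py u))). exact E.
  - destruct (HC (x, y) H) as [_ [_ [_ [_ [_ [_ [_ [_ [_ [_ [E _]]]]]]]]]]].
    apply (continuity_2d_planar (py (px u))). exact E. }
constructor.
- intros x y H. apply cwithin_planar, Hc, cl_planar; auto.
- intros x y H. apply cwithin_planar. apply (Hc (x, y)), cl_planar; auto.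
- intros x y H. apply cwithin_planar. apply (Hc (x, y)), cl_planar; auto.
- intros x y H1 H2. apply Hb, boundary2_planar; auto.
- intros x y H. rewrite (proj1 (HG (x, y) H)). apply (Derive_correct (fun x => u (x, y))).
  apply (HC (x, y) H).
- intros x y H. rewrite (proj2 (HG (x, y) H)). apply (Derive_correct (fun y => u (x, y))).
  apply (HC (x, y) H).
- intros x y H. apply (HextX G1 (px u)); [intros; apply HG; auto|auto|].
  apply (Derive_correct (fun x => px u (x, y))). apply (HC (x, y) H).
- intros x y H. apply (HextY G1 (px u)); [intros; apply HG; auto|auto|].
  apply (Derive_correct (fun y => px u (x, y))). apply (HC (x, y) H).
- intros x y H. rewrite <- Hmix by auto. apply (HextX G2 (py u)); [intros; apply HG; auto|auto|].
  apply (Derive_correct (fun x => py u (x, y))). apply (HC (x, y) H).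
- intros x y H. apply (HextY G2 (py u)); [intros; apply HG; auto|auto|].
  apply (Derive_correct (fun y => py u (x, y))). apply (HC (x, y) H).
- intros x y H. apply (continuity_2d_planar (px (px u))), (HC (x, y) H).
- intros x y H. apply (continuity_2d_planar (py (px u))), (HC (x, y) H).
- intros x y H. apply (continuity_2d_planar (py (py u))), (HC (x, y) H).
- intros x y H. apply (HL (x, y) H).
Qed.

(* Coordinates centred at [(o1, o2)] with axes [(b, - a)] and [(a, b)]; the height [t] is measured along [(a, b)]. *)
Definition frame {A : Type} (o1 o2 a b : R) (f : R -> R -> A) (x t : R) : A :=
  f (o1 + b * x + a * t) (o2 - a * x + b * t).

Section Frame.
Variables (o1 o2 a b : R).
Hypothesis Hab : a ^ 2 + b ^ 2 = 1.

Let Ha : Rabs a <= 1.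
Proof. apply Rabs_le; split; nra. Qed.
Let Hb : Rabs b <= 1.
Proof. apply Rabs_le; split; nra. Qed.

Lemma frame_close (x t x' t' d : R) : Rabs (x' - x) < d / 2 -> Rabs (t' - t) < d / 2 ->
  Rabs (o1 + b * x' + a * t' - (o1 + b * x + a * t)) < d /\
  Rabs (o2 - a * x' + b * t' - (o2 - a * x + b * t)) < d.
Proof.
intros H1 H2. pose proof (Rabs_pos (x' - x)). pose proof (Rabs_pos (t' - t)).
split.
- replace (o1 + b * x' + a * t' - (o1 + b * x + a * t)) with (b * (x' - x) + a * (t' - t)) by ring.
  eapply Rle_lt_trans; [apply Rabs_triang|]. rewrite !Rabs_mult. nra.
- replace (o2 - a * x' + b * t' - (o2 - a * x + b * t)) with (- (a * (x' - x)) + b * (t' - t)) by ring.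
  eapply Rle_lt_trans; [apply Rabs_triang|]. rewrite Rabs_Ropp, !Rabs_mult. nra.
Qed.

Lemma frame_onto (p q : R) : exists x t, p = o1 + b * x + a * t /\ q = o2 - a * x + b * t.
Proof.
exists (b * (p - o1) - a * (q - o2)), (a * (p - o1) + b * (q - o2)).
split.
- transitivity (o1 + (a ^ 2 + b ^ 2) * (p - o1)); [rewrite Hab|]; ring.
- transitivity (o2 + (a ^ 2 + b ^ 2) * (q - o2)); [rewrite Hab|]; ring.
Qed.

Lemma frame_inverse (x t p q : R) : p = o1 + b * x + a * t -> q = o2 - a * x + b * t ->
  x = b * (p - o1) - a * (q - o2) /\ t = a * (p - o1) + b * (q - o2).
Proof.
intros -> ->. split.
- transitivity ((a ^ 2 + b ^ 2) * x); [rewrite Hab|]; ring.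
- transitivity ((a ^ 2 + b ^ 2) * t); [rewrite Hab|]; ring.
Qed.

Lemma cl_frame (S : R -> R -> Prop) (x t : R) :
  cl (frame o1 o2 a b S) x t <-> cl S (o1 + b * x + a * t) (o2 - a * x + b * t).
Proof.
split; intros H e He.
- destruct (H (e / 2) ltac:(lra)) as [x' [t' [A [B C]]]].
  exists (o1 + b * x' + a * t'), (o2 - a * x' + b * t'). split; [exact A|]. apply frame_close; auto.
- destruct (H (e / 2) ltac:(lra)) as [p [q [A [B C]]]].
  destruct (frame_onto p q) as [x' [t' [E1 E2]]].
  destruct (frame_inverse x' t' p q E1 E2) as [E3 E4].
  destruct (frame_inverse x t _ _ eq_refl eq_refl) as [E5 E6].
  exists x', t'. unfold frame. rewrite <- E1, <- E2. split; auto.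
  set (p0 := o1 + b * x + a * t) in *. set (q0 := o2 - a * x + b * t) in *.
  pose proof (Rabs_pos (p - p0)). pose proof (Rabs_pos (q - q0)).
  split.
  + replace (x' - x) with (b * (p - p0) + - (a * (q - q0))) by lra.
    eapply Rle_lt_trans; [apply Rabs_triang|]. rewrite Rabs_Ropp, !Rabs_mult. nra.
  + replace (t' - t) with (a * (p - p0) + b * (q - q0)) by lra.
    eapply Rle_lt_trans; [apply Rabs_triang|]. rewrite !Rabs_mult. nra.
Qed.

Lemma cwithin_frame (S : R -> R -> Prop) (f : R -> R -> R) (x t : R) :
  cwithin S f (o1 + b * x + a * t) (o2 - a * x + b * t) ->
  cwithin (frame o1 o2 a b S) (frame o1 o2 a b f) x t.
Proof.
intros H e He. destruct (H e He) as [d [Hd HH]]. exists (d / 2). split; [lra|].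
intros x' t' A B C. destruct (frame_close x t x' t' d B C). apply HH; auto. apply cl_frame; auto.
Qed.

Lemma continuity_2d_frame (f : R -> R -> R) (x t : R) :
  continuity_2d_pt f (o1 + b * x + a * t) (o2 - a * x + b * t) ->
  continuity_2d_pt (frame o1 o2 a b f) x t.
Proof.
intros H e. destruct (H e) as [d HH].
assert (Hd : 0 < d / 2) by (pose proof (cond_pos d); lra).
exists (mkposreal _ Hd). simpl. intros x' t' B C.
destruct (frame_close x t x' t' d B C). apply HH; auto.
Qed.

Lemma is_derive_frame (f fx fy : R -> R -> R) (x t : R) :
  let p := o1 + b * x + a * t in let q := o2 - a * x + b * t in
  locally_2d (fun u v => is_derive (fun z => f z v) u (fx u v)) p q ->
  is_derive (fun z => f p z) q (fy p q) ->
  continuity_2d_pt fx p q ->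
  is_derive (fun x => frame o1 o2 a b f x t) x (b * fx p q - a * fy p q) /\
  is_derive (fun t => frame o1 o2 a b f x t) t (a * fx p q + b * fy p q).
Proof.
intros p q H1 H2 H3.
pose proof (differentiable_of_partials f fx fy p q H1 H2 H3) as HD.
split; apply is_derive_Reals.
- replace (b * fx p q - a * fy p q) with (fx p q * b + fy p q * - a) by ring.
  apply (derivable_pt_lim_comp_2d f (fun x => o1 + b * x + a * t) (fun x => o2 - a * x + b * t)); auto.
  + apply is_derive_Reals. auto_derive; auto. ring.
  + apply is_derive_Reals. auto_derive; auto. ring.
- replace (a * fx p q + b * fy p q) with (fx p q * a + fy p q * b) by ring.
  apply (derivable_pt_lim_comp_2d f (fun t => o1 + b * x + a * t) (fun t => o2 - a * x + b * t)); auto.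
  + apply is_derive_Reals. auto_derive; auto. ring.
  + apply is_derive_Reals. auto_derive; auto. ring.
Qed.

Lemma frame_open (S : R -> R -> Prop) (x t : R) :
  locally_2d S (o1 + b * x + a * t) (o2 - a * x + b * t) -> locally_2d (frame o1 o2 a b S) x t.
Proof.
intros [d H]. assert (Hd : 0 < d / 2) by (pose proof (cond_pos d); lra).
exists (mkposreal _ Hd). simpl. intros x' t' B C.
destruct (frame_close x t x' t' d B C). apply H; auto.
Qed.

Lemma has_normal_frame (S : R -> R -> Prop) (x t n1 n2 : R) :
  has_normal S (o1 + b * x + a * t) (o2 - a * x + b * t) n1 n2 ->
  has_normal (frame o1 o2 a b S) x t (n1 * b - n2 * a) (n1 * a + n2 * b).
Proof.
intros [H1 [H2 H3]].
assert (Hdot : forall x' t', (n1 * b - n2 * a) * (x' - x) + (n1 * a + n2 * b) * (t' - t)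
  = n1 * (o1 + b * x' + a * t' - (o1 + b * x + a * t)) + n2 * (o2 - a * x' + b * t' - (o2 - a * x + b * t))).
{ intros; ring. }
split; [|split].
- transitivity ((n1 ^ 2 + n2 ^ 2) * (a ^ 2 + b ^ 2)); [ring|]. rewrite H1, Hab. ring.
- intros x' t' H. rewrite Hdot. apply H2, H.
(* A rotation can at most double the sum of the absolute values of the coordinates, hence
   [e / 2]. *)
- intros e He. destruct (H3 (e / 2) ltac:(lra)) as [d [Hd HH]].
  exists (d / 2). split; [lra|]. intros x' t' A B C D. rewrite Hdot.
  destruct (frame_close x t x' t' d C D).
  eapply Rle_trans; [apply HH; auto|].
  + apply cl_frame; auto.
  + set (m := Rabs (x' - x) + Rabs (t' - t)).
    assert (E : forall z, m < z -> Rabs (o1 + b * x' + a * t' - (o1 + b * x + a * t))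
      + Rabs (o2 - a * x' + b * t' - (o2 - a * x + b * t)) <= 2 * m).
    { intros z _. unfold m. pose proof (Rabs_pos (x' - x)). pose proof (Rabs_pos (t' - t)).
      replace (o1 + b * x' + a * t' - (o1 + b * x + a * t)) with (b * (x' - x) + a * (t' - t)) by ring.
      replace (o2 - a * x' + b * t' - (o2 - a * x + b * t)) with (- (a * (x' - x)) + b * (t' - t)) by ring.
      pose proof (Rabs_triang (b * (x' - x)) (a * (t' - t))) as T1.
      pose proof (Rabs_triang (- (a * (x' - x))) (b * (t' - t))) as T2.
      rewrite Rabs_Ropp in T2. rewrite !Rabs_mult in T1, T2. nra. }
    specialize (E (m + 1) ltac:(lra)).
    replace (e * m) with (e / 2 * (2 * m)) by field.
    apply Rmult_le_compat_l; lra.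
Qed.

(** The Laplacian is invariant under rotation. The witnesses are the entries of the rotated
    Hessian. *)
Lemma helmholtz_frame (S : R -> R -> Prop) (alpha : R) (v X T XX XT TT : R -> R -> R) :
  (forall x t, S x t -> locally_2d S x t) ->
  helmholtz S alpha v X T XX XT TT ->
  exists XX' XT' TT', helmholtz (frame o1 o2 a b S) alpha (frame o1 o2 a b v)
    (frame o1 o2 a b (fun x t => b * X x t - a * T x t))
    (frame o1 o2 a b (fun x t => a * X x t + b * T x t)) XX' XT' TT'.
Proof.
intros Ho HZ.
exists (frame o1 o2 a b (fun x t => b * (b * XX x t - a * XT x t) - a * (b * XT x t - a * TT x t))),
  (frame o1 o2 a b (fun x t => b * (a * XX x t + b * XT x t) - a * (a * XT x t + b * TT x t))),
  (frame o1 o2 a b (fun x t => a * (a * XX x t + b * XT x t) + b * (a * XT x t + b * TT x t))).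
assert (Hlin : forall f g c d x t, cwithin S f x t -> cwithin S g x t ->
   cwithin S (fun x t => c * f x t + d * g x t) x t).
{ intros f g c d x t H1 H2. apply (cwithin_plus S (fun x t => c * f x t)).
  - apply (cwithin_mult S (fun _ _ => c)); auto. apply cwithin_of_continuity_2d_pt, continuity_2d_pt_const.
  - apply (cwithin_mult S (fun _ _ => d)); auto. apply cwithin_of_continuity_2d_pt, continuity_2d_pt_const. }
assert (Hcv : forall x t, S x t -> continuity_2d_pt X x t).
{ intros x t H. apply (cwithin_continuity_2d_pt S); auto. apply HZ, cl_of_mem; auto. }
assert (Dv : forall x t, frame o1 o2 a b S x t ->
  is_derive (fun x => frame o1 o2 a b v x t) x (frame o1 o2 a b (fun x t => b * X x t - a * T x t) x t) /\
  is_derive (fun t => frame o1 o2 a b v x t) t (frame o1 o2 a b (fun x t => a * X x t + b * T x t) x t)).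
{ intros x t H. apply (is_derive_frame v X T x t).
  - destruct (Ho _ _ H) as [d Hd]. exists d. intros u w A B. apply (hz_vx _ _ _ _ _ _ _ _ HZ), Hd; auto.
  - apply (hz_vt _ _ _ _ _ _ _ _ HZ), H.
  - apply Hcv, H. }
assert (DX : forall x t, frame o1 o2 a b S x t ->
  is_derive (fun x => frame o1 o2 a b X x t) x (frame o1 o2 a b (fun x t => b * XX x t - a * XT x t) x t) /\
  is_derive (fun t => frame o1 o2 a b X x t) t (frame o1 o2 a b (fun x t => a * XX x t + b * XT x t) x t)).
{ intros x t H. apply (is_derive_frame X XX XT x t).
  - destruct (Ho _ _ H) as [d Hd]. exists d. intros u w A B. apply (hz_Xx _ _ _ _ _ _ _ _ HZ), Hd; auto.
  - apply (hz_Xt _ _ _ _ _ _ _ _ HZ), H.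
  - apply (hz_XXc _ _ _ _ _ _ _ _ HZ), H. }
assert (DT : forall x t, frame o1 o2 a b S x t ->
  is_derive (fun x => frame o1 o2 a b T x t) x (frame o1 o2 a b (fun x t => b * XT x t - a * TT x t) x t) /\
  is_derive (fun t => frame o1 o2 a b T x t) t (frame o1 o2 a b (fun x t => a * XT x t + b * TT x t) x t)).
{ intros x t H. apply (is_derive_frame T XT TT x t).
  - destruct (Ho _ _ H) as [d Hd]. exists d. intros u w A B. apply (hz_Tx _ _ _ _ _ _ _ _ HZ), Hd; auto.
  - apply (hz_Tt _ _ _ _ _ _ _ _ HZ), H.
  - apply (hz_XTc _ _ _ _ _ _ _ _ HZ), H. }
assert (Lin : forall (f g : R -> R) (c d z lf lg : R), is_derive f z lf -> is_derive g z lg ->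
  is_derive (fun z => c * f z + d * g z) z (c * lf + d * lg)).
{ intros f g c d z lf lg H1 H2. apply (is_derive_plus (fun z => c * f z) (fun z => d * g z));
  apply is_derive_scal; auto. }
assert (LinM : forall (f g : R -> R) (c d z lf lg : R), is_derive f z lf -> is_derive g z lg ->
  is_derive (fun z => c * f z - d * g z) z (c * lf - d * lg)).
{ intros f g c d z lf lg H1 H2. apply (is_derive_minus (fun z => c * f z) (fun z => d * g z));
  apply is_derive_scal; auto. }
assert (HC : forall x t, S x t -> continuity_2d_pt XX x t /\ continuity_2d_pt XT x t /\ continuity_2d_pt TT x t).
{ intros x t H. destruct HZ. auto. }
assert (HCf : forall c1 c2 c3 c4 c5 c6 x t, S x t ->
  continuity_2d_pt (fun x t => c1 * (c2 * XX x t + c3 * XT x t) + c4 * (c5 * XT x t + c6 * TT x t)) x t).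
{ intros c1 c2 c3 c4 c5 c6 x t H. destruct (HC x t H) as [? [? ?]].
  repeat first [apply continuity_2d_pt_plus | apply continuity_2d_pt_mult | apply continuity_2d_pt_const | assumption]. }
constructor.
- intros x t H. apply cwithin_frame, HZ, cl_frame; auto.
- intros x t H. apply cwithin_frame. apply cl_frame in H.
  intros e He. destruct (Hlin X T b (- a) _ _ (hz_X _ _ _ _ _ _ _ _ HZ _ _ H) (hz_T _ _ _ _ _ _ _ _ HZ _ _ H) e He) as [d [Hd HH]].
  exists d; split; auto. intros x' t' A B C. specialize (HH x' t' A B C). cbv beta in HH.
  eapply Rle_lt_trans; [|exact HH]. right. f_equal. ring.
- intros x t H. apply cwithin_frame. apply cl_frame in H.
  apply Hlin; apply HZ; auto.
- intros x t H1 H2. apply (hz_bd _ _ _ _ _ _ _ _ HZ); auto. apply cl_frame; auto.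
- intros x t H. apply Dv; auto.
- intros x t H. apply Dv; auto.
- intros x t H. apply LinM; [apply DX|apply DT]; auto.
- intros x t H. apply LinM; [apply DX|apply DT]; auto.
- intros x t H.
  replace (frame o1 o2 a b (fun x t => b * (a * XX x t + b * XT x t) - a * (a * XT x t + b * TT x t)) x t)
   with (a * frame o1 o2 a b (fun x t => b * XX x t - a * XT x t) x t
     + b * frame o1 o2 a b (fun x t => b * XT x t - a * TT x t) x t) by (unfold frame; ring).
  apply Lin; [apply DX|apply DT]; auto.
- intros x t H. apply Lin; [apply DX|apply DT]; auto.
- intros x t H. apply continuity_2d_frame.
  apply (continuity_2d_pt_ext (fun x t => b * (b * XX x t + - a * XT x t) + - a * (b * XT x t + - a * TT x t))).
  + intros; ring.
  + apply HCf, H.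
- intros x t H. apply continuity_2d_frame.
  apply (continuity_2d_pt_ext (fun x t => b * (a * XX x t + b * XT x t) + - a * (a * XT x t + b * TT x t))).
  + intros; ring.
  + apply HCf, H.
- intros x t H. apply continuity_2d_frame. apply HCf, H.
- intros x t H. unfold frame.
  transitivity ((a ^ 2 + b ^ 2) * (XX (o1 + b * x + a * t) (o2 - a * x + b * t) + TT (o1 + b * x + a * t) (o2 - a * x + b * t))
   + alpha * v (o1 + b * x + a * t) (o2 - a * x + b * t)); [ring|].
  rewrite Hab, Rmult_1_l. apply (hz_eq _ _ _ _ _ _ _ _ HZ), H.
Qed.

Lemma normals_with_flux_frame (S : R -> R -> Prop) (X T : R -> R -> R) (c : R) :
  normals_with_flux S X T c ->
  normals_with_flux (frame o1 o2 a b S) (frame o1 o2 a b (fun x t => b * X x t - a * T x t))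
    (frame o1 o2 a b (fun x t => a * X x t + b * T x t)) c.
Proof.
intros H x t H1 H2. apply cl_frame in H1. destruct (H _ _ H1 H2) as [n1 [n2 [A B]]].
exists (n1 * b - n2 * a), (n1 * a + n2 * b). split; [apply has_normal_frame; auto|].
unfold frame.
set (X0 := X (o1 + b * x + a * t) (o2 - a * x + b * t)) in *.
set (T0 := T (o1 + b * x + a * t) (o2 - a * x + b * t)) in *.
transitivity ((a ^ 2 + b ^ 2) * (X0 * n1 + T0 * n2)); [ring|]. rewrite Hab, B. ring.
Qed.

Lemma sym_body_frame (Om : pt -> Prop) (M : R) :
  (exists p, Om p) -> open2 Om -> convex2 Om ->
  (forall p, Om p -> dist2 p (0, 0) <= M) ->
  (forall x, Om x <-> Om (2 * o1 - fst x, 2 * o2 - snd x)) ->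
  sym_body (frame o1 o2 a b (planar Om)) (2 * M + Rabs o1 + Rabs o2).
Proof.
intros [[p q] Hne] Ho Hc HM Hs.
constructor.
- destruct (frame_onto p q) as [x [t [E1 E2]]]. exists x, t. unfold frame. rewrite <- E1, <- E2. exact Hne.
- intros x t H. apply frame_open, planar_open; auto.
- intros x t x' t' l H1 H2 Hl. unfold frame, planar in *.
  assert (H := Hc _ _ l H1 H2 Hl). simpl in H.
  match type of H with Om (?u, ?v) => match goal with |- Om (?u', ?v') =>
    replace u' with u by ring; replace v' with v by ring end end. exact H.
- intros x t H. unfold frame, planar in *. apply Hs in H. simpl in H.
  match type of H with Om (?u, ?v) => match goal with |- Om (?u', ?v') =>
    replace u' with u by ring; replace v' with v by ring end end. exact H.
- intros x t H. specialize (HM _ H).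
  destruct (dist2_ge (o1 + b * x + a * t, o2 - a * x + b * t) (0, 0)) as [D1 D2]. simpl in D1, D2.
  destruct (frame_inverse x t _ _ eq_refl eq_refl) as [E _].
  rewrite Rminus_0_r in D1, D2.
  set (p0 := o1 + b * x + a * t) in *. set (q0 := o2 - a * x + b * t) in *.
  assert (Hx : Rabs x <= Rabs (p0 - o1) + Rabs (q0 - o2)).
  { rewrite E. eapply Rle_trans; [apply Rabs_triang|]. rewrite Rabs_Ropp, !Rabs_mult.
    pose proof (Rabs_pos (p0 - o1)). pose proof (Rabs_pos (q0 - o2)). nra. }
  pose proof (Rabs_triang p0 (- o1)) as T1. pose proof (Rabs_triang q0 (- o2)) as T2.
  rewrite Rabs_Ropp in T1, T2. unfold Rminus in Hx.
  apply Rabs_le_between. lra.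
Qed.

End Frame.

(** * The height as a function of the direction *)

Lemma polar_angle (a b : R) : a ^ 2 + b ^ 2 = 1 -> exists th, cos th = a /\ sin th = b.
Proof.
intros H.
assert (Ha : - 1 <= a <= 1) by (split; nra).
assert (E : 1 - a² = b ^ 2) by (unfold Rsqr; lra).
destruct (Rle_or_lt 0 b) as [Hb|Hb].
- exists (acos a). rewrite cos_acos, sin_acos by auto. split; auto.
  rewrite E. apply sqrt_pow2; auto.
- exists (- acos a). rewrite cos_neg, sin_neg, cos_acos, sin_acos by auto. split; auto.
  rewrite E. replace (b ^ 2) with ((- b) ^ 2) by ring. rewrite sqrt_pow2 by lra. ring.
Qed.

Lemma cos_sin_lipschitz (s t : R) : Rabs (cos t - cos s) <= Rabs (t - s) /\ Rabs (sin t - sin s) <= Rabs (t - s).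
Proof.
split.
- destruct (MVT_gen cos s t (fun x => - sin x)) as [c [_ E]].
  + intros x _. auto_derive; auto. ring.
  + intros x _. apply continuity_pt_filterlim, (ex_derive_continuous cos). auto_derive; auto.
  + rewrite E, Rabs_mult, Rabs_Ropp. pose proof (Rabs_pos (t - s)).
    assert (Rabs (sin c) <= 1) by (apply Rabs_le, SIN_bound). nra.
- destruct (MVT_gen sin s t cos) as [c [_ E]].
  + intros x _. auto_derive; auto. ring.
  + intros x _. apply continuity_pt_filterlim, (ex_derive_continuous sin). auto_derive; auto.
  + rewrite E, Rabs_mult. pose proof (Rabs_pos (t - s)).
    assert (Rabs (cos c) <= 1) by (apply Rabs_le, COS_bound). nra.
Qed.

Lemma cos_sin_unit (th : R) : cos th ^ 2 + sin th ^ 2 = 1.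
Proof. pose proof (sin2_cos2 th) as H. unfold Rsqr in H. lra. Qed.

(** The frame is turned so that the given point lies on its positive horizontal axis, at height
    0. *)
Lemma polar_frame (o1 o2 p q : R) : (p, q) <> (o1, o2) ->
  exists a b rho, a ^ 2 + b ^ 2 = 1 /\ 0 < rho /\ rho = dist2 (p, q) (o1, o2) /\
    p = o1 + b * rho + a * 0 /\ q = o2 - a * rho + b * 0.
Proof.
intros Hpq. set (rho := dist2 (p, q) (o1, o2)).
assert (Hsq : 0 < (p - o1) ^ 2 + (q - o2) ^ 2).
{ destruct (Req_dec p o1) as [->|H1].
  - destruct (Req_dec q o2) as [->|H2]; [tauto|].
    pose proof (pow2_gt_0 (q - o2) ltac:(lra)). pose proof (pow2_ge_0 (o1 - o1)). lra.
  - pose proof (pow2_gt_0 (p - o1) ltac:(lra)). pose proof (pow2_ge_0 (q - o2)). lra. }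
assert (Hr : 0 < rho) by (apply sqrt_lt_R0; exact Hsq).
assert (Hrr : rho * rho = (p - o1) ^ 2 + (q - o2) ^ 2) by (apply sqrt_sqrt; simpl; lra).
exists (- (q - o2) / rho), ((p - o1) / rho), rho.
split; [|split; [|split; [|split]]]; auto; try (field; lra).
replace ((- (q - o2) / rho) ^ 2 + ((p - o1) / rho) ^ 2)
  with (((p - o1) ^ 2 + (q - o2) ^ 2) / (rho * rho)) by (field; lra).
rewrite Hrr. field. lra.
Qed.

Section Domain.
Variables (Om : pt -> Prop) (o1 o2 M : R).
Hypotheses (Hne : exists p, Om p) (Ho : open2 Om) (Hc : convex2 Om)
  (HM : forall p, Om p -> dist2 p (0, 0) <= M)
  (Hs : forall x, Om x <-> Om (2 * o1 - fst x, 2 * o2 - snd x)).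

Let fr (a b : R) : R -> R -> Prop := frame o1 o2 a b (planar Om).
Let K : R := 2 * M + Rabs o1 + Rabs o2.

Lemma frame_sym_body (a b : R) : a ^ 2 + b ^ 2 = 1 -> sym_body (fr a b) K.
Proof. intros H. apply sym_body_frame; auto. Qed.

Lemma sup_height_exists (a b : R) : a ^ 2 + b ^ 2 = 1 -> exists h, sup_height (fr a b) h.
Proof.
intros Hab.
(* [sym_body] bounds abscissae only; the heights of the frame [(a, b)] are the abscissae of the
   frame [(- b, a)]. *)
assert (HB := frame_sym_body a b Hab). assert (HB' := frame_sym_body (- b) a ltac:(nra)).
destruct (completeness (fun t => exists x, fr a b x t)) as [h [H1 H2]].
- exists K. intros t [x H]. apply (sb_bound _ _ HB' t (- x)).
  unfold fr, frame in *.
  replace (o1 + a * t + - b * - x) with (o1 + b * x + a * t) by ring.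
  replace (o2 - - b * t + a * - x) with (o2 - a * x + b * t) by ring. exact H.
- exists 0, 0. apply (sym_body_origin _ _ HB).
- exists h. split.
  + intros x t H. apply H1. exists x; auto.
  + intros s Hlt. apply NNPP. intros Hn. assert (h <= s); [|lra].
    apply H2. intros t [x H]. apply Rnot_lt_le. intros Hlt'. apply Hn. exists x, t; auto.
Qed.

(** A nearly highest point for [th] competes for [th']. Its height changes by its offset from the
    centre times the change of the unit vector, which is Lipschitz in the angle. *)
Lemma sup_height_lipschitz (th th' h h' : R) :
  sup_height (fr (cos th) (sin th)) h -> sup_height (fr (cos th') (sin th')) h' ->
  h <= h' + K * Rabs (th - th').
Proof.
intros [_ H1] [H2 _]. apply Rnot_lt_le. intros Hlt.
destruct (H1 _ Hlt) as [x [t [A B]]].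
unfold fr, frame in A.
destruct (frame_inverse o1 o2 _ _ (cos_sin_unit th) x t _ _ eq_refl eq_refl) as [_ Et].
set (p := o1 + sin th * x + cos th * t) in *. set (q := o2 - cos th * x + sin th * t) in *.
destruct (frame_onto o1 o2 _ _ (cos_sin_unit th') p q) as [x' [t' [E1 E2]]].
destruct (frame_inverse o1 o2 _ _ (cos_sin_unit th') x' t' _ _ E1 E2) as [_ Et'].
assert (Ht' : t' <= h').
{ apply (H2 x' t'). unfold fr, frame. rewrite <- E1, <- E2. exact A. }
assert (Hpq := HM _ A). destruct (dist2_ge (p, q) (0, 0)) as [D1 D2]. simpl in D1, D2.
rewrite Rminus_0_r in D1, D2.
destruct (cos_sin_lipschitz th' th) as [L1 L2].
pose proof (Rabs_triang p (- o1)) as T1. pose proof (Rabs_triang q (- o2)) as T2.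
rewrite Rabs_Ropp in T1, T2.
assert (E : t - t' <= K * Rabs (th - th')).
{ replace (t - t') with ((cos th - cos th') * (p + - o1) + (sin th - sin th') * (q + - o2)) by lra.
  eapply Rle_trans; [apply Rle_abs|]. eapply Rle_trans; [apply Rabs_triang|]. rewrite !Rabs_mult.
  replace (K * Rabs (th - th')) with (Rabs (th - th') * (M + Rabs o1) + Rabs (th - th') * (M + Rabs o2))
    by (unfold K; ring).
  apply Rplus_le_compat; apply Rmult_le_compat; auto using Rabs_pos; lra. }
lra.
Qed.

(** The distance of a point of [Om] from the centre is its height in its own direction, hence less
    than [h]. Conversely, where a ray leaves [Om] the supporting line is at distance [h] from the
    centre, so the exit point is no closer than that. *)
Lemma disk_of_constant_height (h : R) :
  (forall x y, cl (planar Om) x y -> ~ planar Om x y -> exists n1 n2, has_normal (planar Om) x y n1 n2) ->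
  (forall a b, a ^ 2 + b ^ 2 = 1 -> sup_height (fr a b) h) -> is_disk Om.
Proof.
intros HN Hh.
assert (H01 : 0 ^ 2 + 1 ^ 2 = 1) by ring.
assert (HO := sym_body_origin _ _ (frame_sym_body 0 1 H01)).
assert (Hh0 := sup_height_lt _ _ _ _ _ (frame_sym_body 0 1 H01) (Hh 0 1 H01) HO).
assert (HO' : Om (o1, o2)).
{ unfold fr, frame, planar in HO. replace (o1, o2) with (o1 + 1 * 0 + 0 * 0, o2 - 0 * 0 + 1 * 0); auto.
  f_equal; ring. }
exists (o1, o2), h. split; [lra|]. intros [p q].
destruct (classic ((p, q) = (o1, o2))) as [E|Hpq].
{ rewrite E. split; auto. intros _. unfold dist2; simpl. rewrite !Rminus_eq_0.
  replace (0 * (0 * 1) + 0 * (0 * 1)) with 0 by ring. rewrite sqrt_0. lra. }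
destruct (polar_frame o1 o2 p q Hpq) as [a [b [rho [Hab [Hr [Er [Ep Eq]]]]]]].
rewrite <- Er.
assert (HB := frame_sym_body a b Hab).
assert (HS : Om (p, q) <-> fr a b rho 0).
{ unfold fr, frame, planar. rewrite <- Ep, <- Eq. tauto. }
split; intros H.
(* [(b, - a)] is the direction of [(p, q)] from the centre, and the height along it is [rho]. *)
- assert (Hab' : b ^ 2 + (- a) ^ 2 = 1) by nra.
  apply (sup_height_lt (fr b (- a)) K h 0 rho); auto using frame_sym_body.
  unfold fr, frame, planar.
  replace (o1 + - a * 0 + b * rho) with p by lra. replace (o2 - b * 0 + - a * rho) with q by lra. exact H.
- apply NNPP. intros Hn. rewrite HS in Hn.
  destruct (sym_body_slices _ _ _ HB (Hh a b Hab)) as [l [r Hlr]].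
  destruct (Hlr 0 Hh0) as [Hlt [_ [_ Hx]]].
  assert (HSO := proj1 (Hx 0) (sym_body_origin _ _ HB)).
  assert (Hrr : r 0 <= rho).
  { apply Rnot_lt_le. intros Hlt'. apply Hn, Hx. lra. }
  assert (Hcl : cl (fr a b) (r 0) 0).
  { intros e He. set (d := Rmin (e / 2) (r 0 / 2)).
    assert (0 < d) by (apply Rmin_glb_lt; lra).
    pose proof (Rmin_l (e / 2) (r 0 / 2)). pose proof (Rmin_r (e / 2) (r 0 / 2)). fold d in H1, H2.
    exists (r 0 - d), 0. rewrite Rminus_eq_0, Rabs_R0. split; [apply Hx; lra|split; auto].
    apply Rabs_def1; lra. }
  assert (Hnc : ~ fr a b (r 0) 0) by (rewrite Hx; lra).
  apply (cl_frame o1 o2 a b Hab) in Hcl.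
  (* The height in the direction of the normal at the exit point is at most [r 0] times a cosine,
     hence at most [rho], while it should be [h > rho]. *)
  destruct (HN _ _ Hcl Hnc) as [n1 [n2 [Hu [Hn' _]]]].
  destruct (Hh n1 n2 Hu) as [_ Hsup].
  destruct (Hsup rho H) as [x [t [A B]]].
  unfold fr, frame in A. specialize (Hn' _ _ A).
  assert (Hab1 : r 0 * (n1 * b - n2 * a) <= r 0 * 1).
  { apply Rmult_le_compat_l; [lra|]. pose proof (pow2_ge_0 (n1 - b)). pose proof (pow2_ge_0 (n2 + a)). lra. }
  assert (E : t = n1 * (o1 + n2 * x + n1 * t - (o1 + b * r 0 + a * 0)) + n2 * (o2 - n1 * x + n2 * t - (o2 - a * r 0 + b * 0))
     + r 0 * (n1 * b - n2 * a)).
  { transitivity ((n1 ^ 2 + n2 ^ 2) * t); [rewrite Hu; ring|ring]. }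
  lra.
Qed.

End Domain.

Theorem theorem1p1 (Om : pt -> Prop) :
  (exists p, Om p) -> open2 Om -> bounded2 Om -> convex2 Om ->
  centrally_symmetric Om -> connected2 (boundary2 Om) ->
  (exists eps, 0 < eps < 1 /\ boundary_C2eps Om eps) ->
  exists astar, 0 < astar /\
    forall (alpha c : R) (u : pt -> R),
      astar < alpha ->
      overdetermined_solution Om alpha c u ->
      (exists p, Om p /\ u p <> 0) ->
      is_disk Om.
Proof.
intros Hne Ho [M HM] Hc [[o1 o2] Hs] _ [eps [_ Hbd]]. simpl in Hs.
set (Sf := fun th => frame o1 o2 (cos th) (sin th) (planar Om)).
assert (Hex : forall th, exists h, sup_height (Sf th) h).
{ intros th. apply (sup_height_exists Om o1 o2 M Hne Ho Hc HM Hs _ _ (cos_sin_unit th)). }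
set (hf := fun th => proj1_sig (constructive_indefinite_description _ (Hex th))).
assert (Hhf : forall th, sup_height (Sf th) (hf th)).
{ intros th. apply (proj2_sig (constructive_indefinite_description _ (Hex th))). }
clearbody hf.
assert (HB : forall a b, a ^ 2 + b ^ 2 = 1 -> sym_body (frame o1 o2 a b (planar Om)) (2 * M + Rabs o1 + Rabs o2)).
{ intros a b Hab. apply sym_body_frame; auto. }
destruct (classic (exists th1 th2, hf th1 < hf th2)) as [[th1 [th2 Hlt]]|Hconst].
(* For constant height the domain is a disk whatever [alpha] is, so any positive threshold
   serves. *)
2:{ exists 1. split; [lra|]. intros _ _ _ _ _ _.
  apply (disk_of_constant_height Om o1 o2 M Hne Ho Hc HM Hs (hf 0)).
  - intros x y H1 H2. pose proof (boundary2_planar Om x y H1 H2) as Hb.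
    destruct (Hbd _ Hb) as [th [r [g [Hch _]]]].
    exists (fst (chart_normal th g)), (snd (chart_normal th g)).
    apply (chart_has_normal Om (x, y) th r g); auto.
  - intros a b Hab. destruct (polar_angle a b Hab) as [th [<- <-]].
    replace (hf 0) with (hf th); [apply Hhf|].
    destruct (Rtotal_order (hf th) (hf 0)) as [|[|]]; auto; exfalso; apply Hconst; eauto. }
set (D := hf th2 - hf th1). assert (HD : 0 < D) by (unfold D; lra).
pose proof PI_RGT_0 as Hpi.
(* Above this threshold [k * D > 2 * PI]: the values of [k * hf] fill more than a full period and
   must meet PI / 2 modulo 2 PI. *)
exists ((2 * PI / D) * (2 * PI / D)). split.
{ assert (0 < 2 * PI / D) by (apply Rdiv_lt_0_compat; lra). nra. }
(* For nonconstant height, no nontrivial solution exists above the threshold, whence the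
   contradiction. *)
intros alpha c u Hal [G1 [G2 [HC2 [HL [HG [Hcw [Hu0 Hnu]]]]]]] [[up uq] [Hup Hune]]. exfalso.
assert (HZ := planar_helmholtz Om alpha u G1 G2 Ho HC2 HL HG Hcw Hu0).
assert (HN : normals_with_flux (planar Om) (fun x y => G1 (x, y)) (fun x y => G2 (x, y)) c).
{ intros x y H1 H2. pose proof (boundary2_planar Om x y H1 H2) as Hb.
  destruct (Hbd _ Hb) as [th [r [g [Hch _]]]].
  exists (fst (chart_normal th g)), (snd (chart_normal th g)). split.
  - apply (chart_has_normal Om (x, y) th r g); auto.
  - apply (Hnu (x, y) th r g); auto. }
assert (Hop : forall x y, planar Om x y -> locally_2d (planar Om) x y).
{ intros x y H. apply planar_open; auto. }
set (k := sqrt alpha).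
assert (Hq : 0 < 2 * PI / D) by (apply Rdiv_lt_0_compat; lra).
assert (Hkk : alpha = k * k) by (symmetry; apply sqrt_sqrt; nra).
assert (Hk : 2 * PI / D < k).
{ rewrite <- (sqrt_square (2 * PI / D)) by lra. apply sqrt_lt_1; nra. }
assert (HkD : 2 * PI < k * D).
{ apply Rmult_lt_compat_r with (r := D) in Hk; auto.
  replace (2 * PI / D * D) with (2 * PI) in Hk by (field; lra). exact Hk. }
assert (Hpos : forall th, 0 < hf th).
{ intros th. pose proof (HB _ _ (cos_sin_unit th)) as HBt.
  pose proof (sup_height_lt _ _ _ _ _ HBt (Hhf th) (sym_body_origin _ _ HBt)). lra. }
(* The shift 3 PI / 2 = 2 PI - PI / 2 makes the floor [n] such that PI / 2 + 2 n PI lies above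
   [k * hf th1] by at most 2 PI. Nonnegativity makes [n] a natural number, as [sin_period]
   requires. *)
assert (Hx : 0 <= (k * hf th1 + 3 * (PI / 2)) / (2 * PI)).
{ apply Rdiv_le_0_compat; [|lra]. pose proof (Hpos th1). nra. }
destruct (nfloor_ex _ Hx) as [n [Hn1 Hn2]].
apply (Rmult_le_compat_r (2 * PI)) in Hn1; [|lra].
apply (Rmult_lt_compat_r (2 * PI)) in Hn2; [|lra].
assert (Exn : (k * hf th1 + 3 * (PI / 2)) / (2 * PI) * (2 * PI) = k * hf th1 + 3 * (PI / 2)) by (field; lra).
rewrite Exn in Hn1, Hn2.
set (y := PI / 2 + 2 * INR n * PI).
assert (Hcont : continuity hf).
{ intros th. apply continuity_pt_filterlim, (filterlim_locally hf). intros e.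
  set (K := 2 * M + Rabs o1 + Rabs o2).
  assert (HK : 0 <= K).
  { pose proof (HM _ Hup). destruct (dist2_ge (up, uq) (0, 0)) as [D1 _].
    pose proof (Rabs_pos (fst (up, uq) - fst (0, 0))). pose proof (Rabs_pos o1). pose proof (Rabs_pos o2).
    unfold K; lra. }
  assert (Hd : 0 < e / (K + 1)) by (apply Rdiv_lt_0_compat; [apply cond_pos|lra]).
  exists (mkposreal _ Hd). intros th' Hth. change (Rabs (th' - th) < e / (K + 1)) in Hth.
  change (Rabs (hf th' - hf th) < e).
  pose proof (sup_height_lipschitz Om o1 o2 M HM th th' _ _ (Hhf th) (Hhf th')) as L1.
  pose proof (sup_height_lipschitz Om o1 o2 M HM th' th _ _ (Hhf th') (Hhf th)) as L2.
  fold K in L1, L2. rewrite Rabs_minus_sym in L1.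
  assert (Hlt' : (K + 1) * Rabs (th' - th) < e).
  { apply Rmult_lt_compat_l with (r := K + 1) in Hth; [|lra].
    replace ((K + 1) * (e / (K + 1))) with (pos e) in Hth by (field; lra). exact Hth. }
  pose proof (Rabs_pos (th' - th)). apply Rabs_def1; lra. }
assert (Hk0 : 0 < k) by lra.
destruct (IVT_gen hf th1 th2 (y / k) Hcont) as [th [_ Hth]].
{ rewrite Rmin_left, Rmax_right by lra.
  split; apply Rmult_le_reg_r with k; auto; replace (y / k * k) with y by (field; lra); unfold y, D in *; lra. }
assert (Hsin : sin (k * hf th) = 1).
{ rewrite Hth. replace (k * (y / k)) with y by (field; lra). unfold y. rewrite sin_period. apply sin_PI2. }
destruct (helmholtz_frame o1 o2 (cos th) (sin th) (cos_sin_unit th) _ _ _ _ _ _ _ _ Hop HZ) as [XX [XT [TT HZt]]].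
pose proof (normals_with_flux_frame o1 o2 (cos th) (sin th) (cos_sin_unit th) _ _ _ _ HN) as HNt.
pose proof (HB _ _ (cos_sin_unit th)) as HBt.
assert (Hc0 : c = 0).
{ apply (body_no_resonance _ _ _ _ _ k _ _ _ _ _ _ HBt (Hhf th) HZt HNt); auto. }
subst c.
(* Each boundary point gets its own frame, with the point on the positive axis; the gradient found
   there is then rotated back. *)
assert (Hgrad : forall x y, cl (planar Om) x y -> ~ planar Om x y -> G1 (x, y) = 0 /\ G2 (x, y) = 0).
{ intros p q H1 H2.
  assert (Hpq : (p, q) <> (o1, o2)).
  { intros E. injection E; intros -> ->. apply H2.
    pose proof (sym_body_origin _ _ HBt) as HO. unfold frame in HO.
    replace o1 with (o1 + sin th * 0 + cos th * 0) by ring.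
    replace o2 with (o2 - cos th * 0 + sin th * 0) by ring. exact HO. }
  destruct (polar_frame o1 o2 p q Hpq) as [a [b [rho [Hab [Hr [_ [Ep Eq]]]]]]].
  destruct (helmholtz_frame o1 o2 a b Hab _ _ _ _ _ _ _ _ Hop HZ) as [XX' [XT' [TT' HZ']]].
  pose proof (normals_with_flux_frame o1 o2 a b Hab _ _ _ _ HN) as HN'.
  destruct (sup_height_exists Om o1 o2 M Hne Ho Hc HM Hs a b Hab) as [h Hh].
  destruct (body_axis_gradient_zero _ _ _ _ rho _ _ _ _ _ _ (HB a b Hab) Hh HZ' HN' Hr) as [E1 E2].
  - apply cl_frame; auto. rewrite <- Ep, <- Eq. exact H1.
  - unfold frame. rewrite <- Ep, <- Eq. exact H2.
  - unfold frame in E1, E2. rewrite <- Ep, <- Eq in E1, E2.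
    split.
    + transitivity ((a ^ 2 + b ^ 2) * G1 (p, q)); [rewrite Hab; ring|].
      transitivity (b * (b * G1 (p, q) - a * G2 (p, q)) + a * (a * G1 (p, q) + b * G2 (p, q))); [ring|].
      rewrite E1, E2. ring.
    + transitivity ((a ^ 2 + b ^ 2) * G2 (p, q)); [rewrite Hab; ring|].
      transitivity (- a * (b * G1 (p, q) - a * G2 (p, q)) + b * (a * G1 (p, q) + b * G2 (p, q))); [ring|].
      rewrite E1, E2. ring. }
apply Hune.
destruct (frame_onto o1 o2 (cos th) (sin th) (cos_sin_unit th) up uq) as [x [t [Ex Et]]].
assert (Hv := body_zero _ _ _ _ _ _ _ _ _ _ HBt (Hhf th) HZt HNt).
assert (Hv' : frame o1 o2 (cos th) (sin th) (fun x y => u (x, y)) x t = 0).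
{ apply Hv.
  - intros x' t' A1 A2. apply cl_frame in A1; [|apply cos_sin_unit].
    destruct (Hgrad _ _ A1 A2) as [E1 E2]. unfold frame. rewrite E1, E2. split; ring.
  - unfold frame. rewrite <- Ex, <- Et. exact Hup. }
unfold frame in Hv'. rewrite <- Ex, <- Et in Hv'. exact Hv'.
Qed.
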